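(* Let $0<m_1\le\dots\le m_k\le 1$ be real numbers. Consider the $k$-class TASEP on $\mathbb Z_N$ with $[Nm_i]$ particles of class $\le i$, $i=1,\dots,k$. When $(\eta_1,\dots,\eta_k)$ is distributed according to the invariant measure of this process, $\pi_N^k(\eta_1,\dots,\eta_k)=(\pi_N(\eta_1),\dots,\pi_N(\eta_k))$ satisfies, as $N\to\infty$, a large deviation principle on $\mathcal M^k$ (weak topology) with parameter $N$ and good rate function $S_k(\rho_1,\dots,\rho_k)$ given by $$S_k(\rho_1,\dots,\rho_k)=\inf\Big\{\sum_{i=1}^k\int_\Lambda h_{m_i}(\psi_i(u))\,du\ :\ \psi_i\in\mathcal M^{0,b}_{m_i},\ \mathbb C_k(\psi_1,\dots,\psi_k)=(\rho_1,\dots,\rho_k)\Big\},$$ with the convention that the infimum over an empty set is $+\infty$.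
   Context: **Process.** $\mathbb Z_N=\mathbb Z/N\mathbb Z$, $X_N=\{0,1\}^{\mathbb Z_N}$; $\eta\preceq\xi$ means $\eta(x)\le\xi(x)$ for all $x$. The $k$-class TASEP is the continuous time Markov chain on $\{(\eta_1,\dots,\eta_k)\in X_N^k:\eta_i\preceq\eta_{i+1}\}$ with generator $L_Nf(\eta_1,\dots,\eta_k)=\sum_{x\in\mathbb Z_N}\big(f(\eta_1^{e_x},\dots,\eta_k^{e_x})-f(\eta_1,\dots,\eta_k)\big)$, where $\eta^{e_x}(x)=\max\{\eta(x),\eta(x+1)\}$, $\eta^{e_x}(x+1)=\min\{\eta(x),\eta(x+1)\}$ and $\eta^{e_x}(z)=\eta(z)$ otherwise. $\eta_i(x)=1$ means there is a particle of class $\le i$ at $x$. The chain restricted to $\sum_x\eta_i(x)=[Nm_i]$, $i=1,\dots,k$ ($[\cdot]$ = integer part), has a unique invariant measure, which is the one meant. **Measures.** $\Lambda=\mathbb R/\mathbb Z$, positively oriented; for $u,v\in\Lambda$, $[u,v]$ (resp. $(u,v]$) is the closed (resp. left-open) arc going from $u$ to the right to $v$, $[u,u]=\{u\}$. $\mathcal M$ is the set of (finite) positive measures on $\Lambda$ with the weak topology, $\mathcal M_m$ those of total mass $m$; $\mathcal M^{0,b}_m$ is the set of measures in $\mathcal M_m$ absolutely continuous with respect to Lebesgue measure with density a.e. in $[0,1]$. The same symbol denotes a measure and its density. The empirical measure is $\pi_N(\eta)=\frac1N\sum_{x\in\mathbb Z_N}\eta(x)\delta_{x/N}$. **Collapsing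 operators.** For $\rho_1\in\mathcal M_{a}$, $\rho_2\in\mathcal M_{b}$ with $a\le b$, set $E(u,v)=\int_{[u,v]}d\rho_1-\int_{[u,v]}d\rho_2$ and $J(v)=\sup_{u\in\Lambda}[E(u,v)]_+$, with $[\cdot]_+$ the positive part. The collapsed measure $C_{\rho_2}[\rho_1]$ is the measure such that $\int_{(a,b]}dC_{\rho_2}[\rho_1]=\int_{(a,b]}d\rho_1+J(a)-J(b)$ for every interval $(a,b]\subset\Lambda$. For $\psi_i\in\mathcal M_{m_i}$, $m_1\le\dots\le m_k$, define $\mathbb C_k(\psi_1,\dots,\psi_k)=(\xi_1,\dots,\xi_k)$ with $\xi_k=\psi_k$ and $\xi_{k-j}=C_{\psi_k}\big[C_{\psi_{k-1}}\big[\cdots C_{\psi_{k-j+1}}[\psi_{k-j}]\cdots\big]\big]$ for $1\le j\le k-1$. **Functions.** $h_m(x)=x\log\frac{x}{m}+(1-x)\log\frac{1-x}{1-m}$ (usual conventions, $0\log 0=0$, $0\log\frac00=0$). **LDP.** Random elements of a Polish space $X$ with laws $\mu_N$ satisfy a large deviation principle with parameter $N$ and rate function $I:X\to[0,+\infty]$ ($I$ lower semicontinuous) if $\limsup_N N^{-1}\log\mu_N(C)\le-\inf_C I$ for all closed $C$ and $\liminf_N N^{-1}\log\mu_N(O)\ge-\inf_O I$ for all open $O$. $I$ is good if it has compact level sets. *)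

(* Defs.v *)
From HB Require Import structures.
From mathcomp Require Import all_boot all_order all_algebra.
From mathcomp Require Import all_classical all_reals all_analysis.
From mathcomp Require Import measurable_realfun giry.

Set Implicit Arguments.
Unset Strict Implicit.
Unset Printing Implicit Defensive.

Import Order.TTheory GRing.Theory Num.Theory.
Import numFieldNormedType.Exports.

Local Open Scope classical_set_scope.
Local Open Scope ring_scope.

Section circle_rel.
Variable R : realType.

Definition int_diff (x y : R) : bool := (x - y) \is a Num.int.

Lemma int_diff_refl : reflexive int_diff.
Proof. by move=> x; rewrite /int_diff subrr rpred0. Qed.

Lemma int_diff_sym : symmetric int_diff.
Proof. by move=> x y; rewrite /int_diff -[RHS]rpredN opprB. Qed.

Lemma int_diff_trans : transitive int_diff.
Proof.
move=> y x z xy yz; rewrite /int_diff.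
by have -> : x - z = (x - y) + (y - z) by [rewrite addrA subrK]; rewrite rpredD.
Qed.

Canonical int_diff_equiv :=
  EquivRel int_diff int_diff_refl int_diff_sym int_diff_trans.

End circle_rel.

Definition circle (R : realType) :=
  quotient_topology {eq_quot (@int_diff R)}%qT.

HB.instance Definition _ (R : realType) := Quotient.on (circle R).
HB.instance Definition _ (R : realType) := Topological.on (circle R).
HB.instance Definition _ (R : realType) := Pointed.on (circle R).
HB.instance Definition _ (R : realType) :=
  Measurable.copy (circle R) (g_sigma_algebraType (@open (circle R))).

Section arcs.
Variable R : realType.

Definition toC (x : R) : circle R := (\pi_(circle R) x)%qT.

(* The lifts x of u and y of v are chosen with x <= y < x + 1, so that
   [u, u] = {u} and (u, u] is empty. *)
Definition arc_cc (u v : circle R) : set (circle R) :=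
  [set w | exists x y z : R, [/\ toC x = u, toC y = v, toC z = w,
                                 x <= z <= y & y < x + 1]].

Definition arc_oc (u v : circle R) : set (circle R) :=
  [set w | exists x y z : R, [/\ toC x = u, toC y = v, toC z = w,
                                 x < z <= y & y < x + 1]].

Lemma toC_continuous : continuous toC.
Proof. exact: (@pi_continuous _ (circle R)). Qed.

Lemma measurable_toC :
  measurable_fun setT (toC : measurableTypeR R -> circle R).
Proof.
apply: (@measurability _ _ _ _ _ _ (@open (circle R))) => //.
move=> _ [A oA <-]; rewrite setTI; apply: open_measurable.
by move/continuousP : toC_continuous; exact.
Qed.

Definition lebesgueC : set (circle R) -> \bar R :=
  pushforward (mrestr lebesgue_measure (measurable_itv `[0%R, 1%R[)) toC.

Let lebesgueC0 : lebesgueC set0 = 0%E.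
Proof. by rewrite /lebesgueC /pushforward preimage_set0 measure0. Qed.

Let lebesgueC_ge0 A : (0 <= lebesgueC A)%E.
Proof. by rewrite /lebesgueC /pushforward; exact: measure_ge0. Qed.

Let lebesgueC_sigma_additive : semi_sigma_additive lebesgueC.
Proof.
have mtoC A : measurable A -> measurable (toC @^-1` A).
  by move=> mA; rewrite -[X in measurable X]setTI; exact: measurable_toC.
move=> F mF tF mUF; rewrite /lebesgueC /pushforward preimage_bigcup.
apply: measure_semi_sigma_additive.
- by move=> n; exact: mtoC.
- apply/trivIsetP => /= i j _ _ ij; rewrite -preimage_setI.
  by move/trivIsetP : tF => /(_ _ _ _ _ ij) ->//; rewrite preimage_set0.
- by rewrite -preimage_bigcup; exact: mtoC.
Qed.

HB.instance Definition _ := isMeasure.Build _ _ _ lebesgueC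
  lebesgueC0 lebesgueC_ge0 lebesgueC_sigma_additive.

Let lebesgueC_fin : fin_num_fun lebesgueC.
Proof.
apply: lty_fin_num_fun.
rewrite /= /lebesgueC /pushforward /mrestr /= setTI.
by rewrite lebesgue_measure_itv /= lte_fin ltr01 oppr0 adde0 ltry.
Qed.

HB.instance Definition _ := Measure_isFinite.Build _ _ _ lebesgueC
  lebesgueC_fin.

End arcs.

(* The library's measures are set functions defined on all subsets, with
   unspecified values outside the Borel sets: equality of measures is
   agreement on Borel sets, written ≡μ below, and not Leibniz equality.
   The weak topology does not separate two such equal measures. *)
Definition fin_measC (R : realType) : Type :=
  {finite_measure set (circle R) -> \bar R}.

HB.instance Definition _ (R : realType) := gen_eqMixin (fin_measC R).
HB.instance Definition _ (R : realType) := gen_choiceMixin (fin_measC R).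

Definition integrals (R : realType) (mu : fin_measC R) :
    prod_topology (fun _ : continuousType (circle R) R => R : topologicalType) :=
  fun f => (\int[mu]_u f u)%R.

Definition measC (R : realType) : Type := initial_topology (@integrals R).

HB.instance Definition _ (R : realType) := Topological.on (measC R).

Definition measCk (R : realType) (k : nat) : Type :=
  prod_topology (fun _ : 'I_k => measC R : topologicalType).

HB.instance Definition _ (R : realType) (k : nat) := Topological.on (measCk R k).

Section empirical.
Variables (R : realType) (N : nat) (eta : {ffun 'I_N -> bool}).

Definition empirical (A : set (circle R)) : \bar R :=
  (N%:R^-1%:E * \sum_(x < N) ((eta x)%:R%:E * \d_(toC (x%:R / N%:R : R)) A))%E.

Let point_mass (n : nat) : {measure set (circle R) -> \bar R} :=
  mscale ((oapp eta false (insub n))%:R : R)%:nng (dirac (toC (n%:R / N%:R : R))).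

Let empiricalE : empirical = mscale (N%:R^-1 : R)%:nng (msum point_mass N).
Proof.
apply/funext => A; rewrite /empirical /mscale /msum /=; congr (_ * _)%E.
by apply: eq_bigr => x _; rewrite /point_mass /mscale /= valK.
Qed.

Let empirical0 : empirical set0 = 0%E.
Proof. by rewrite empiricalE measure0. Qed.

Let empirical_ge0 A : (0 <= empirical A)%E.
Proof. by rewrite empiricalE measure_ge0. Qed.

Let empirical_sigma_additive : semi_sigma_additive empirical.
Proof. by rewrite empiricalE; exact: measure_semi_sigma_additive. Qed.

HB.instance Definition _ := isMeasure.Build _ _ _ empirical
  empirical0 empirical_ge0 empirical_sigma_additive.

Let empirical_fin : fin_num_fun empirical.
Proof.
move=> A mA; rewrite /empirical fin_numM//; apply/sum_fin_numP => x _ _.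
by rewrite fin_numM// diracE.
Qed.

HB.instance Definition _ := Measure_isFinite.Build _ _ _ empirical
  empirical_fin.

End empirical.

Section tasep.
Variables (R : realType) (N k : nat).

Definition config : Type := {ffun 'I_k -> {ffun 'I_N -> bool}}.

Definition exchange (eta : {ffun 'I_N -> bool}) (x : 'I_N) :
    {ffun 'I_N -> bool} :=
  [ffun z => if z == x then eta x || eta (ordS x)
             else if z == ordS x then eta x && eta (ordS x)
             else eta z].

Definition generator (f : config -> R) (eta : config) : R :=
  \sum_(x < N) (f [ffun i => exchange (eta i) x] - f eta).

Definition state (m : 'I_k -> R) (eta : config) : Prop :=
  (forall i j : 'I_k, j = i.+1 :> nat -> forall x, eta i x <= eta j x)%N /\
  (forall i : 'I_k, \sum_(x < N) eta i x = Num.truncn (N%:R * m i))%N.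

(* Laws on the state space are extended by 0 to all k-tuples. *)
Definition invariant_law (m : 'I_k -> R) (P : config -> R) : Prop :=
  [/\ forall eta, 0 <= P eta,
      \sum_(eta : config) P eta = 1,
      forall eta, ~ state m eta -> P eta = 0 &
      forall f : config -> R, \sum_(eta : config) P eta * generator f eta = 0].

Definition empirical_k (eta : config) : measCk R k :=
  fun i => @empirical R N (eta i) : fin_measC R.

Definition law_empirical (P : config -> R) (A : set (measCk R k)) : R :=
  \sum_(eta : config | empirical_k eta \in A) P eta.

End tasep.

Section collapse.
Variable R : realType.
Implicit Types rho xi : fin_measC R.

Definition arc_excess rho1 rho2 (u v : circle R) : R :=
  fine (rho1 (arc_cc u v)) - fine (rho2 (arc_cc u v)).

Definition queue rho1 rho2 (v : circle R) : R :=
  sup (range (fun u => Num.max (arc_excess rho1 rho2 u v) 0)).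

Definition is_collapse rho2 rho1 xi : Prop :=
  forall a b : circle R, fine (xi (arc_oc a b)) =
    fine (rho1 (arc_oc a b)) + queue rho1 rho2 a - queue rho1 rho2 b.

(* [is_collapse rho2 rho1] determines a measure; the default value of [xget]
   is never used. *)
Definition collapse rho2 rho1 : fin_measC R :=
  xget rho1 [set xi | is_collapse rho2 rho1 xi].

(* The i-th measure is hit by C_(psi_j) for j = i+1, ..., k, in this order. *)
Definition collapse_k (k : nat) (psi : 'I_k -> fin_measC R) (i : 'I_k) :
    fin_measC R :=
  foldl (fun xi j => collapse (psi j) xi) (psi i)
    [seq j : 'I_k <- enum 'I_k | (i < j)%N].

End collapse.

Section rate.
Variable R : realType.
Local Open Scope ereal_scope.
Local Open Scope charge_scope.

(* x log (x / y), with 0 log 0 = 0 log (0 / 0) = 0 and x log (x / 0) = +oo. *)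
Definition xlogxVy (x y : R) : \bar R :=
  if x == 0%R then 0 else if y == 0%R then +oo else (x * ln (x / y))%:E.

Definition hfun (m x : R) : \bar R := xlogxVy x m + xlogxVy (1 - x) (1 - m).

Definition density (psi : fin_measC R) (u : circle R) : R :=
  fine (('d (charge_of_finite_measure psi) '/d (@lebesgueC R)) u).

Definition M0b (m : R) (psi : fin_measC R) : Prop :=
  [/\ psi setT = m%:E, psi `<< @lebesgueC R &
      {ae @lebesgueC R, forall u, (0 <= density psi u <= 1)%R}].

Definition S_k (k : nat) (m : 'I_k -> R) (rho : measCk R k) : \bar R :=
  ereal_inf [set s | exists psi : 'I_k -> fin_measC R,
    [/\ forall i, M0b (m i) (psi i),
        forall i, collapse_k psi i ≡μ (rho i : fin_measC R) &
        s = \sum_(i < k) \int[@lebesgueC R]_u hfun (m i) (density (psi i) u)]].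

End rate.

Section ldp.
Variables (R : realType) (X : topologicalType).
Local Open Scope ereal_scope.

Definition log_rate (mu : nat -> set X -> R) (A : set X) (N : nat) : \bar R :=
  (N%:R^-1)%:E * lne (mu N A)%:E.

Definition LDP (mu : nat -> set X -> R) (I : X -> \bar R) : Prop :=
  [/\ forall x, 0 <= I x,
      lower_semicontinuous I,
      forall C, closed C -> limn_esup (log_rate mu C) <= - ereal_inf (I @` C) &
      forall O, open O -> - ereal_inf (I @` O) <= limn_einf (log_rate mu O)].

Definition good_rate (I : X -> \bar R) : Prop :=
  forall a : R, compact [set x | I x <= a%:E].

End ldp.

(* Main.v *)
From HB Require Import structures.
Require Import Defs.
From mathcomp Require Import all_boot all_order all_algebra.
From mathcomp Require Import finmap all_classical all_reals all_analysis.
From mathcomp Require Import measurable_realfun giry zify ring lra.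

(** The proof rests on three facts.

    The invariant law is the image of a uniform law (Ferrari and Martin). Take
    [k] independent uniform configurations, the lines, with the prescribed
    numbers of particles. The particles of line [i] are the arrivals at a queue
    on the ring whose services are the particles of line [i + 1]; the departures
    are the arrivals at the queue of line [i + 2], and so on up to line [k]. When
    the multi-class process jumps at a site, let the last line jump there and
    let each other line jump at the site to which the bell is passed on by the
    line after it. The queueing map intertwines these dynamics with those of
    the multi-class process ([multiline_map_move]), and the jumps permute the
    pairs of a family of lines and a site, so that they preserve the uniform law
    ([sum_move]). The invariant law is unique, because one and the same word of
    jumps packs every configuration to the left: the chain contracts the total
    variation distance ([invariant_law_uniq]).

    Collapsing is a continuous queueing map. Cut at 0, a measure on the circle
    becomes a distribution function on the unit interval, the collapsing
    operator becomes the explicit functional [fcollapse], and the empirical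
    measures of the multi-class process are exactly the collapsed empirical
    measures of the lines ([dfun_empirical_multiline]). This functional is
    Lipschitz for the uniform distance ([fcollapse_k_near]). Limits of empirical
    distribution functions are profiles, that is monotone functions with
    Lipschitz constant 1, for which uniform closeness is closeness on a fine
    grid ([near_grid]), hence a neighbourhood for pointwise convergence.

    The number of lines close to a profile [F] is exp (N ent F) to first order,
    where [ent F] is the integral of the binary entropy of the density of [F].
    It is also the infimum, over the grids, of the entropies of the increments
    of [F] ([ent_integral]; Jensen's inequality and Lebesgue differentiation).
    From above the lines are counted with weights that are constant on the cells
    of a grid ([card_le_weight]), from below by rounding [F] and rearranging the
    particles in each cell ([card_blocks_ge]). Dividing by the number of all
    lines, exp (N (binent m)) to first order, gives the rate
    [frate F = sum (binent (m i) - ent (F i))], and [S_k] is its infimum over the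
    profiles that represent the given measures ([S_k_le_frate],
    [S_k_lt_frate]).

    The large deviation principle follows. The distribution functions live in a
    compact product of unit intervals, where the sets of profiles of bounded
    rate are compact. The upper bound covers this product by finitely many open
    sets, each of which contains eventually no lines with empirical measure in
    the closed set, or few enough of them ([local_upper_bound]). The lower bound
    counts the lines close to a single profile ([lines_lower]). Cluster points of
    profiles show that [S_k] has compact level sets, and then that it is lower
    semicontinuous, since continuous functions separate the measures
    ([eq_integrals_measure_eq]). *)

Set Implicit Arguments.
Unset Strict Implicit.
Unset Printing Implicit Defensive.

Import Order.TTheory GRing.Theory Num.Theory.
Import numFieldNormedType.Exports.
Local Open Scope classical_set_scope.
Local Open Scope ring_scope.


(** * The circle and distribution functions *)

Section circle_lift.
Variable R : realType.
Implicit Types (x y t : R) (w : circle R).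

Lemma toC_eq x y : (toC x = toC y) <-> ((x - y) \is a Num.int).
Proof.
split; first by move=> /eqmodP.
by move=> h; apply/eqmodP.
Qed.

Lemma toC_repr w : toC (repr w) = w.
Proof. exact: reprK. Qed.

(** The representative of a point of the circle in ]0, 1]; the left-open
    convention matches the arcs (a, b]. *)
Definition clift w : R := repr w - (Num.ceil (repr w))%:~R + 1.

Lemma lift_itv w : 0 < clift w <= 1.
Proof.
rewrite /clift; set x := repr w.
have /andP[h1 h2] := real_ceil_itv (num_real x).
by apply/andP; split; move: h1 h2; rewrite intrB; lra.
Qed.

Lemma toC_lift w : toC (clift w) = w.
Proof.
rewrite -[RHS]toC_repr; apply/toC_eq.
have -> : clift w - repr w = (1 - Num.ceil (repr w))%:~R :> R.
  by rewrite /clift intrB; ring.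
exact: intr_int.
Qed.

Lemma int_itv_eq x y : (x - y) \is a Num.int -> y - 1 < x < y + 1 -> x = y.
Proof.
move=> /intrP[n hn] h.
have : n = 0.
  have h1 : -1 < n%:~R :> R by rewrite -hn; lra.
  have h2 : n%:~R < 1 :> R by rewrite -hn; lra.
  have : (-1 < n)%R by rewrite -(ltr_int R).
  have : (n < 1)%R by rewrite -(ltr_int R).
  by lia.
by move=> n0; move: hn; rewrite n0 => /eqP; rewrite subr_eq0 => /eqP.
Qed.

Lemma liftK x : 0 < x <= 1 -> clift (toC x) = x.
Proof.
move=> hx; have hl := lift_itv (toC x).
apply: int_itv_eq; last by lra.
by apply/toC_eq; rewrite toC_lift.
Qed.

Lemma lift_inj : injective clift.
Proof. by move=> u v uv; rewrite -(toC_lift u) uv toC_lift. Qed.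

Lemma toC01 : toC (0 : R) = toC 1.
Proof. by apply/toC_eq; rewrite sub0r rpredN rpred1. Qed.

Lemma lift0 : clift (toC 0) = 1.
Proof. by rewrite toC01 liftK// ltr01 lexx. Qed.

(** The arc (0, t] of the circle; the whole circle when [t = 1]. *)
Definition iarc t : set (circle R) := clift @^-1` `]-oo, t]%classic.

Lemma iarcE t w : iarc t w <-> clift w <= t.
Proof. by rewrite /iarc /= in_itv. Qed.

Lemma iarc1 : iarc 1 = setT.
Proof.
apply/seteqP; split => // w _; apply/iarcE.
by have /andP[] := lift_itv w.
Qed.

Lemma open_toC (U : set R) : open U -> open (@toC R @` U : set (circle R)).
Proof.
move=> oU.
suff : open ((@toC R) @^-1` (@toC R @` U)) by [].
rewrite (_ : _ @^-1` _ = \bigcup_(n in [set: int]) ((fun x => x + n%:~R) @^-1` U)).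
  apply: bigcup_open => n _; apply: open_comp => // x _.
  by apply: cvgD; [exact: cvg_id|exact: cvg_cst].
apply/seteqP; split => x /=.
  move=> [y Uy /toC_eq /intrP[n yx]]; exists n => //=.
  by have -> : x + n%:~R = y by rewrite -yx; ring.
move=> [n _ /= Ux]; exists (x + n%:~R) => //; apply/toC_eq.
by rewrite addrAC subrr add0r intr_int.
Qed.

Lemma measurable_iarc t : measurable (iarc t).
Proof.
have mo (U : set R) : open U -> measurable (@toC R @` U : set (circle R)).
  by move=> /open_toC oU; apply: sub_sigma_algebra.
have [t1|t1] := leP 1 t.
  have E : iarc t = setT.
    apply/seteqP; split => w // _; apply/iarcE.
    by have /andP[_ /le_trans] := lift_itv w; exact.
  by rewrite E; exact: measurableT.
have [t0|t0] := ltP t 0.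
  have E : iarc t = set0.
    apply/seteqP; split => w // /iarcE wt.
    by have /andP[] := lift_itv w; lra.
  by rewrite E; exact: measurable0.
(* The sigma-algebra is generated by the images of the open sets of the line. *)
suff -> : iarc t = @toC R @` `]0, ((1 + t) / 2)[ `\` @toC R @` `]t, ((1 + t) / 2)[.
  by apply: measurableD; apply: mo; exact: interval_open.
apply/seteqP; split => w.
  move=> /iarcE wt; split.
    exists (clift w); last exact: toC_lift.
    by have /andP[] := lift_itv w; rewrite /= in_itv /=; lra.
  move=> /= [x]; rewrite in_itv/= => hx xw.
  by move: wt; rewrite -xw liftK; lra.
move=> [[x]]; rewrite /= in_itv/= => hx <- h; apply/iarcE.
rewrite liftK; last by lra.
have [//|tx] := leP x t.
exfalso; apply: h; exists x => //; rewrite /= in_itv/=; lra.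
Qed.

Lemma measurable_lift :
  measurable_fun setT (clift : circle R -> measurableTypeR R).
Proof.
apply: (@measurability _ _ _ _ _ _ (@RGenOInfty.G R)).
  exact: RGenOInfty.measurableE.
move=> _ [_ [x ->] <-]; rewrite setTI -setCitvl preimage_setC.
by apply: measurableC; exact: (measurable_iarc x).
Qed.

Lemma iarcS s t : s <= t -> iarc s `<=` iarc t.
Proof. by move=> st w /iarcE ws; apply/iarcE/(le_trans ws). Qed.

Lemma iarc0 t : t <= 0 -> iarc t = set0.
Proof.
move=> t0; apply/seteqP; split => w // /iarcE wt.
by have /andP[] := lift_itv w; lra.
Qed.

End circle_lift.

Section distribution_function.
Variable R : realType.
Implicit Types (s t : R) (mu nu : fin_measC R).
Local Notation iarc := (@iarc R).

Definition dfun mu t : R := fine (mu (iarc t)).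

Lemma fin_measC_fin mu (A : set (circle R)) : measurable A -> mu A \is a fin_num.
Proof. by move=> mA; exact: fin_num_measure. Qed.

Lemma dfunE mu t : (dfun mu t)%:E = mu (iarc t).
Proof. by rewrite fineK// fin_measC_fin//; exact: measurable_iarc. Qed.

Lemma dfun1 mu : (dfun mu 1)%:E = mu setT.
Proof. by rewrite dfunE iarc1. Qed.

Lemma dfun0 mu : dfun mu 0 = 0.
Proof. by rewrite /dfun iarc0// measure0. Qed.

Lemma dfunB mu s t : s <= t ->
  mu (iarc t `\` iarc s) = (dfun mu t - dfun mu s)%:E.
Proof.
move=> st; rewrite measureD//; try exact: measurable_iarc.
- have -> : iarc t `&` iarc s = iarc s by apply/setIidPr/iarcS.
  by rewrite EFinB !dfunE.
- by have := fin_measC_fin mu (measurable_iarc t); rewrite ge0_fin_numE.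
Qed.

(** The half-lines ]-oo, t] form a pi-system generating the Borel sets of the
    line, and [clift] embeds the circle measurably into the line. *)
Lemma dfun_measure_eq mu nu :
  (forall t, 0 <= t <= 1 -> dfun mu t = dfun nu t) -> mu ≡μ nu.
Proof.
move=> h.
have h' t : mu (iarc t) = nu (iarc t).
  rewrite -!dfunE; have [t0|t0] := leP t 0.
    by rewrite /dfun iarc0// !measure0.
  have [t1|t1] := leP t 1; first by rewrite h ?(ltW t0).
  suff E : iarc t = iarc 1 by rewrite /dfun E -/(dfun mu 1) h// ler01 lexx.
  apply/seteqP; split; last exact/iarcS/ltW.
  by rewrite iarc1; exact: subsetT.
pose mu' : {measure set (measurableTypeR R) -> \bar R} :=
  measure_function_pushforward__canonical__measure_function_Measure
    mu (@measurable_lift R).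
pose nu' : {measure set (measurableTypeR R) -> \bar R} :=
  measure_function_pushforward__canonical__measure_function_Measure
    nu (@measurable_lift R).
have mu'nu' (B : set (measurableTypeR R)) : measurable B -> mu' B = nu' B.
  pose G := [set A : set (measurableTypeR R) | exists x : R, A = `]-oo, x]%classic].
  apply: (@measure_unique _ _ _ G (fun n => `]-oo, n%:R]%classic)) => //.
  - rewrite [LHS](@RGenOInfty.measurableE R) eqEsubset; split => B'.
      apply: smallest_sub; first exact: smallest_sigma_algebra.
      move=> _ [x ->]; rewrite -setCitvl.
      have [_ + _] := smallest_sigma_algebra setT G.
      move=> /(_ `]-oo, x]%classic); rewrite setTD; apply.
      by apply: sub_sigma_algebra; exists x.
    apply: smallest_sub; first exact: smallest_sigma_algebra.
    move=> _ [x ->]; rewrite -(setCK `]-oo, x]%classic) setCitvl.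
    have [_ + _] := smallest_sigma_algebra setT (@RGenOInfty.G R).
    move=> /(_ `]x, +oo[%classic); rewrite setTD; apply.
    by apply: sub_sigma_algebra; exists x.
  - move=> _ _ [x ->] [y ->]; exists (Num.min x y).
    by apply/seteqP; split => z /=; rewrite !in_itv/= le_min => /andP.
  - by move=> n; exists n%:R.
  - apply/seteqP; split => // x _; exists (Num.truncn x).+1 => //=.
    by rewrite in_itv/= ltW// truncnS_gt.
  - by move=> _ [x ->]; exact: h'.
  - move=> n; have := fin_measC_fin mu (measurable_iarc n%:R).
    by rewrite ge0_fin_numE.
move=> A mA.
have -> : A = @clift R @^-1` (@toC R @^-1` A).
  by apply/seteqP; split => w /=; rewrite toC_lift.
apply: (mu'nu' (@toC R @^-1` A)).
by rewrite -[X in measurable X]setTI; exact: measurable_toC.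
Qed.
End distribution_function.

(** * Collapsing distribution functions *)

Section collapse_of_functions.
Variable R : realType.
Implicit Types (s t u v d e : R) (F G W : R -> R).

Definition bounded01 W := exists M, forall t, 0 <= t <= 1 -> `|W t| <= M.

Definition near01 d F G := forall t, 0 <= t <= 1 -> `|F t - G t| <= d.

Definition nondecr01 F := forall s t, 0 <= s -> s <= t -> t <= 1 -> F s <= F t.

(** Distribution functions of the measures of mass [m] with density at most 1. *)
Definition profile (m : R) F := [/\ F 0 = 0, F 1 = m &
  forall s t, 0 <= s -> s <= t -> t <= 1 -> 0 <= F t - F s <= t - s].

(** Increment of [W] over the arc from [u] to [t], when [W] is the distribution
    function of a signed measure on the circle cut at 0: the arc goes through
    the cut as soon as [t < u], and then picks up the total mass [W 1]. *)
Definition arc_inc W u t := W t - W u + (if u <= t then 0 else W 1).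

(** The queue length [queue] read on distribution functions; the positive part
    is recovered from [u = t]. *)
Definition fqueue W t := sup [set arc_inc W u t | u in `[0, 1]%classic].

(** The collapsing operator in terms of distribution functions. *)
Definition fcollapse F G t := F t + fqueue (F \- G) 0 - fqueue (F \- G) t.

Lemma fqueue_set_neq0 W t : [set arc_inc W u t | u in `[0, 1]%classic] !=set0.
Proof. by exists (arc_inc W 0 t), 0 => //=; rewrite in_itv/= lexx ler01. Qed.

Lemma fqueue_has_sup W t : bounded01 W -> 0 <= t <= 1 ->
  has_sup [set arc_inc W u t | u in `[0, 1]%classic].
Proof.
move=> [M hM] t01; split; first exact: fqueue_set_neq0.
exists (M + M + M) => y [u /=]; rewrite in_itv/= => u01 <-.
rewrite /arc_inc; have := hM _ u01; have := hM _ t01.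
have : `|W 1| <= M by apply: hM; rewrite ler01 lexx.
by rewrite !ler_norml; case: ifP; lra.
Qed.

Lemma arc_inc_le_fqueue W u t : bounded01 W -> 0 <= t <= 1 -> 0 <= u <= 1 ->
  arc_inc W u t <= fqueue W t.
Proof.
move=> bW t01 u01; apply: ub_le_sup; first exact: (fqueue_has_sup bW t01).2.
by exists u => //=; rewrite in_itv.
Qed.

Lemma fqueue_le W t x : (forall u, 0 <= u <= 1 -> arc_inc W u t <= x) ->
  fqueue W t <= x.
Proof.
move=> h; apply: ge_sup; first exact: fqueue_set_neq0.
by move=> y [u /=]; rewrite in_itv/= => /h + <-.
Qed.

Lemma fqueue_ge0 W t : bounded01 W -> 0 <= t <= 1 -> 0 <= fqueue W t.
Proof.
move=> bW t01; have := arc_inc_le_fqueue bW t01 t01.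
by rewrite /arc_inc lexx subrr addr0.
Qed.

Lemma bounded01B F G : bounded01 F -> bounded01 G -> bounded01 (F \- G).
Proof.
move=> [M hM] [M' hM']; exists (M + M') => t t01 /=.
by rewrite (le_trans (ler_normB _ _))// lerD ?hM ?hM'.
Qed.

Lemma bounded01_fqueue W : bounded01 W -> bounded01 (fqueue W).
Proof.
move=> bW; have [M hM] := bW; exists (M + M + M) => t t01.
rewrite ger0_norm ?fqueue_ge0//; apply: fqueue_le => u u01.
rewrite /arc_inc; have := hM _ u01; have := hM _ t01.
have : `|W 1| <= M by apply: hM; rewrite ler01 lexx.
by rewrite !ler_norml; case: ifP; lra.
Qed.

Lemma bounded01_fcollapse F G : bounded01 F -> bounded01 G ->
  bounded01 (fcollapse F G).
Proof.
move=> bF bG; have [M hM] := bF.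
have [L hL] := bounded01_fqueue (bounded01B bF bG).
exists (M + L + L) => t t01; rewrite /fcollapse.
have := hM _ t01; have := hL _ t01.
have : `|fqueue (F \- G) 0| <= L by apply: hL; rewrite lexx ler01.
by rewrite !ler_norml; lra.
Qed.

Lemma fqueue_le_near d W W' t : bounded01 W' -> near01 d W W' ->
  0 <= t <= 1 -> fqueue W t <= fqueue W' t + 3 * d.
Proof.
move=> bW' WW' t01; apply: fqueue_le => u u01.
apply: le_trans (_ : arc_inc W' u t + 3 * d <= _).
  rewrite /arc_inc; have := WW' _ u01; have := WW' _ t01.
  have : `|W 1 - W' 1| <= d by apply: WW'; rewrite ler01 lexx.
  by rewrite !ler_norml; case: ifP; lra.
by rewrite lerD2r arc_inc_le_fqueue.
Qed.

Lemma near01C d F G : near01 d F G -> near01 d G F.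
Proof. by move=> h t t01; rewrite distrC h. Qed.

Lemma fqueue_near d W W' : bounded01 W -> bounded01 W' -> near01 d W W' ->
  near01 (3 * d) (fqueue W) (fqueue W').
Proof.
move=> bW bW' WW' t t01.
have := fqueue_le_near bW' WW' t01.
have := fqueue_le_near bW (near01C WW') t01.
by rewrite ler_norml; lra.
Qed.

(** The constant is 13 = 1 + 2 * 3 * 2: the arrivals, and two queue lengths, each
    a supremum of combinations of three values of a difference of two functions. *)
Lemma fcollapse_near d F G F' G' : bounded01 F -> bounded01 G ->
  bounded01 F' -> bounded01 G' -> near01 d F F' -> near01 d G G' ->
  near01 (13 * d) (fcollapse F G) (fcollapse F' G').
Proof.
move=> bF bG bF' bG' FF' GG' t t01; rewrite /fcollapse.
have h : near01 (2 * d) (F \- G) (F' \- G').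
  move=> s s01 /=; have := FF' _ s01; have := GG' _ s01.
  by rewrite !ler_norml; lra.
have q := fqueue_near (bounded01B bF bG) (bounded01B bF' bG') h.
have := q _ t01; have := FF' _ t01.
have : `|fqueue (F \- G) 0 - fqueue (F' \- G') 0| <= 3 * (2 * d).
  by apply: q; rewrite lexx ler01.
by rewrite !ler_norml; lra.
Qed.

Lemma profile_bounded m F : profile m F -> bounded01 F.
Proof.
move=> [F0 _ h]; exists 1 => t /andP[t0 t1].
by have := h 0 t (lexx _) t0 t1; rewrite F0 ler_norml; lra.
Qed.

(** Both the initial time and the final time stand for the point 0 of the
    circle. *)
Lemma fqueue01 W : bounded01 W -> W 0 = 0 -> W 1 <= 0 ->
  fqueue W 1 = fqueue W 0.
Proof.
move=> bW W0 W1.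
have i0 : 0 <= (0 : R) <= 1 by rewrite lexx ler01.
have i1 : 0 <= (1 : R) <= 1 by rewrite lexx ler01.
apply/le_anti/andP; split; apply: fqueue_le => u /[dup] u01 /andP[u0 u1].
  rewrite /arc_inc u1; have [->|un0] := eqVneq u 0.
    by have := fqueue_ge0 bW i0; rewrite W0; lra.
  apply: le_trans (arc_inc_le_fqueue bW i0 u01).
  have {un0}u0' : 0 < u by rewrite lt_neqAle eq_sym un0.
  by rewrite /arc_inc (lt_geF u0') W0; lra.
have [ul0|u_gt0] := leP u 0.
  have -> : u = 0 by lra.
  by rewrite /arc_inc lexx subrr addr0 fqueue_ge0.
apply: le_trans (arc_inc_le_fqueue bW i1 u01).
by rewrite /arc_inc u1 (lt_geF u_gt0) W0; lra.
Qed.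

Lemma fqueue_ge_shift W s t : bounded01 W -> W 1 <= 0 ->
  0 <= s -> s <= t -> t <= 1 -> fqueue W s + (W t - W s) <= fqueue W t.
Proof.
move=> bW W1 s0 st t1; rewrite -lerBrDr; apply: fqueue_le => u u01.
have t01 : 0 <= t <= 1 by lra.
have := arc_inc_le_fqueue bW t01 u01.
rewrite /arc_inc; case: (leP u s) => us; case: (leP u t) => ut; lra.
Qed.

(** The queue over [s, t] is either the queue at [s] carried along, or has
    been built up from an empty queue inside [s, t]. *)
Lemma fqueue_le_shift W s t x : bounded01 W -> W 1 <= 0 ->
  0 <= s -> s <= t -> t <= 1 -> fqueue W s + (W t - W s) <= x ->
  (forall u, s <= u <= t -> W t - W u <= x) -> fqueue W t <= x.
Proof.
move=> bW W1 s0 st t1 hs hu; apply: fqueue_le => u u01.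
have s01 : 0 <= s <= 1 by lra.
have := arc_inc_le_fqueue bW s01 u01.
rewrite /arc_inc; case: (leP u s) => us; case: (leP u t) => ut; try lra.
by move=> _; have := hu u; rewrite ltW ?ut//= => /(_ isT); lra.
Qed.

(** Departures are caused by services, so they inherit the Lipschitz bound of
    [G]; they are nonnegative because the queue cannot grow faster than the
    arrivals. *)
Lemma profile_fcollapse m m' F G : profile m F -> profile m' G -> m <= m' ->
  profile m (fcollapse F G).
Proof.
move=> pF pG mm'; have bF := profile_bounded pF; have bG := profile_bounded pG.
have bW := bounded01B bF bG; move: pF pG => [F0 F1 hF] [G0 G1 hG].
have W0 : (F \- G) 0 = 0 by rewrite /= F0 G0 subrr.
have W1 : (F \- G) 1 <= 0 by rewrite /= F1 G1 subr_le0.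
split.
- by rewrite /fcollapse F0 add0r subrr.
- by rewrite /fcollapse F1 fqueue01// addrK.
- move=> s t s0 st t1; rewrite /fcollapse.
  have h1 := fqueue_ge_shift bW W1 s0 st t1.
  have hFst := hF _ _ s0 st t1; have hGst := hG _ _ s0 st t1.
  have h2 : fqueue (F \- G) t <= fqueue (F \- G) s + (F t - F s).
    apply: (fqueue_le_shift bW W1 s0 st t1) => /=; first by lra.
    move=> u /andP[su ut].
    have := hF _ _ s0 su (le_trans ut t1).
    have := hF _ _ (le_trans s0 su) ut t1.
    have := hG _ _ (le_trans s0 su) ut t1.
    have : 0 <= fqueue (F \- G) s by apply: fqueue_ge0 => //; lra.
    by lra.
  by move: h1 => /=; lra.
Qed.

(** The order of the collapsings is that of [collapse_k]. *)
Definition fcollapse_k k (F : 'I_k -> R -> R) (i : 'I_k) : R -> R :=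
  foldl (fun G j => fcollapse G (F j)) (F i) [seq j : 'I_k <- enum 'I_k | (i < j)%N].

(** The multi-class measures depend continuously on the lines: this replaces the
    contraction principle in the proof of the large deviation principle. *)
Lemma fcollapse_k_near k (F G : 'I_k -> R -> R) d : 0 <= d ->
  (forall i, bounded01 (F i)) -> (forall i, bounded01 (G i)) ->
  (forall i, near01 d (F i) (G i)) ->
  forall i, near01 (13 ^+ k * d) (fcollapse_k F i) (fcollapse_k G i).
Proof.
move=> d0 bF bG FG i; rewrite /fcollapse_k.
set s := [seq _ <- _ | _].
have : (size s <= k)%N.
  by rewrite size_filter (leq_trans (count_size _ _))// size_enum_ord.
suff h e X Y : d <= e -> bounded01 X -> bounded01 Y -> near01 e X Y ->
    near01 (13 ^+ size s * e) (foldl (fun G j => fcollapse G (F j)) X s)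
      (foldl (fun H j => fcollapse H (G j)) Y s).
  move=> sk t t01; apply: le_trans (h _ _ _ (lexx d) (bF i) (bG i) (FG i) t t01) _.
  by rewrite ler_wpM2r// ler_eXn2l// ltr1n.
elim: s e X Y => [|j s IH] e X Y de bX bY XY; first by rewrite expr0 mul1r.
(* The errors of the two arguments of a collapsing must be bounded by the same number. *)
rewrite /= exprSr -mulrA; apply: IH.
- by rewrite (le_trans de)// ler_peMl// ?ler1n// (le_trans d0).
- exact: bounded01_fcollapse.
- exact: bounded01_fcollapse.
- apply: fcollapse_near => //.
  by move=> t t01; rewrite (le_trans (FG j t t01)).
Qed.

Lemma profile_fcollapse_k k (m : 'I_k -> R) (F : 'I_k -> R -> R) :
  (forall i j : 'I_k, (i <= j)%N -> m i <= m j) ->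
  (forall i, profile (m i) (F i)) ->
  forall i, profile (m i) (fcollapse_k F i).
Proof.
move=> mm pF i; rewrite /fcollapse_k.
have : all (fun j : 'I_k => (i < j)%N) [seq j : 'I_k <- enum 'I_k | (i < j)%N].
  exact: filter_all.
elim: [seq _ <- _ | _] (F i) (pF i) => [|j s IH] X pX //= /andP[ij hs].
apply: IH => //; apply: profile_fcollapse pX (pF j) _.
exact/mm/ltnW.
Qed.

End collapse_of_functions.

(** * Arcs in terms of distribution functions *)

Section arcs_and_distribution_functions.
Variable R : realType.
Implicit Types (u v w : circle R) (mu : fin_measC R).

Lemma toCD1 (x : R) : toC (x + 1) = toC x.
Proof. by apply/toC_eq; rewrite addrAC subrr add0r rpred1. Qed.

(** An arc that passes through 0 is the complement of one that does not. *)
Lemma arc_ocE u v : arc_oc u v =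
  if clift u <= clift v then iarc (clift v) `\` iarc (clift u)
  else ~` (iarc (clift u) `\` iarc (clift v)).
Proof.
have hu := lift_itv u; have hv := lift_itv v.
have lK (x : R) (w : circle R) (n : int) : toC x = w -> 0 < x + n%:~R <= 1 ->
    clift w = x + n%:~R.
  move=> <- h; rewrite -(liftK h); congr clift; apply/toC_eq.
  by rewrite opprD addrA subrr add0r rpredN intr_int.
have hw (w : circle R) (x : R) : toC x = w -> exists n : int, x = clift w + n%:~R.
  move=> xw; have /toC_eq/intrP[n hn] : toC x = toC (clift w) by rewrite toC_lift.
  by exists n; rewrite -hn; ring.
have [ab|ba] := leP (clift u) (clift v); apply/seteqP; split => w /=.
- move=> [x [y [z [/hw[n ->] /hw[p ->] zw xzy yx]]]].
  have pn : p = n.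
    apply/eqP; rewrite eq_le -(ler_int R) -[X in _ && X](ler_int R).
    have : (p%:~R - n%:~R < 1 :> R) by lra.
    have : (-1 < p%:~R - n%:~R :> R) by lra.
    rewrite -intrB (_ : -1 = (-1)%:~R)// (_ : 1 = 1%:~R)// !ltr_int => h1 h2.
    by rewrite !ler_int; lia.
  have zl : clift w = z + (- n)%:~R by apply: lK => //; rewrite intrN; move: pn => -> in xzy *; lra.
  by split; [apply/iarcE|move/iarcE]; rewrite zl intrN; move: pn => -> in xzy *; lra.
- move=> [/iarcE wv wu].
  have {}wu : clift u < clift w by rewrite ltNge; apply/negP => /iarcE.
  by exists (clift u), (clift v), (clift w); rewrite !toC_lift; split => //; lra.
- move=> [x [y [z [/hw[n ->] /hw[p ->] zw xzy yx]]]].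
  have pn : p = n + 1.
    have : (p%:~R - n%:~R < 2 :> R) by lra.
    have : (0 < p%:~R - n%:~R :> R) by lra.
    rewrite -intrB (_ : 2 = 2%:~R)// (_ : 0 = 0%:~R)// !ltr_int => h1 h2.
    by lia.
  move=> [/iarcE wu wv]; subst p; rewrite intrD in xzy yx.
  have {}wv : clift v < clift w by rewrite ltNge; apply/negP => /iarcE.
  have [zn|zn] := leP (z + (- n)%:~R) 1.
    have zl : clift w = z + (- n)%:~R by apply: lK => //; rewrite intrN in zn *; lra.
    by move: zl; rewrite intrN; lra.
  have zl : clift w = z + (- n - 1)%:~R.
    by apply: lK => //; rewrite intrB intrN in zn *; lra.
  by move: zl; rewrite intrB intrN; lra.
- move=> h; have hlw := lift_itv w.
  have [wv|wv] := leP (clift w) (clift v).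
    by exists (clift u), (clift v + 1), (clift w + 1); split; rewrite ?(toCD1 (clift _)) ?toC_lift//; lra.
  have wu : clift u < clift w.
    by rewrite ltNge; apply/negP => wu; apply: h; split; [exact/iarcE|move/iarcE; lra].
  by exists (clift u), (clift v + 1), (clift w); split; rewrite ?(toCD1 (clift _)) ?toC_lift//; lra.
Qed.

Lemma measurable_arc_oc u v : measurable (arc_oc u v).
Proof.
rewrite arc_ocE; case: ifP => _; [|apply: measurableC];
  apply: measurableD; exact: measurable_iarc.
Qed.

Lemma measure_arc_oc mu u v :
  fine (mu (arc_oc u v)) = arc_inc (dfun mu) (clift u) (clift v).
Proof.
rewrite arc_ocE /arc_inc; case: leP => uv.
  by rewrite dfunB//= addr0.
transitivity (fine (mu setT - mu (iarc (clift u) `\` iarc (clift v)))%E).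
  rewrite -setTD measureD//; last 2 first.
  - by apply: measurableD; exact: measurable_iarc.
  - by have := fin_measC_fin mu (@measurableT _ (circle R)); rewrite ge0_fin_numE.
  by rewrite setTI.
rewrite dfunB ?ltW// -(dfun1 mu) -EFinB /=; ring.
Qed.

Lemma arc_ccE u v : arc_cc u v = [set u] `|` arc_oc u v.
Proof.
apply/seteqP; split => w /=.
  move=> [x [y [z [xu yv zw /andP[xz zy] yx]]]].
  move: xz; rewrite le_eqVlt => /orP[/eqP xz|xz].
    by left; rewrite -zw -xz.
  by right; exists x, y, z; split => //; rewrite xz.
move=> [->|[x [y [z [xu yv zw /andP[xz zy] yx]]]]]; last first.
  by exists x, y, z; split => //; rewrite ltW.
have hu := lift_itv u; have hv := lift_itv v.
have [uv|uv] := leP (clift u) (clift v).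
  by exists (clift u), (clift v), (clift u); rewrite !toC_lift; split => //; lra.
by exists (clift u), (clift v + 1), (clift u); split; rewrite ?(toCD1 (clift _)) ?toC_lift//; lra.
Qed.

Lemma measurable_point u : measurable [set u].
Proof.
have -> : [set u] = @clift R @^-1` [set clift u].
  apply/seteqP; split => w /=; first by move=> ->.
  exact: lift_inj.
by rewrite -[X in measurable X]setTI; apply: measurable_lift.
Qed.

Lemma profile_point m mu u : profile m (dfun mu) -> mu [set u] = 0%E.
Proof.
move=> [_ _ h]; apply/eqP; rewrite eq_le measure_ge0 andbT.
apply/lee_addgt0Pr => e e0; rewrite add0e.
have hu := lift_itv u.
pose s := Num.max 0 (clift u - e).
have su : s < clift u by rewrite /s gt_max; lra.
have s0 : 0 <= s by rewrite /s le_max lexx.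
have se : clift u - s <= e by rewrite /s lerBlDl -lerBlDr le_max lexx orbT.
have hp := h s (clift u) s0 (ltW su) (andP hu).2.
apply: (@le_trans _ _ (mu (iarc (clift u) `\` iarc s))).
  apply: le_measure; rewrite ?inE.
  - exact: measurable_point.
  - by apply: measurableD; exact: measurable_iarc.
  - by move=> _ ->; split; [exact/iarcE|move/iarcE; lra].
by rewrite (dfunB _ (ltW su)) lee_fin; lra.
Qed.

(** A measure with bounded density does not see the end points of the arcs. *)
Lemma measure_arc_cc m mu u v : profile m (dfun mu) ->
  fine (mu (arc_cc u v)) = arc_inc (dfun mu) (clift u) (clift v).
Proof.
move=> pmu; rewrite -measure_arc_oc arc_ccE; congr fine.
apply/eqP; rewrite eq_le; apply/andP; split.
  have : (mu ([set u] `|` arc_oc u v) <= mu [set u] + mu (arc_oc u v))%E.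
    by apply: measureU2; [exact: measurable_point|exact: measurable_arc_oc].
  by rewrite (profile_point _ pmu) add0e.
apply: le_measure; rewrite ?inE.
- exact: measurable_arc_oc.
- by apply: measurableU; [exact: measurable_point|exact: measurable_arc_oc].
- exact: subsetUr.
Qed.

Lemma arc_incB F G s t : arc_inc (F \- G) s t = arc_inc F s t - arc_inc G s t :> R.
Proof. by rewrite /arc_inc/=; case: ifP => _; ring. Qed.

(** A starting point of the queue at 0 is a starting point at 1 as well, and the
    empty arc gives the positive part. *)
Lemma queueE m1 m2 (r1 r2 : fin_measC R) v : profile m1 (dfun r1) -> profile m2 (dfun r2) ->
  m1 <= m2 -> queue r1 r2 v = fqueue (dfun r1 \- dfun r2) (clift v).
Proof.
move=> p1 p2 m12; set W := dfun r1 \- dfun r2.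
have bW : bounded01 W by apply: bounded01B; [exact: profile_bounded p1|exact: profile_bounded p2].
have hv := lift_itv v.
have v01 : 0 <= clift v <= 1 by lra.
have ex u : arc_excess r1 r2 u v = arc_inc W (clift u) (clift v).
  by rewrite /arc_excess (measure_arc_cc _ _ p1) (measure_arc_cc _ _ p2) arc_incB.
have hub u : Num.max (arc_excess r1 r2 u v) 0 <= fqueue W (clift v).
  rewrite ge_max fqueue_ge0// andbT ex arc_inc_le_fqueue//.
  by have := lift_itv u; lra.
have hs : has_sup (range (fun u => Num.max (arc_excess r1 r2 u v) 0)).
  split; first by exists (Num.max (arc_excess r1 r2 v v) 0), v.
  by exists (fqueue W (clift v)) => _ [u _ <-].
have lb u : Num.max (arc_excess r1 r2 u v) 0 <= queue r1 r2 v.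
  by apply: ub_le_sup; [exact: hs.2|exists u].
apply/le_anti/andP; split.
  apply: ge_sup; first exact: hs.1.
  by move=> _ [u _ <-].
apply: fqueue_le => t /andP[t0 t1].
move: t0; rewrite le_eqVlt => /orP[/eqP t0|t0]; last first.
  apply: le_trans (lb (toC t)); rewrite ex liftK ?t0//.
  by rewrite le_max lexx.
apply: le_trans (lb (toC 1)); rewrite ex liftK ?ltr01 ?lexx// -t0.
have W0 : W 0 = 0 by rewrite /W/= !dfun0 subrr.
have W1 : W 1 <= 0.
  by move: p1 p2 => [_ p1 _] [_ p2 _]; rewrite /W/= p1 p2 subr_le0.
rewrite /arc_inc le_max; move: v01 => /andP[-> v1]; rewrite W0.
case: (leP 1 (clift v)) => h.
  have -> : clift v = 1 by lra.
  by apply/orP; right; lra.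
by apply/orP; left; lra.
Qed.

(** Cutting the circle at 0 turns the defining property of the collapsed
    measure into an equality of distribution functions. *)
Lemma is_collapseP m1 m2 (r1 r2 xi : fin_measC R) :
  profile m1 (dfun r1) -> profile m2 (dfun r2) -> m1 <= m2 ->
  is_collapse r2 r1 xi <->
  forall t, 0 <= t <= 1 -> dfun xi t = fcollapse (dfun r1) (dfun r2) t.
Proof.
move=> p1 p2 m12; set W := dfun r1 \- dfun r2.
have bW : bounded01 W by apply: bounded01B; [exact: profile_bounded p1|exact: profile_bounded p2].
have W0 : W 0 = 0 by rewrite /W/= !dfun0 subrr.
have W1 : W 1 <= 0.
  by move: p1 p2 => [_ p1 _] [_ p2 _]; rewrite /W/= p1 p2 subr_le0.
have q01 := fqueue01 bW W0 W1.
have i11 : 0 < (1 : R) <= 1 by rewrite ltr01 lexx.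
split => [h|h u v].
  have h' (a b : R) : 0 < a <= 1 -> 0 < b <= 1 -> arc_inc (dfun xi) a b =
      arc_inc (dfun r1) a b + fqueue W a - fqueue W b.
    move=> ha hb; have := h (toC a) (toC b).
    by rewrite !measure_arc_oc !(queueE _ p1 p2)// !liftK.
  have ht (t : R) : 0 < t < 1 -> dfun xi t = fcollapse (dfun r1) (dfun r2) t.
    move=> /andP[t0 t1]; have := h' 1 t i11; rewrite t0 ltW// => /(_ isT).
    by rewrite /arc_inc !(lt_geF t1) q01 /fcollapse -/W; lra.
  move=> t /andP[]; rewrite le_eqVlt => /orP[/eqP <- _|t0].
    by rewrite /fcollapse !dfun0 -/W add0r subrr.
  rewrite le_eqVlt => /orP[/eqP ->|t1]; last by apply: ht; rewrite t0.
  (* The total mass is recovered by going around the circle through the point 1/2. *)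
have h2 : 0 < (2^-1 : R) < 1 by lra.
  have := h' (2^-1) 1 _ i11; have -> : 0 < (2^-1 : R) <= 1 by lra.
  move=> /(_ isT); have := ht _ h2.
  have h3 : (2^-1 : R) <= 1 by lra.
  by rewrite /arc_inc h3 /fcollapse -/W q01 => ->; lra.
have hu := lift_itv u; have hv := lift_itv v.
rewrite !measure_arc_oc !(queueE _ p1 p2)// -/W.
rewrite /arc_inc (h (clift u)) ?(h (clift v)) ?(h 1); try lra.
by rewrite /fcollapse -/W q01; case: ifP => _; lra.
Qed.

End arcs_and_distribution_functions.

(** * Measures with density at most one *)

Section measure_of_profile.
Variable R : realType.
Implicit Types (m : R) (F : R -> R).

Lemma stieltjes_itv_oc (f : cumulative R R) (a b : R) : a <= b ->
  lebesgue_stieltjes_measure f `]a, b]%classic = (f b - f a)%:E.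
Proof.
move=> ab; rewrite /lebesgue_stieltjes_measure /measure_extension/=.
by rewrite measurable_mu_extE/= ?wlength_itv_bnd//; exact: is_ocitv.
Qed.

(** The Lebesgue-Stieltjes measure of the profile, extended by constants outside
    [0, 1], and wrapped around the circle. *)
Lemma profile_measure m F : profile m F ->
  exists xi : fin_measC R, forall t, 0 <= t <= 1 -> dfun xi t = F t.
Proof.
move=> [F0 F1 hF]; pose clip (t : R) := Num.max 0 (Num.min t 1).
have clip_itv t : 0 <= clip t <= 1.
  by rewrite /clip le_max lexx/= ge_max ler01 ge_min lexx orbT.
have clipE t : 0 <= t <= 1 -> clip t = t.
  by move=> /andP[t0 t1]; rewrite /clip min_l// max_r.
have clip_nd s t : s <= t -> 0 <= clip t - clip s <= t - s.
  move=> st; rewrite /clip; case: (leP s 1) => ?; case: (leP t 1) => ?;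
    rewrite ?(max_r ler01); try (case: (leP 0 s) => ?); try (case: (leP 0 t) => ?); lra.
pose G t := F (clip t).
have G_lip s t : s <= t -> 0 <= G t - G s <= t - s.
  move=> st; have /andP[h1 h2] := clip_nd _ _ st.
  have /andP[s0 s1] := clip_itv s; have /andP[t0 t1] := clip_itv t.
  have := hF (clip s) (clip t) s0 _ t1; rewrite -subr_ge0 => /(_ h1).
  by rewrite /G; lra.
have G_nd : nondecreasing G by move=> s t /G_lip; lra.
have G_dist s t : `|G s - G t| <= `|s - t|.
  wlog st : s t / s <= t => [h|].
    by have [/h//|/ltW/h] := leP s t; rewrite distrC [leRHS]distrC.
  have /andP[h1 h2] := G_lip _ _ st.
  by rewrite distrC [leRHS]distrC ger0_norm// ger0_norm// subr_ge0.
have G_cont : continuous G.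
  move=> t; apply/cvgrPdist_lt => e e0; near=> s.
  apply: le_lt_trans (G_dist _ _) _.
  by near: s; apply: cvgr_dist_lt => //; exact: cvg_id.
pose f : cumulative R R := HB.pack_for (cumulative R R) G
  (isCumulative.Build R _ R G G_nd (right_continuousW G_cont)).
pose mu1 := mrestr (lebesgue_stieltjes_measure f) (measurable_itv `]0%R, 1%R]).
pose mu2 : {measure set (circle R) -> \bar R} :=
  measure_function_pushforward__canonical__measure_function_Measure
    mu1 (@measurable_toC R).
have mu2E t : 0 <= t <= 1 -> mu2 (iarc t) = (F t)%:E.
  move=> t01; rewrite -[LHS]/(lebesgue_stieltjes_measure f _).
  have -> : @toC R @^-1` iarc t `&` `]0, 1]%classic = `]0, t]%classic.
    apply/seteqP; split => x.
      move=> [/iarcE]; rewrite /= !in_itv/= => + x01.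
      by rewrite liftK// => ->; rewrite (andP x01).1.
    rewrite /= in_itv/= => x0t.
    by split; [apply/iarcE; rewrite liftK; lra|rewrite /= in_itv/=; lra].
  rewrite stieltjes_itv_oc/=; last by case/andP : t01.
  rewrite /G !clipE// ?lexx ?ler01// F0 subr0//.
have mu2_fin : fin_num_fun mu2.
  by apply: lty_fin_num_fun; rewrite -iarc1 mu2E ?ler01 ?lexx// ltry.
pose xi : fin_measC R := HB.pack_for (fin_measC R) (mu2 : set _ -> \bar R)
  (Measure.on mu2) (Measure_isFinite.Build _ _ _ mu2 mu2_fin).
by exists xi => t t01; rewrite /dfun -[xi _]/(mu2 _) mu2E.
Unshelve. all: by end_near. Qed.

End measure_of_profile.

Section ae_sign.
Context d (T : measurableType d) (R : realType).
Variable mu : {measure set T -> \bar R}.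

(** Otherwise the integral over the set where [f] is positive would be positive. *)
Lemma ae_le0_of_integral_le0 (f : T -> R) : mu.-integrable setT (EFin \o f) ->
  (forall B, measurable B -> (\int[mu]_(x in B) (f x)%:E <= 0)%E) ->
  {ae mu, forall x, f x <= 0}.
Proof.
move=> intf h; pose D := f @^-1` `]0, +oo[%classic.
have mf : measurable_fun setT f by exact/measurable_EFinP/(measurable_int mu).
have mD : measurable D.
  by rewrite -[X in measurable X]setTI; apply: mf.
have fD x : D x -> 0 < f x by rewrite /D/= in_itv/= andbT.
have : ae_eq mu D (EFin \o f) (cst 0%E).
  apply/ae_eq_integral_abs => //.
    exact: measurable_funS (measurable_int mu intf).
  apply/eqP; rewrite eq_le integral_ge0 ?andbT//.
  apply: le_trans (h D mD); rewrite le_eqVlt; apply/orP; left; apply/eqP.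
  by apply: eq_integral => x /set_mem/fD x0; rewrite /= ger0_norm// ltW.
apply: filterS => x hx; rewrite leNgt; apply/negP => fx0.
have : D x by rewrite /D/= in_itv/= fx0.
by move=> /hx /= [] fx; rewrite fx ltxx in fx0.
Qed.

End ae_sign.

Section density_bounds.
Variable R : realType.
Implicit Types (m : R) (psi : fin_measC R).
Local Notation lebC := (@lebesgueC R).

Lemma dfun_lebesgueC (t : R) : 0 <= t <= 1 -> lebC (iarc t) = t%:E.
Proof.
move=> /andP[t0 t1]; rewrite -[LHS]/(lebesgue_measure _).
have [t1'|t1'] := ltP t 1.
  have -> : @toC R @^-1` iarc t `&` `[0, 1[%classic = `]0, t]%classic.
    apply/seteqP; split => x.
      move=> [/iarcE]; rewrite /= !in_itv/= => + /andP[x0 x1].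
      move: x0; rewrite le_eqVlt => /orP[/eqP <-|x0]; first by rewrite lift0; lra.
      by rewrite liftK ?x0 ?(ltW x1)// => ->.
    rewrite /= in_itv/= => x0t.
    by split; [apply/iarcE; rewrite liftK; lra|rewrite /= in_itv/=; lra].
  by rewrite lebesgue_measure_itv/= lte_fin; case: ltP => ?; rewrite ?oppr0 ?adde0//; congr EFin; lra.
have -> : t = 1 by lra.
by rewrite iarc1 preimage_setT setTI lebesgue_measure_itv/= lte_fin ltr01 oppr0 adde0.
Qed.

Lemma dfun_lebesgueE (t : R) : 0 <= t <= 1 ->
  dfun (@lebesgueC R : fin_measC R) t = t.
Proof. by move=> t01; rewrite /dfun [X in fine X](dfun_lebesgueC t01). Qed.

(** A profile complements the identity to another profile: the corresponding
    measures add up to Lebesgue measure. *)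
Lemma profile_le_lebesgue m psi (B : set (circle R)) : profile m (dfun psi) ->
  measurable B -> (psi B <= lebC B)%E.
Proof.
move=> [p0 p1 hp] mB.
have pc : profile (1 - m) (fun t => t - dfun psi t).
  split; rewrite ?p0 ?p1 ?subr0// => s t s0 st t1.
  by have := hp s t s0 st t1; lra.
have [nu nuE] := profile_measure pc.
pose sigma : {measure set (circle R) -> \bar R} := measure_add psi nu.
have sE A : sigma A = (psi A + nu A)%E by exact: measure_addE.
have s_fin : fin_num_fun sigma.
  by move=> A mA; rewrite sE fin_numD !fin_num_measure.
pose sig : fin_measC R := HB.pack_for (fin_measC R) (sigma : set _ -> \bar R)
  (Measure.on sigma) (Measure_isFinite.Build _ _ _ sigma s_fin).
have -> : lebC B = sig B.
  apply: (@dfun_measure_eq R (@lebesgueC R : fin_measC R) sig) => // t t01.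
  rewrite dfun_lebesgueE//.
  rewrite /dfun -[sig _]/(sigma _) sE -!dfunE -EFinD/= nuE//; lra.
by rewrite -[sig _]/(sigma _) sE leeDl.
Qed.

Lemma density_measurable psi : psi `<< lebC ->
  measurable_fun setT (density psi).
Proof.
move=> h; apply: measurableT_comp; first exact: fine_measurable.
apply: (measurable_int lebC).
exact: Radon_Nikodym_integrable.
Qed.

Lemma densityE psi u : psi `<< lebC -> (density psi u)%:E =
  Radon_Nikodym (charge_of_finite_measure psi) lebC u.
Proof. by move=> h; rewrite fineK//; exact: Radon_Nikodym_fin_num. Qed.

Lemma integral_density psi (B : set (circle R)) : psi `<< lebC ->
  measurable B -> (\int[lebC]_(u in B) (density psi u)%:E = psi B)%E.
Proof.
move=> h mB; under eq_integral do rewrite densityE//.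
by rewrite -Radon_Nikodym_integral.
Qed.

Lemma density_integrable psi : psi `<< lebC ->
  lebC.-integrable setT (EFin \o density psi).
Proof.
move=> h; rewrite (_ : _ \o _ = Radon_Nikodym (charge_of_finite_measure psi) lebC).
  exact: Radon_Nikodym_integrable.
by apply/funext => u; exact: densityE.
Qed.

(** Domination by Lebesgue measure gives absolute continuity, and comparing the
    integrals of the density with those of 0 and 1 bounds it almost everywhere. *)
Lemma profile_M0b m psi : profile m (dfun psi) -> M0b m psi.
Proof.
move=> pm; have le_leb := profile_le_lebesgue pm.
have dom : psi `<< lebC.
  apply/null_content_dominatesP => A mA A0.
  by apply/eqP; rewrite eq_le measure_ge0 andbT -A0 le_leb.
split => //.
  by have [_ <- _] := pm; rewrite dfun1.
have int1 : lebC.-integrable setT (EFin \o cst (1 : R)).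
  by apply: finite_measure_integrable_cst.
have intd := density_integrable dom.
have h1 : {ae lebC, forall u, density psi u - 1 <= 0}.
  apply: ae_le0_of_integral_le0.
    exact: (@integrableB _ _ _ _ _ measurableT _ _ intd int1).
  move=> B mB; under eq_integral do rewrite EFinB.
  rewrite integralB_EFin//; last 2 first.
    exact: (integrableS measurableT mB (@subsetT _ B) intd).
    exact: (integrableS measurableT mB (@subsetT _ B) int1).
  by rewrite integral_density// integral_cst// mul1e sube_le0; exact: le_leb.
have h2 : {ae lebC, forall u, - density psi u <= 0}.
  apply: ae_le0_of_integral_le0.
    exact: (@integrableN _ _ _ _ _ _ intd).
  move=> B mB; under eq_integral do rewrite EFinN.
  rewrite integralN ?integral_density//.
    by rewrite leeNl oppe0 measure_ge0.
  apply: integrable_add_def => //.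
  exact: (integrableS measurableT mB (@subsetT _ B) intd).
by apply: filterS2 h1 h2 => u; lra.
Qed.

(** The density is only determined, and only controlled, almost everywhere;
    this version of it takes its values in [0, 1]. *)
Definition density01 psi (u : circle R) : R :=
  Num.max 0 (Num.min (density psi u) 1).

Lemma density01_itv psi u : 0 <= density01 psi u <= 1.
Proof. by rewrite /density01 le_max lexx/= ge_max ler01 ge_min lexx orbT. Qed.

Lemma density01_measurable psi : psi `<< lebC ->
  measurable_fun setT (density01 psi).
Proof.
move=> h; apply: measurable_maxr => //; apply: measurable_minr => //.
exact: density_measurable.
Qed.

Lemma density01_ae m psi : M0b m psi ->
  {ae lebC, forall u, density01 psi u = density psi u}.
Proof.
move=> [_ _]; apply: filterS => u /andP[h0 h1].
by rewrite /density01 min_l// max_r.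
Qed.

Lemma integral_density01 m psi (B : set (circle R)) : M0b m psi ->
  measurable B -> (\int[lebC]_(u in B) (density01 psi u)%:E = psi B)%E.
Proof.
move=> hpsi mB; have [_ dom _] := hpsi; rewrite -(integral_density dom mB).
apply: ae_eq_integral => //.
- apply/measurable_EFinP; apply: measurable_funS (density01_measurable dom) => //.
- apply/measurable_EFinP; apply: measurable_funS (density_measurable dom) => //.
- by apply: filterS (density01_ae hpsi) => u -> _.
Qed.

Lemma M0b_profile m psi : M0b m psi -> profile m (dfun psi).
Proof.
move=> hpsi; have [pm dom _] := hpsi; split; first exact: dfun0.
  by have := dfun1 psi; rewrite pm => -[].
move=> s t s0 st t1.
have mA : measurable (iarc t `\` @iarc R s) by apply: measurableD; exact: measurable_iarc.
have lA : lebC (iarc t `\` @iarc R s) = (t - s)%:E.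
  rewrite (@dfunB R (@lebesgueC R : fin_measC R))// !dfun_lebesgueE//; lra.
rewrite -!lee_fin -(dfunB psi st) measure_ge0 -(integral_density01 hpsi)//=.
rewrite -lA -[leRHS]mul1e -integral_cst//.
apply: ge0_le_integral => //.
- by move=> u _; rewrite lee_fin; case/andP: (density01_itv psi u).
- apply/measurable_EFinP; apply: measurable_funS (density01_measurable dom) => //.
- by move=> u _; rewrite lee_fin; case/andP: (density01_itv psi u).
Qed.

Lemma profile_eq m F G : (forall t, 0 <= t <= 1 -> F t = G t) ->
  profile m F -> profile m G.
Proof.
move=> FG [F0 F1 h]; split; rewrite -?FG ?lexx ?ler01// => s t s0 st t1.
by rewrite -!FG; [exact: h|lra|lra].
Qed.

Lemma dfun_collapse m1 m2 (r1 r2 : fin_measC R) :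
  profile m1 (dfun r1) -> profile m2 (dfun r2) -> m1 <= m2 ->
  forall t, 0 <= t <= 1 -> dfun (collapse r2 r1) t = fcollapse (dfun r1) (dfun r2) t.
Proof.
move=> p1 p2 m12; have [xi xiE] := profile_measure (profile_fcollapse p1 p2 m12).
apply/(is_collapseP _ p1 p2 m12); rewrite /collapse.
by apply: (@xgetPex _ r1 [set xi | is_collapse r2 r1 xi]); exists xi; apply/(is_collapseP _ p1 p2 m12).
Qed.

Lemma near01_0 (F G : R -> R) : near01 0 F G <->
  (forall t, 0 <= t <= 1 -> F t = G t).
Proof.
split => h t t01; last by rewrite h// subrr normr0.
by have := h t t01; rewrite normr_le0 subr_eq0 => /eqP.
Qed.

(** By induction along the lines; each collapsed measure is again a profile, which
    keeps the next collapsing well defined. *)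
Lemma dfun_collapse_k k (m : 'I_k -> R) (psi : 'I_k -> fin_measC R) :
  (forall i j : 'I_k, (i <= j)%N -> m i <= m j) ->
  (forall i, profile (m i) (dfun (psi i))) ->
  forall i t, 0 <= t <= 1 ->
  dfun (collapse_k psi i) t = fcollapse_k (fun j => dfun (psi j)) i t.
Proof.
move=> mm pm i; rewrite /collapse_k /fcollapse_k.
suff h s r G : all (fun j : 'I_k => (i < j)%N) s -> profile (m i) G ->
    (forall t, 0 <= t <= 1 -> dfun r t = G t) ->
    forall t, 0 <= t <= 1 ->
    dfun (foldl (fun xi j => collapse (psi j) xi) r s) t =
    foldl (fun H j => fcollapse H (dfun (psi j))) G s t.
  by apply: h; [exact: filter_all|exact: pm|].
elim: s r G => [//|j s IH] r G /= /andP[ij hs] pG rG.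
have pr : profile (m i) (dfun r) by apply: profile_eq pG => t /rG.
have mij := mm _ _ (ltnW ij).
apply: IH => //; first exact: profile_fcollapse pG (pm j) mij.
move=> t t01; rewrite (dfun_collapse pr (pm j) mij)//.
have bd := profile_bounded (pm j).
have /near01_0 := rG => h; have h2 : near01 0 (dfun (psi j)) (dfun (psi j)) by exact/near01_0.
have := fcollapse_near (profile_bounded pr) bd (profile_bounded pG) bd h h2.
by rewrite mulr0 => /near01_0; exact.
Qed.

End density_bounds.

(** * Binary entropy *)

Section binary_entropy.
Variable R : realType.
Implicit Types (x q e : R).

Definition binent x : R := - (x * ln x) - (1 - x) * ln (1 - x).

(** Cross entropy of the Bernoulli laws of parameters [x] and [q]; affine in
    [x], and minimal over [q] at [q = x], which makes [binent] the infimum of a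
    family of affine functions. *)
Definition xent q x : R := - (x * ln q) - (1 - x) * ln (1 - q).

Lemma xlnx_le x q : 0 <= x -> 0 < q -> x * ln q - x * ln x <= q - x.
Proof.
rewrite le_eqVlt => /orP[/eqP <-|x0] q0; first by rewrite !mul0r !subr0 ltW.
have qx : 0 < q / x by rewrite divr_gt0.
have : ln (q / x) <= q / x - 1.
  by have := @le_ln1Dx R (q / x - 1); rewrite (_ : 1 + _ = q / x); [apply; lra|ring].
rewrite ln_div// => h'; rewrite -mulrBr.
have := ler_wpM2l (ltW x0) h'; rewrite [X in _ <= X -> _]mulrBr mulr1 mulrCA divff ?mulr1//.
by rewrite gt_eqF.
Qed.

Lemma binent_le_xent x q : 0 <= x <= 1 -> 0 < q < 1 -> binent x <= xent q x.
Proof.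
move=> /andP[x0 x1] /andP[q0 q1]; rewrite /binent /xent.
have h1 := xlnx_le x0 q0.
have := @xlnx_le (1 - x) (1 - q); rewrite !subr_ge0 subr_gt0 => /(_ x1 q1).
by lra.
Qed.

Lemma binent0 : binent 0 = 0.
Proof. by rewrite /binent mul0r subr0 ln1 mulr0 subr0 oppr0. Qed.

Lemma binent1 : binent 1 = 0.
Proof. by rewrite /binent subrr mul0r subr0 ln1 mulr0 oppr0. Qed.

(** The infimum over [q] is attained inside ]0, 1[ except at the two end points,
    where [q] has to approach 0 or 1. *)
Lemma xent_near_binent x e : 0 <= x <= 1 -> 0 < e ->
  exists q, 0 < q < 1 /\ xent q x <= binent x + e.
Proof.
move=> /andP[x0 x1] e0.
have ee : 0 < expR (- e) < 1 by rewrite expR_gt0 expR_lt1 oppr_lt0 e0.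
move: x0; rewrite le_eqVlt => /orP[/eqP <-|x0].
  exists (1 - expR (- e)); split; first by lra.
  have e1 : 1 - (1 - expR (- e)) = expR (- e) by ring.
  by rewrite binent0 /xent e1 expRK; lra.
move: x1; rewrite le_eqVlt => /orP[/eqP ->|x1].
  by exists (expR (- e)); split => //; rewrite binent1 /xent expRK; lra.
by exists x; rewrite x0 x1; split => //; rewrite /binent /xent; lra.
Qed.

(** Used for the continuity of [x ln x] at 0. *)
Lemma xlnx_ge x : 0 <= x -> - (2 * Num.sqrt x) <= x * ln x.
Proof.
rewrite le_eqVlt => /orP[/eqP <-|x0]; first by rewrite sqrtr0 mulr0 mul0r oppr0.
have s0 : 0 < Num.sqrt x by rewrite sqrtr_gt0.
have h : ln ((Num.sqrt x)^-1) < (Num.sqrt x)^-1 by apply: ln_sublinear; rewrite invr_gt0.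
have lx : ln x = 2 * ln (Num.sqrt x).
  by rewrite -{1}(sqr_sqrtr (ltW x0)) lnXn// mulr_natl.
have h2 : - (Num.sqrt x)^-1 <= ln (Num.sqrt x).
  by rewrite lerNl -lnV ?posrE// ltW.
have e2 : x * (Num.sqrt x)^-1 = Num.sqrt x.
  by rewrite -{1}(sqr_sqrtr (ltW x0)) expr2 -mulrA divff ?mulr1// gt_eqF.
rewrite lx; have := ler_wpM2l (ltW x0) h2; rewrite mulrN e2; lra.
Qed.

Lemma continuous_xlnx : continuous (fun x : R => x * ln x).
Proof.
move=> x; have [x0|x0] := ltP 0 x.
  by apply: cvgM; [exact: cvg_id|exact: continuous_ln].
move: x0; rewrite le_eqVlt => /orP[/eqP ->|x0].
  apply/cvgrPdist_lt => e e0; rewrite mul0r.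
  have h : Num.sqrt y @[y --> (0:R)] --> (0:R).
    by rewrite -[X in _ --> X](@sqrtr0 R); exact: sqrt_continuous.
  have e2 : 0 < Num.min e 1 / 2 by rewrite divr_gt0// lt_min e0 ltr01.
  near=> y.
  have ys : Num.sqrt y < Num.min e 1 / 2.
    have : `|0 - Num.sqrt y| < Num.min e 1 / 2.
      by near: y; apply: cvgr_dist_lt.
    by rewrite sub0r normrN; apply: le_lt_trans; exact: ler_norm.
  have y1 : y < 1.
    by near: y; apply: (cvgr_lt (0 : R)); [exact: cvg_id|exact: ltr01].
  rewrite sub0r normrN; have [y0|y0] := leP y 0; first by rewrite ln0// mulr0 normr0.
  have hy := xlnx_ge (ltW y0).
  have : y * ln y <= 0 by rewrite mulr_ge0_le0 ?(ltW y0)// ln_le0// ltW.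
  have hm : Num.min e 1 <= e by rewrite ge_min lexx.
  by move=> hy2; rewrite ler0_norm//; lra.
apply: cvg_near_cst; near=> y; rewrite !ln0 ?mulr0//; first exact: ltW.
by apply: ltW; near: y; apply: (cvgr_lt x); [exact: cvg_id|].
Unshelve. all: by end_near. Qed.

Lemma continuous_binent : continuous binent.
Proof.
move=> x; rewrite /binent; apply: cvgB.
  by apply: cvgN; exact: continuous_xlnx.
apply: (@cvg_comp _ _ _ (fun x => 1 - x) (fun y => y * ln y)); last exact: continuous_xlnx.
by apply: cvgB; [exact: cvg_cst|exact: cvg_id].
Qed.

Lemma binent_itv x : 0 <= x <= 1 -> 0 <= binent x <= 1.
Proof.
move=> /andP[x0 x1]; apply/andP; split.
  have h1 : x * ln x <= 0 by rewrite mulr_ge0_le0// ln_le0.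
  have h2 : (1 - x) * ln (1 - x) <= 0.
    by rewrite mulr_ge0_le0// ?subr_ge0// ln_le0//; lra.
  by rewrite /binent; lra.
have h2 : 0 < (2^-1 : R) < 1 by lra.
apply: le_trans (binent_le_xent _ h2) _; first by rewrite x0.
rewrite /xent; have -> : 1 - 2^-1 = 2^-1 :> R by lra.
have h3 : ln 2 <= 1 :> R.
  have := @le_ln1Dx R 1; rewrite (_ : 1 + 1 = 2 :> R); last by ring.
  by apply; lra.
by rewrite lnV ?posrE//; lra.
Qed.

Lemma xentM (c x q : R) : c * xent q x = - (c * x * ln q) - (c - c * x) * ln (1 - q).
Proof. by rewrite /xent; ring. Qed.

End binary_entropy.

(** * Entropy on a grid *)

Section partition_into_cells.
Variable R : realType.
Implicit Types (mu : fin_measC R) (n j : nat).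

Lemma bounded_integrable d (T : measurableType d)
    (mu : {finite_measure set T -> \bar R}) (f : T -> R) (M : R) :
  measurable_fun setT f -> (forall x, `|f x| <= M) ->
  mu.-integrable setT (EFin \o f).
Proof.
move=> mf fM; apply: (@le_integrable _ _ _ _ _ measurableT _ (EFin \o cst M)).
- exact/measurable_EFinP.
- move=> x _ /=; rewrite lee_fin (le_trans (fM x))//; exact: ler_norm.
- exact: finite_measure_integrable_cst.
Qed.

Definition cell n j : set (circle R) :=
  iarc (j.+1%:R / n%:R) `\` iarc (j%:R / n%:R).

Lemma measurable_cell n j : measurable (cell n j).
Proof. by apply: measurableD; exact: measurable_iarc. Qed.

Lemma cellE n j w : cell n j w <-> j%:R / n%:R < clift w <= j.+1%:R / n%:R.
Proof.
split; first by move=> [/iarcE -> h]; rewrite andbT ltNge; apply/negP => /iarcE.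
by move=> /andP[h1 h2]; split; [exact/iarcE|move=> /iarcE; rewrite leNgt h1].
Qed.

Lemma cell_cover n w : (0 < n)%N -> exists2 j, (j < n)%N & cell n j w.
Proof.
move=> n0; have hw := lift_itv w.
have n0' : 0 < n%:R :> R by rewrite ltr0n.
have [j hj] : exists j : nat, clift w <= j.+1%:R / n%:R.
  by exists n; rewrite ler_pdivlMr// -addn1 natrD; nra.
have [{}j {}hj jmin] := ex_minnP (ex_intro (fun j => clift w <= j.+1%:R / n%:R) j hj).
have jw : j%:R / n%:R < clift w.
  case: j hj jmin => [|j] hj jmin; first by rewrite mul0r; lra.
  by rewrite ltNge; apply/negP => /jmin; rewrite ltnn.
exists j; last by apply/cellE; rewrite jw.
have : j%:R < n%:R :> R by move: jw; rewrite ltr_pdivrMr// => jw; nra.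
by rewrite ltr_nat.
Qed.

Lemma cell_uniq n i j w : (0 < n)%N -> cell n i w -> cell n j w -> i = j.
Proof.
move=> n0 /cellE /andP[h1 h2] /cellE /andP[h3 h4].
have n0' : 0 < n%:R :> R by rewrite ltr0n.
have : i%:R / n%:R < j.+1%:R / n%:R :> R by exact: lt_le_trans h4.
have : j%:R / n%:R < i.+1%:R / n%:R :> R by exact: lt_le_trans h2.
by rewrite !ltr_pM2r ?invr_gt0// !ltr_nat; lia.
Qed.

Definition step n (c : nat -> R) (w : circle R) : R :=
  \sum_(j < n) c j * \1_(cell n j) w.

Lemma step_cell n c j w : (j < n)%N -> cell n j w -> step n c w = c j.
Proof.
move=> jn wj; have n0 : (0 < n)%N by apply: leq_ltn_trans jn.
rewrite /step (bigD1 (Ordinal jn))//= indicE mem_set//= mulr1 big1 ?addr0//.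
move=> i ij; rewrite indicE memNset ?mulr0// => wi.
by move/eqP: ij; apply; apply: val_inj; exact: cell_uniq wi wj.
Qed.

Definition dincr (F : R -> R) n j : R := F (j.+1%:R / n%:R) - F (j%:R / n%:R).

Lemma le_natdiv n i j : (i <= j)%N -> i%:R / n%:R <= j%:R / n%:R :> R.
Proof. by move=> ij; rewrite ler_wpM2r ?invr_ge0// ler_nat. Qed.

Lemma grid_itv n j : (0 < n)%N -> (j <= n)%N -> 0 <= (j%:R / n%:R : R) <= 1.
Proof.
by move=> n0 jn; rewrite divr_ge0//= ler_pdivrMr ?ltr0n// mul1r ler_nat.
Qed.

Lemma measure_cell mu n j : mu (cell n j) = (dincr (dfun mu) n j)%:E.
Proof. by rewrite dfunB//; exact: le_natdiv. Qed.

Lemma step_measurable n c : measurable_fun setT (step n c).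
Proof.
apply: measurable_sum => j; apply: measurable_funM => //.
by apply: measurable_indic; exact: measurable_cell.
Qed.

Lemma integral_step mu n c :
  (\int[mu]_w (step n c w)%:E = (\sum_(j < n) c j * dincr (dfun mu) n j)%:E)%E.
Proof.
under eq_integral do rewrite /step -sumEFin.
rewrite integral_sum//=; last first.
  move=> j; apply: (@bounded_integrable _ _ mu _ `|c j|).
    apply: measurable_funM; first exact: measurable_cst.
    by apply: measurable_indic; exact: measurable_cell.
  by move=> w; rewrite normrM indicE ler_piMr//; case: (_ \in _); rewrite ?normr1 ?normr0.
rewrite -sumEFin; apply: eq_bigr => j _.
under eq_integral do rewrite EFinM.
rewrite integralZl//; last first.
  apply: (@bounded_integrable _ _ mu _ 1); first by apply: measurable_indic; exact: measurable_cell.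
  by move=> w; rewrite indicE; case: (_ \in _); rewrite ?normr1 ?normr0.
rewrite integral_indic ?setIT; [by rewrite EFinM -measure_cell|exact: measurableT|exact: measurable_cell].
Qed.

End partition_into_cells.

Section entropy.
Variable R : realType.
Implicit Types (m : R) (F : R -> R) (psi : fin_measC R) (n j : nat).
Local Notation lebC := (@lebesgueC R).

(** The entropy of the density obtained from that of [F] by averaging over [n]
    equal cells. *)
Definition ent_grid n F : R :=
  n%:R^-1 * \sum_(j < n) binent (n%:R * dincr F n j).

(** For a profile this is the integral of [binent] of its density. As an infimum of
    functions of finitely many values of [F], it is upper semicontinuous for
    pointwise convergence. *)
Definition ent F : R := inf [set ent_grid n F | n in [set n | (0 < n)%N]].

Definition profile_dincr m F n j : profile m F -> (j < n)%N ->
  0 <= n%:R * dincr F n j <= 1.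
Proof.
move=> [_ _ h] jn.
have n0 : 0 < n%:R :> R by rewrite ltr0n; exact: leq_ltn_trans jn.
have := h (j%:R / n%:R) (j.+1%:R / n%:R) _ (le_natdiv _ _ (leqnSn j)) _.
rewrite divr_ge0// ler_pdivrMr// mul1r ler_nat => /(_ isT jn).
rewrite -mulrBl -natrB// subSnn mul1r -/(dincr F n j) => /andP[h1 h2].
by rewrite mulr_ge0 ?(ltW n0)//= -ler_pdivlMl// mulr1.
Qed.

Lemma ent_grid_ge0 m F n : profile m F -> 0 <= ent_grid n F.
Proof.
move=> pF; rewrite /ent_grid mulr_ge0 ?invr_ge0// sumr_ge0// => j _.
by have /binent_itv/andP[] := profile_dincr pF (ltn_ord j).
Qed.

Lemma ent_le_grid m F n : profile m F -> (0 < n)%N -> ent F <= ent_grid n F.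
Proof.
move=> pF n0; apply: ge_inf; last by exists n.
by exists 0 => _ [k _ <-]; exact: ent_grid_ge0 pF.
Qed.

Definition binent_density psi (u : circle R) : R := binent (density01 psi u).

Lemma binent_density_itv psi u : 0 <= binent_density psi u <= 1.
Proof. by apply: binent_itv; exact: density01_itv. Qed.

Lemma binent_density_measurable psi : psi `<< lebC ->
  measurable_fun setT (binent_density psi).
Proof.
move=> h; apply: measurableT_comp; last exact: density01_measurable.
by apply: continuous_measurable_fun; exact: continuous_binent.
Qed.

Lemma integrable_density01 psi (B : set (circle R)) : psi `<< lebC ->
  measurable B -> lebC.-integrable B (EFin \o density01 psi).
Proof.
move=> h mB; apply: integrableS measurableT mB (@subsetT _ B) _.
apply: (@bounded_integrable _ _ _ (@lebesgueC R : fin_measC R) _ 1) => //.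
  exact: density01_measurable.
by move=> w; have := density01_itv psi w; rewrite ler_norml; lra.
Qed.

Lemma dincr_lebesgue n j : (j < n)%N ->
  lebC (@cell R n j) = (n%:R^-1)%:E.
Proof.
move=> jn; have n0 : 0 < n%:R :> R by rewrite ltr0n; exact: leq_ltn_trans jn.
have h : dincr (dfun (@lebesgueC R : fin_measC R)) n j = n%:R^-1.
  have nn : (0 < n)%N by exact: leq_ltn_trans jn.
  rewrite /dincr !dfun_lebesgueE ?grid_itv// 1?ltnW//.
  by rewrite -mulrBl -natrB// subSnn mul1r.
by rewrite -h; exact: (@measure_cell R (@lebesgueC R : fin_measC R)).
Qed.

Lemma integral_xent m psi n j q : M0b m psi -> (j < n)%N ->
  (\int[lebC]_(u in @cell R n j) (xent q (density01 psi u))%:E =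
   (n%:R^-1 * xent q (n%:R * dincr (dfun psi) n j))%:E)%E.
Proof.
move=> hpsi jn; have [_ dom _] := hpsi.
have n0 : n%:R != 0 :> R by rewrite pnatr_eq0 -lt0n; exact: leq_ltn_trans jn.
have mC := @measurable_cell R n j.
transitivity (\int[lebC]_(u in @cell R n j)
   ((ln (1 - q) - ln q)%:E * (density01 psi u)%:E + (- ln (1 - q))%:E))%E.
  apply: eq_integral => u _; rewrite /xent -EFinM -EFinD; congr EFin; ring.
rewrite integralD//; last 2 first.
- by apply: integrableZl => //; exact: integrable_density01.
- exact: (@finite_measure_integrable_cst _ _ _ (@lebesgueC R : fin_measC R)).
rewrite integralZl//; last exact: integrable_density01.
rewrite (integral_density01 hpsi mC) measure_cell integral_cst//.
rewrite [X in (_ + _ * X)%E](dincr_lebesgue jn) -!EFinM -EFinD; congr EFin.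
by rewrite xentM mulrA mulVf// mul1r; set L := ln q; set L' := ln _; ring.
Qed.

(** Jensen's inequality on a cell, through the affine upper bounds of
    [binent]. *)
Lemma integral_binent_cell m psi n j : M0b m psi -> (j < n)%N ->
  (\int[lebC]_(u in @cell R n j) (binent_density psi u)%:E <=
   (n%:R^-1 * binent (n%:R * dincr (dfun psi) n j))%:E)%E.
Proof.
move=> hpsi jn; have [_ dom _] := hpsi; have pF := M0b_profile hpsi.
have n0 : 0 < n%:R :> R by rewrite ltr0n; exact: leq_ltn_trans jn.
have mC := @measurable_cell R n j.
apply/lee_addgt0Pr => e e0.
have [q [q01 hq]] := xent_near_binent (profile_dincr pF jn) (mulr_gt0 n0 e0).
apply: (@le_trans _ _ (\int[lebC]_(u in @cell R n j) (xent q (density01 psi u))%:E)%E).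
  apply: ge0_le_integral => //.
  - by move=> u _; rewrite lee_fin; case/andP: (binent_density_itv psi u).
  - apply/measurable_EFinP; apply: measurable_funS (binent_density_measurable dom) => //.
  - apply/measurable_EFinP; apply: (@measurable_funS _ _ _ _ setT) => //.
    rewrite /xent; apply: measurable_funB.
      by apply: measurableT_comp => //; apply: measurable_funM => //; exact: density01_measurable.
    by apply: measurable_funM => //; apply: measurable_funB => //; exact: density01_measurable.
  - by move=> u _; rewrite lee_fin binent_le_xent//; exact: density01_itv.
rewrite (integral_xent _ hpsi jn) -EFinD lee_fin.
have h : 0 <= n%:R^-1 :> R by rewrite invr_ge0 ltW.
by have := ler_wpM2l h hq; rewrite (mulrDr _ (binent _)) mulKf ?gt_eqF.
Qed.

End entropy.

(** * Lebesgue differentiation and the entropy integral *)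

Section cell_averages.
Variable R : realType.
Implicit Types (x : R) (w : circle R) (psi : fin_measC R) (n j : nat).
Local Notation lebC := (@lebesgueC R).
Local Notation mu := (@lebesgue_measure R).

Definition line_cell x n : set R :=
  `]((Num.ceil (x * n.+1%:R) - 1)%:~R / n.+1%:R),
    ((Num.ceil (x * n.+1%:R))%:~R / n.+1%:R)]%classic.

Lemma lebesgue_line_cell x n : mu (line_cell x n) = (n.+1%:R^-1)%:E.
Proof.
have n0 : 0 < n.+1%:R :> R by [].
rewrite /line_cell lebesgue_measure_itv/= lte_fin ltr_pM2r ?invr_gt0//.
rewrite ltr_int ltrBlDr ltrDl ltr01 -EFinB; congr EFin.
by rewrite intrB; field.
Qed.

Lemma line_cell_near x n y : line_cell x n y -> `|x - y| < n.+1%:R^-1.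
Proof.
have n0 : 0 < n.+1%:R :> R by [].
rewrite /line_cell/= in_itv/= ltr_pdivrMr// ler_pdivlMr// => hy.
have hx := real_ceil_itv (num_real (x * n.+1%:R)).
have h : `|(x - y) * n.+1%:R| < 1 by rewrite ltr_norml; move: hx hy; lra.
by move: h; rewrite normrM (gtr0_norm n0) -ltr_pdivlMr// mul1r.
Qed.

Lemma nicely_shrinking_line_cell x : nicely_shrinking x (line_cell x).
Proof.
split; first by move=> n; exact: measurable_itv.
exists (2, fun n => (n.+1%:R^-1)%:pos); split => //=.
- exact: cvg_harmonic.
- by move=> n y /line_cell_near.
- move=> n; rewrite lebesgue_line_cell lebesgue_measure_ball//=.
  by rewrite -EFinM lee_fin mulr_natl.
Qed.

Lemma negligible_point x : mu [set x] = 0%E.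
Proof. exact: lebesgue_measure_set1. Qed.

(** The two half-open fundamental domains [0, 1[ and ]0, 1] of the circle
    differ by a null set. *)
Lemma integral_circle_cell (g : circle R -> R) n j : (j < n)%N ->
  measurable_fun setT g -> (forall w, 0 <= g w) ->
  (\int[mu]_(x in `](j%:R / n%:R)%R, (j.+1%:R / n%:R)%R]%classic) (g (toC x))%:E =
   \int[lebC]_(w in @cell R n j) (g w)%:E)%E.
Proof.
move=> jn mg g0; set a := j%:R / n%:R; set b := _ / n%:R.
have n0 : 0 < n%:R :> R by rewrite ltr0n; exact: leq_ltn_trans jn.
have a0 : 0 <= a by rewrite divr_ge0.
have b1 : b <= 1 by rewrite ler_pdivrMr// mul1r ler_nat.
have mC := @measurable_cell R n j.
have mT : measurable_fun setT (@toC R : measurableTypeR R -> circle R) := @measurable_toC R.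
have mgT : measurable_fun setT (fun x : measurableTypeR R => (g (toC x))%:E).
  by apply/measurable_EFinP; apply: (measurableT_comp mg mT).
pose m : {measure set (measurableTypeR R) -> \bar R} :=
  mrestr mu (measurable_itv `[0%R, 1%R[).
have mpre : measurable (@toC R @^-1` @cell R n j : set (measurableTypeR R)).
  by rewrite -[X in measurable X]setTI; exact: mT.
pose h x := (g (toC x))%:E.
have h0 x : (0 <= h x)%E by rewrite lee_fin.
have m01 : m (~` `]0, 1[%classic) = 0%E.
  rewrite /m/= /mrestr; apply/eqP; rewrite eq_le measure_ge0 andbT.
  apply: (@le_trans _ _ (mu [set 0])); last by rewrite negligible_point.
  apply: le_measure; rewrite ?inE//.
  + by apply: measurableI => //; apply: measurableC; exact: measurable_itv.
  + move=> x /=; rewrite !in_itv/= => -[/negP h1 h2].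
    by move: h1; case/andP: h2 => h2 h3; rewrite h3 andbT -leNgt; lra.
have mI : measurable (~` `]0, 1[%classic : set (measurableTypeR R)).
  by apply: measurableC; exact: measurable_itv.
have E0 : @toC R @^-1` @cell R n j `\` ~` `]0, 1[%classic = `]a, b]%classic `\` [set 1].
  apply/seteqP; split => x /=.
    move=> [/cellE + /contrapT]; rewrite !in_itv/= => + x01.
    rewrite liftK; last by lra.
    by move=> ->; split => // x1; move: x01; rewrite x1 ltxx andbF.
  rewrite in_itv/= => -[xab /eqP x1].
  have x1' : x < 1 by rewrite lt_neqAle x1/=; lra.
  split; first by apply/cellE; rewrite liftK//; lra.
  by apply; rewrite in_itv/=; lra.
pose D1 : set R := `]a, b]%classic `\` [set 1].
transitivity (\int[mu]_(x in D1) h x)%E.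
  apply: (@ge0_negligible_integral _ (measurableTypeR R) R mu _ [set 1] h) => //.
  - exact: measurable_funS mgT.
  - exact: negligible_point.
transitivity (\int[pushforward m (@toC R)]_(w in @cell R n j) (g w)%:E)%E; last by [].
rewrite (ge0_integral_pushforward mT)//; last 2 first.
- by apply/measurable_EFinP; apply: measurable_funS mg.
- by move=> w _; rewrite lee_fin.
apply/esym.
transitivity (\int[m]_(x in D1) h x)%E.
  rewrite /D1 -E0.
  apply: (@ge0_negligible_integral _ (measurableTypeR R) R m _ _ h mI mpre _ _ m01) => //.
  exact: measurable_funS mgT.
apply: eq_measure_integral => A mA Asub; rewrite /m/= /mrestr; congr (mu _).
apply/setIidPl => x /Asub[/=]; rewrite !in_itv/= => xab /eqP x1.
have x1' : x < 1 by rewrite lt_neqAle x1/=; lra.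
lra.
Qed.

Lemma line_cellE w n j : (j < n.+1)%N -> cell n.+1 j w ->
  line_cell (clift w) n = `](j%:R / n.+1%:R), (j.+1%:R / n.+1%:R)]%classic.
Proof.
move=> jn /cellE hw; have n0 : 0 < n.+1%:R :> R by [].
rewrite /line_cell (_ : Num.ceil _ = (j.+1)%:Z).
  by rewrite (_ : j.+1%:Z - 1 = j%:Z)//; lia.
apply: ceil_def.
rewrite (_ : j.+1%:Z - 1 = j%:Z); last by lia.
by rewrite -ltr_pdivrMr// -ler_pdivlMr.
Qed.

Lemma locally_integrable_density m psi : M0b m psi ->
  locally_integrable setT (fun x : R => density01 psi (toC x)).
Proof.
move=> [_ dom _]; split.
- apply: (measurableT_comp (density01_measurable dom)).
  exact: measurable_toC.
- exact: openT.
- move=> K _ cK; apply: le_lt_trans (compact_finite_measure cK).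
  have mK := compact_measurable cK.
  rewrite -[leRHS]mul1e -integral_cst//; apply: ge0_le_integral => //.
  + apply/measurable_EFinP; apply: measurableT_comp => //.
    apply: (@measurable_funS _ _ _ _ setT) => //.
    apply: (measurableT_comp (density01_measurable dom)).
    exact: measurable_toC.
  + by move=> x _; rewrite lee_fin ger0_norm; case/andP: (density01_itv psi (toC x)).
Qed.

(** Lebesgue's differentiation theorem along the grid cells. *)
Lemma step_entropy_cvg m psi : M0b m psi ->
  {ae lebC, forall w, step n.+1 (fun j => binent (n.+1%:R * dincr (dfun psi) n.+1 j)) w
    @[n --> \oo] --> binent_density psi w}.
Proof.
move=> hpsi; have [_ dom _] := hpsi.
have locf := locally_integrable_density hpsi.
have [N [mN N0 subN]] := lebesgue_differentiation locf.
have mM : measurable (@clift R @^-1` N).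
  by rewrite -[X in measurable X]setTI; apply: measurable_lift.
exists (@clift R @^-1` N); split => //.
  apply/eqP; rewrite eq_le measure_ge0 andbT.
  rewrite -[X in (X <= _)%E]/(mu (@toC R @^-1` (@clift R @^-1` N) `&` `[0, 1[%classic)).
  apply: (@le_trans _ _ (mu (N `|` [set 0]))).
    apply: le_measure; rewrite ?inE//.
    - apply: measurableI => //; rewrite -[X in measurable X]setTI.
      exact: (@measurable_toC R).
    - exact: measurableU.
    - move=> x /=; rewrite in_itv/= => -[+ /andP[]].
      rewrite le_eqVlt => + /orP[/eqP <- _|x0 x1]; first by right.
      by rewrite liftK ?x0 ?(ltW x1)//; left.
  have : (mu (N `|` [set 0%R]) <= mu N + mu [set 0%R])%E by apply: measureU2.
  by rewrite N0 negligible_point adde0.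
move=> w /= hw; apply: subN => /= hpt; apply: hw.
have := nice_lebesgue_differentiation nicely_shrinking_line_cell locf hpt.
rewrite toC_lift => h.
have : (n.+1%:R * dincr (dfun psi) n.+1 (xget 0%N [set j | (j < n.+1)%N /\ cell n.+1 j w]))%:E
    @[n --> \oo] --> (density01 psi w)%:E.
  apply: cvg_trans h; apply: near_eq_cvg; near=> n.
  case: xgetP => [j _ [jn wj]|]; last first.
    by move=> hn; have [j jn wj] := cell_cover w (ltn0Sn n); case: (hn j).
  rewrite lebesgue_line_cell (line_cellE jn wj) integral_circle_cell//; last 2 first.
  - exact: density01_measurable.
  - by move=> u; case/andP: (density01_itv psi u).
  rewrite (integral_density01 hpsi)//; last exact: measurable_cell.
  by rewrite measure_cell inver invr_eq0 pnatr_eq0/= invrK -EFinM.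
move=> /fine_cvgP[_ /= hc]; have := cvg_comp _ _ hc (@continuous_binent R _).
apply: cvg_trans; apply: near_eq_cvg; near=> n.
rewrite /=; case: xgetP => [j _ [jn wj]|]; last first.
  by move=> hn; have [j jn wj] := cell_cover w (ltn0Sn n); case: (hn j).
by rewrite /= (step_cell _ jn wj).
Unshelve. all: by end_near. Qed.

End cell_averages.

Section entropy_integral.
Variable R : realType.
Implicit Types (m : R) (psi : fin_measC R) (n j : nat).
Local Notation lebC := (@lebesgueC R).

Lemma integral_binent_le_grid m psi n : M0b m psi -> (0 < n)%N ->
  (\int[lebC]_u (binent_density psi u)%:E <= (ent_grid n (dfun psi))%:E)%E.
Proof.
move=> hpsi n0; have [_ dom _] := hpsi.
have -> : [set: circle R] = \big[setU/set0]_(j <- index_iota 0 n) @cell R n j.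
  apply/seteqP; split => // w _; have [j jn wj] := cell_cover w n0.
  by rewrite -bigcup_seq; exists j => //=; rewrite mem_index_iota.
rewrite ge0_integral_bigsetU//; last 5 first.
- exact: measurable_cell.
- exact: iota_uniq.
- move=> i j _ _ [w [wi wj]]; exact: cell_uniq wi wj.
- apply: measurable_funTS; apply/measurable_EFinP; exact: binent_density_measurable.
- by move=> u _; rewrite lee_fin; case/andP: (binent_density_itv psi u).
rewrite big_mkord /ent_grid mulr_sumr -sumEFin; apply: lee_sum => j _.
exact: integral_binent_cell hpsi (ltn_ord j).
Qed.

(** Dominated convergence: the averaged densities converge almost everywhere. *)
Lemma grid_cvg_integral m psi : M0b m psi ->
  (ent_grid n.+1 (dfun psi))%:E @[n --> \oo] --> (\int[lebC]_u (binent_density psi u)%:E)%E.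
Proof.
move=> hpsi; have [_ dom _] := hpsi; have pF := M0b_profile hpsi.
pose c n j := binent (n.+1%:R * dincr (dfun psi) n.+1 j).
have := @dominated_convergence _ _ _ lebC setT measurableT
  (fun n w => (step n.+1 (c n) w)%:E) (EFin \o binent_density psi) (cst 1%E).
case.
- by move=> n; apply/measurable_EFinP; exact: step_measurable.
- by apply/measurable_EFinP; exact: binent_density_measurable.
- apply: filterS (step_entropy_cvg hpsi) => w hw _.
  by apply/fine_cvgP; split => //; near=> n.
- exact: (@finite_measure_integrable_cst _ _ _ (@lebesgueC R : fin_measC R)).
- apply: aeW => w n _; have [j jn wj] := cell_cover w (ltn0Sn n).
  rewrite (step_cell _ jn wj) /= lee_fin /c.
  by have := binent_itv (profile_dincr pF jn) => /andP[h0 h1]; rewrite ger0_norm.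
move=> _ _; apply: cvg_trans; apply: near_eq_cvg; near=> n.
etransitivity; first exact: (@integral_step R (@lebesgueC R : fin_measC R)).
rewrite /ent_grid mulr_sumr; congr EFin; apply: eq_bigr => j _.
rewrite mulrC; congr (_ * _); rewrite /dincr !dfun_lebesgueE ?grid_itv// 1?ltnW//.
by rewrite -mulrBl -natrB// subSnn mul1r.
Unshelve. all: by end_near. Qed.

(** Jensen's inequality bounds the integral by every grid entropy, and the grid
    entropies converge to it. *)
Lemma ent_integral m psi : M0b m psi ->
  (\int[lebC]_u (binent_density psi u)%:E)%E = (ent (dfun psi))%:E.
Proof.
move=> hpsi; have pF := M0b_profile hpsi.
have h0 : (0 <= \int[lebC]_u (binent_density psi u)%:E)%E.
  by apply: integral_ge0 => u _; rewrite lee_fin; case/andP: (binent_density_itv psi u).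
have h1 n (n0 : (0 < n)%N) := integral_binent_le_grid hpsi n0.
have hfin : (\int[lebC]_u (binent_density psi u)%:E)%E \is a fin_num.
  by rewrite ge0_fin_numE//; apply: le_lt_trans (h1 1%N _) _; rewrite ?ltry.
rewrite -(fineK hfin); congr EFin; apply/le_anti/andP; split.
  apply: lb_le_inf; first by exists (ent_grid 1 (dfun psi)), 1%N.
  by move=> _ [n n0 <-]; rewrite -lee_fin fineK//; exact: h1.
have := grid_cvg_integral hpsi; rewrite -(fineK hfin) => /fine_cvgP[_ /= hc].
rewrite -(cvg_lim _ hc)//; apply: limr_ge; first exact: cvgP hc.
by near=> n; exact: ent_le_grid pF _.
Unshelve. all: by end_near. Qed.

End entropy_integral.

(** * The rate function in terms of profiles *)

Section rate_in_terms_of_profiles.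
Variable R : realType.
Implicit Types (psi : fin_measC R).
Local Notation lebC := (@lebesgueC R).

Lemma measurable_xlogxVy (y : R) : measurable_fun setT (fun x => xlogxVy x y).
Proof.
apply: measurable_fun_ifT => //; first exact: measurable_fun_eqr.
case: (y == 0) => /=; first exact: measurable_cst.
apply/measurable_EFinP; apply: measurable_funM => //.
apply: measurableT_comp; first exact: measurable_ln.
exact: measurable_funM.
Qed.

Lemma measurable_hfun (m : R) : measurable_fun setT (hfun m).
Proof.
apply: emeasurable_funD; first exact: measurable_xlogxVy.
apply: (measurableT_comp (measurable_xlogxVy _)).
exact: measurable_funB.
Qed.

Lemma xlogxVyE (x y : R) : 0 <= x -> 0 < y ->
  xlogxVy x y = (x * ln x - x * ln y)%:E.
Proof.
move=> x0 y0; rewrite /xlogxVy (gt_eqF y0); case: eqVneq => [->|xn0].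
  by rewrite !mul0r subr0.
have x0' : 0 < x by rewrite lt_neqAle eq_sym xn0.
by rewrite ln_div// mulrBr.
Qed.

Lemma hfunE (m x : R) : 0 < m < 1 -> 0 <= x <= 1 ->
  hfun m x = (xent m x - binent x)%:E.
Proof.
move=> /andP[m0 m1] /andP[x0 x1].
rewrite /hfun !xlogxVyE ?subr_ge0 ?subr_gt0//.
by rewrite -EFinD /xent /binent; congr EFin; ring.
Qed.

Lemma hfun11 : hfun 1 1 = 0%E :> \bar R.
Proof.
by rewrite /hfun /xlogxVy oner_eq0 subrr eqxx divr1 ln1 mulr0 adde0.
Qed.

(** For [m < 1] the integrand is the cross entropy relative to [m], affine in the
    density, minus the entropy of the density. For [m = 1] the density is 1 almost
    everywhere. *)
Lemma integral_hfun (m : R) psi : 0 < m <= 1 -> M0b m psi ->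
  (\int[lebC]_u hfun m (density psi u) = (binent m - ent (dfun psi))%:E)%E.
Proof.
move=> /andP[m0 m1] hpsi; have [_ dom _] := hpsi.
have mass : (\int[lebC]_u (density01 psi u)%:E = m%:E)%E.
  by rewrite (integral_density01 hpsi)//; case: hpsi.
have leb1 : lebC setT = 1%E by rewrite -(@iarc1 R) dfun_lebesgueC// ler01 lexx.
have mh : measurable_fun setT (hfun m \o density psi).
  by apply: measurableT_comp; [exact: measurable_hfun|exact: density_measurable].
have intg := integrable_density01 dom measurableT.
have intb : lebC.-integrable setT (EFin \o binent_density psi).
  apply: (@bounded_integrable _ _ _ (@lebesgueC R : fin_measC R) _ 1).
    exact: binent_density_measurable.
  by move=> w; have := binent_density_itv psi w; rewrite ler_norml; lra.
move: m1; rewrite le_eqVlt => /orP[/eqP m1|m1].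
  have g1 : {ae lebC, forall u, 1 - density01 psi u <= 0}.
    have int1 : lebC.-integrable setT (EFin \o cst (1 : R)).
      exact: (@finite_measure_integrable_cst _ _ _ (@lebesgueC R : fin_measC R)).
    have m1g : measurable_fun setT (fun u => (1 - density01 psi u)%:E).
      by apply/measurable_EFinP; apply: measurable_funB => //; exact: density01_measurable.
    apply: ae_le0_of_integral_le0.
      exact: (@integrableB _ _ _ _ _ measurableT _ _ int1 intg).
    move=> B mB.
    apply: (@le_trans _ _ (\int[lebC]_u (1 - density01 psi u)%:E)%E).
      apply: ge0_subset_integral => //.
      by move=> u _; rewrite lee_fin subr_ge0; case/andP: (density01_itv psi u).
    under eq_integral do rewrite EFinB.
    rewrite integralB_EFin// mass integral_cst// mul1e [X in (X - _)%E]leb1 m1.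
    by rewrite subee.
  have -> : ent (dfun psi) = 0.
    apply: EFin_inj; rewrite -(ent_integral hpsi).
    rewrite (ae_eq_integral (cst 0%E))//; first exact: integral0.
      by apply/measurable_EFinP; exact: binent_density_measurable.
    apply: filterS g1 => u hu _; rewrite /binent_density.
    have -> : density01 psi u = 1 by have := density01_itv psi u; lra.
    by rewrite binent1.
  rewrite m1 binent1 subr0 (ae_eq_integral (cst 0%E))//; first exact: integral0.
  - by move: mh; rewrite m1.
  - apply: filterS2 g1 (density01_ae hpsi) => u hu hd _.
    rewrite -hd; have -> : density01 psi u = 1 by have := density01_itv psi u; lra.
    exact: hfun11.
have m01 : 0 < m < 1 by rewrite m0.
transitivity (\int[lebC]_u ((ln (1 - m) - ln m)%:E * (density01 psi u)%:E +
    (- ln (1 - m))%:E - (binent_density psi u)%:E))%E.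
  apply: ae_eq_integral => //.
  - apply: emeasurable_funB; last first.
      by apply/measurable_EFinP; exact: binent_density_measurable.
    apply: emeasurable_funD => //; apply: emeasurable_funM => //.
    by apply/measurable_EFinP; exact: density01_measurable.
  - apply: filterS (density01_ae hpsi) => u hd _.
    rewrite -hd hfunE//; last exact: density01_itv.
    rewrite -EFinM /= -!EFinD; congr EFin; rewrite /xent /binent_density; ring.
have intc : lebC.-integrable setT (cst (- ln (1 - m))%:E).
  exact: (@finite_measure_integrable_cst _ _ _ (@lebesgueC R : fin_measC R)).
have intZ : lebC.-integrable setT (fun u => (ln (1 - m) - ln m)%:E * (density01 psi u)%:E)%E.
  exact: integrableZl.
rewrite integralB//; last exact: integrableD.
rewrite integralD// integralZl// mass integral_cst// [X in (_ + _ * X - _)%E]leb1 mule1 (ent_integral hpsi).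
rewrite -EFinM -!EFinD; congr EFin; rewrite /binent; ring.
Qed.

Variables (k : nat) (m : 'I_k -> R).

Definition frate (F : 'I_k -> R -> R) : R := \sum_(i < k) (binent (m i) - ent (F i)).

Hypothesis m_gt0 : forall i, 0 < m i.
Hypothesis m_le1 : forall i, m i <= 1.
Hypothesis m_mono : forall i j : 'I_k, (i <= j)%N -> m i <= m j.

Definition profile_k (F : 'I_k -> R -> R) := forall i, profile (m i) (F i).

(** Stated on distribution functions, which determine a measure only up to its
    values on the sets that are not measurable. *)
Definition represents (F : 'I_k -> R -> R) (rho : measCk R k) :=
  forall i t, 0 <= t <= 1 -> dfun (rho i : fin_measC R) t = fcollapse_k F i t.

Lemma frate_ge0 F : profile_k F -> 0 <= frate F.
Proof.
move=> pF; apply: sumr_ge0 => i _; rewrite subr_ge0.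
apply: (le_trans (ent_le_grid (pF i) (ltn0Sn 0))).
have [F0 F1 _] := pF i.
by rewrite /ent_grid invr1 mul1r big_ord_recl big_ord0 addr0 /dincr mul1r divr1 mul0r F0 F1 subr0.
Qed.

Lemma eq_ent_grid n F G : (0 < n)%N ->
  (forall t, 0 <= t <= 1 -> F t = G t) -> ent_grid n F = ent_grid n G :> R.
Proof.
move=> n0 FG; rewrite /ent_grid; congr (_ * _); apply: eq_bigr => j _.
by rewrite /dincr !FG// grid_itv// ltnW.
Qed.

Lemma eq_ent F G : (forall t, 0 <= t <= 1 -> F t = G t) -> ent F = ent G :> R.
Proof.
by move=> FG; congr inf; apply: eq_imagel => n n0; exact: eq_ent_grid.
Qed.

Lemma S_k_le_frate F rho : profile_k F -> represents F rho ->
  (S_k m rho <= (frate F)%:E)%E.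
Proof.
move=> pF repF.
have [psi psiE] := choice (fun i => profile_measure (pF i)).
have pp i : profile (m i) (dfun (psi i)).
  by apply: profile_eq (pF i) => t t01; rewrite psiE.
apply: ereal_inf_lbound; exists psi; split.
- by move=> i; exact: profile_M0b.
- move=> i; apply: dfun_measure_eq => t t01.
  rewrite repF// (dfun_collapse_k m_mono pp)//.
  have h j : near01 0 (dfun (psi j)) (F j) by apply/near01_0; exact: psiE.
  have := fcollapse_k_near (lexx 0) (fun j => profile_bounded (pp j))
    (fun j => profile_bounded (pF j)) h i.
  by rewrite mulr0 => /near01_0; exact.
- rewrite /frate -sumEFin; apply: eq_bigr => i _.
  rewrite integral_hfun ?m_gt0 ?m_le1//; last exact: profile_M0b.
  by congr (_ - _)%:E; apply: eq_ent => t t01; rewrite psiE.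
Qed.

(** Together with [S_k_le_frate] this replaces measures by profiles in the
    variational formula for the rate function. *)
Lemma S_k_lt_frate rho (x : R) : (S_k m rho < x%:E)%E ->
  exists F, [/\ profile_k F, represents F rho & frate F < x].
Proof.
move=> /ereal_inf_lt[_ [psi [hpsi rep ->]] hx].
have pp i := M0b_profile (hpsi i).
exists (fun i => dfun (psi i)); split => //.
- move=> i t t01; rewrite -(dfun_collapse_k m_mono pp)// /dfun.
  by rewrite rep//; exact: measurable_iarc.
- rewrite -lte_fin; apply: le_lt_trans hx.
  rewrite /frate -sumEFin le_eqVlt; apply/orP; left; apply/eqP/eq_bigr => i _.
  by rewrite integral_hfun ?m_gt0 ?m_le1.
Qed.

Lemma S_k_ge0 rho : (0 <= S_k m rho)%E.
Proof.
rewrite leNgt; apply/negP => /S_k_lt_frate[F [/frate_ge0 h _]].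
by rewrite ltNge h.
Qed.

End rate_in_terms_of_profiles.

(** * Uniqueness of the invariant law *)

Section synchronizing_word.
Variables (R : realType) (T : finType) (N : nat) (g : 'I_N -> T -> T).
Implicit Types (P Q D f : T -> R) (w : seq 'I_N).

Definition run w (s : T) := foldl (fun s x => g x s) s w.

Let A (f : T -> R) : T -> R := fun s => \sum_(x < N) f (g x s).

Lemma sum_iterA D f n : (forall h, \sum_s D s * A h s = N%:R * \sum_s D s * h s) ->
  N%:R ^+ n * \sum_s D s * f s = \sum_s D s * iter n A f s.
Proof.
move=> inv; elim: n => [|n IH]; first by rewrite mul1r.
by rewrite exprS -mulrA IH -inv.
Qed.

Lemma iterA_bound f n : (forall s, `|f s| <= 1) -> forall s, `|iter n A f s| <= N%:R ^+ n.
Proof.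
move=> f1; elim: n => [|n IH] s /=; first exact: f1.
rewrite (le_trans (ler_norm_sum _ _ _))//.
rewrite (le_trans (ler_sum _ (fun x _ => IH (g x s))))//.
by rewrite sumr_const card_ord exprS mulr_natl.
Qed.

(** Among the [N ^ size w] words of the length of [w], one is [w] itself. *)
Lemma iterA_run f w : (forall s, `|f s| <= 1) ->
  forall s, `|iter (size w) A f s - f (run w s)| <= N%:R ^+ size w - 1.
Proof.
move=> f1; elim: w => [|x w IH] s /=; first by rewrite subrr normr0 subrr.
rewrite {1}/A (bigD1 x)//= addrAC.
have h1 := IH (g x s).
have h2 : `|\sum_(i < N | i != x) iter (size w) A f (g i s)| <=
    (N%:R - 1) * N%:R ^+ size w.
  rewrite (le_trans (ler_norm_sum _ _ _))//.
  rewrite (le_trans (ler_sum _ (fun i _ => iterA_bound _ f1 (g i s))))//.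
  rewrite sumr_const -[leLHS]mulr_natl ler_wpM2r ?exprn_ge0//.
  rewrite cardC1 card_ord -subn1 natrB//.
  exact: leq_ltn_trans (leq0n x) (ltn_ord x).
rewrite (le_trans (ler_normD _ _))// (le_trans (lerD h1 h2))//.
by rewrite exprS; lra.
Qed.

(** A word which sends all the states of the support to one and the same state
    makes the chain strictly contract the total variation norm of signed
    measures of mass 0. *)
Lemma invariant_uniq P Q w (S : T -> Prop) c :
  (forall s, S s -> run w s = c) ->
  (forall s, ~ S s -> P s = 0) -> (forall s, ~ S s -> Q s = 0) ->
  \sum_s P s = \sum_s Q s ->
  (forall f, \sum_s P s * (\sum_(x < N) (f (g x s) - f s)) = 0) ->
  (forall f, \sum_s Q s * (\sum_(x < N) (f (g x s) - f s)) = 0) ->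
  forall s, P s = Q s.
Proof.
move=> sync P0 Q0 PQ invP invQ; pose D s := P s - Q s.
have D0 s : ~ S s -> D s = 0 by move=> Ss; rewrite /D P0// Q0// subrr.
have sumD : \sum_s D s = 0 by rewrite sumrB PQ subrr.
have invD h : \sum_s D s * A h s = N%:R * \sum_s D s * h s.
  apply/eqP; rewrite -subr_eq0 mulr_sumr -sumrB; apply/eqP.
  transitivity (\sum_s (P s * (\sum_(x < N) (h (g x s) - h s)) -
                        Q s * (\sum_(x < N) (h (g x s) - h s)))).
    apply: eq_bigr => s _; rewrite sumrB sumr_const card_ord -/(A h s) /D.
    by rewrite -[h s *+ N]mulr_natl; ring.
  by rewrite sumrB invP invQ subrr.
pose f s : R := Num.sg (D s).
have f1 s : `|f s| <= 1 by rewrite /f normr_sg; case: (_ != _).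
pose V := \sum_s `|D s|.
have VE : V = \sum_s D s * f s.
  by apply: eq_bigr => s _; rewrite /f normrEsg mulrC.
have bound : N%:R ^+ size w * V <= (N%:R ^+ size w - 1) * V.
  rewrite {1}VE (sum_iterA f (size w) invD).
  have -> : \sum_s D s * iter (size w) A f s =
      \sum_s D s * (iter (size w) A f s - f (run w s)).
    apply/eqP; rewrite -subr_eq0 -sumrB; apply/eqP.
    transitivity (\sum_s D s * f c); last by rewrite -mulr_suml sumD mul0r.
    apply: eq_bigr => s _; rewrite -mulrBr opprB addrC subrK.
    by have [/sync ->//|/D0 ->] := pselect (S s); rewrite !mul0r.
  rewrite /V mulr_sumr; apply: ler_sum => s _.
  rewrite (le_trans (ler_norm _))// normrM mulrC ler_wpM2r//.
  exact: iterA_run.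
have V0 : V = 0.
  apply/le_anti/andP; split; first by move: bound; lra.
  by apply: sumr_ge0.
move=> s; apply/eqP; rewrite -subr_eq0 -normr_eq0; apply/eqP.
by apply: (psumr_eq0P _ V0).
Qed.

End synchronizing_word.

Section bubble_sort.
Variable N : nat.
Implicit Types (eta : {ffun 'I_N -> bool}) (x z : 'I_N).

Lemma exchangeE eta x z : exchange eta x z =
  if z == x then eta x || eta (ordS x)
  else if z == ordS x then eta x && eta (ordS x) else eta z.
Proof. by rewrite ffunE. Qed.

(** Written without subtraction: a jump moves at most one particle from [ordS x] to
    [x]. *)
Lemma sum_exchange (f : 'I_N -> nat) eta x : ordS x != x ->
  (\sum_z f z * exchange eta x z + (f x * eta x + f (ordS x) * eta (ordS x)) =
   \sum_z f z * eta z + (f x * (eta x || eta (ordS x)) + f (ordS x) * (eta x && eta (ordS x))))%N.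
Proof.
move=> xx; rewrite (bigD1 x)//= (bigD1 (ordS x))//= [in RHS](bigD1 x)//=.
rewrite [in RHS](bigD1 (ordS x))//= !exchangeE eqxx (negbTE xx) eqxx.
rewrite (eq_bigr (fun z => f z * eta z)%N); first by lia.
by move=> z /andP[zx zxx]; rewrite exchangeE (negbTE zx) (negbTE zxx).
Qed.

Lemma exchange_loop eta x : ordS x = x -> exchange eta x = eta.
Proof. by move=> h; apply/ffunP => z; rewrite exchangeE h orbb; case: eqP => [->|]. Qed.

Definition particles eta := (\sum_(x < N) eta x)%N.

Lemma particles_exchange eta x : particles (exchange eta x) = particles eta.
Proof.
have [/exchange_loop -> //|xx] := eqVneq (ordS x) x.
have := sum_exchange (fun=> 1%N) eta xx; rewrite /particles.
under eq_bigr do rewrite mul1n; under [in X in _ = X -> _]eq_bigr do rewrite mul1n.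
by rewrite !mul1n; case: (eta x) (eta _) => -[] /=; lia.
Qed.

Let weight eta := (\sum_(x < N) x * eta x)%N.

Let bonds := [seq x : 'I_N <- enum 'I_N | (x.+1 < N)%N].

Let val_ordS x : (x.+1 < N)%N -> ordS x = x.+1 :> nat.
Proof. by move=> h; rewrite /= modn_small. Qed.

Let ordS_neq x : (x.+1 < N)%N -> ordS x != x.
Proof. by move=> h; apply/eqP => /(congr1 (@nat_of_ord N)); rewrite val_ordS// => /esym/n_Sn. Qed.

Let weight_exchange eta x : (x.+1 < N)%N ->
  (weight (exchange eta x) + (~~ eta x && eta (ordS x)) = weight eta)%N.
Proof.
move=> h; have := sum_exchange (@nat_of_ord N) eta (ordS_neq h).
rewrite -/(weight _) -/(weight _) val_ordS//=.
by case: (eta x) (eta _) => -[] /=; lia.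
Qed.

Let sorted_line eta := forall x, (x.+1 < N)%N -> eta (ordS x) -> eta x.

Let sorted_lineP eta : sorted_line eta -> forall x, eta x = (x < particles eta)%N.
Proof.
move=> h.
have dn (x z : 'I_N) : (x <= z)%N -> eta z -> eta x.
  move=> /subnKC; move: (z - x)%N => d; elim: d z => [|d IH] z.
    by rewrite addn0 => /val_inj ->.
  rewrite addnS => xz ez; have zN := ltn_ord z.
  have dN : (x + d < N)%N by lia.
  apply: (IH (Ordinal dN)) => //; apply: h => /=; first by lia.
  rewrite (_ : ordS _ = z)//; apply: ord_inj; rewrite val_ordS //=; lia.
have winj p (h' : (p <= N)%N) : injective (widen_ord h').
  by move=> a b /(congr1 val) /= /ord_inj.
move=> x; rewrite /particles; apply/idP/idP => [ex|].
  rewrite (bigID (fun z : 'I_N => (z <= x)%N))/=.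
  rewrite (eq_bigr (fun=> 1%N)) => [|z zx]; last by rewrite (dn z x).
  rewrite sum1_card -(card_ord x.+1) (leq_trans _ (leq_addr _ _))//.
  have xN : (x.+1 <= N)%N := ltn_ord x.
  rewrite -(card_imset _ (winj _ xN)) subset_leq_card//.
  by apply/fintype.subsetP => _ /imsetP[z _ ->]; rewrite unfold_in/=; have := ltn_ord z; lia.
move=> hx; apply: contraLR hx => ex; rewrite -leqNgt.
rewrite (bigID (fun z : 'I_N => (z < x)%N))/= [X in (_ + X)%N]big1 ?addn0.
  apply: (@leq_trans (\sum_(z < N | (z < x)%N) 1)).
    by apply: leq_sum => z _; case: (eta z).
  rewrite sum1_card -[X in (_ <= X)%N](card_ord x).
  rewrite -(card_imset _ (winj _ (ltnW (ltn_ord x)))) subset_leq_card//.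
  apply/fintype.subsetP => z; rewrite unfold_in => zx; apply/imsetP; exists (Ordinal zx) => //.
  exact: val_inj.
by move=> z; rewrite -leqNgt => xz; case ez : (eta z) => //; rewrite (dn x z) in ex.
Qed.

Let bubble_weight eta (s : seq 'I_N) : all (fun x : 'I_N => (x.+1 < N)%N) s ->
  (weight (foldl (@exchange N) eta s) <= weight eta)%N /\
  (weight (foldl (@exchange N) eta s) = weight eta ->
    foldl (@exchange N) eta s = eta /\ forall x, x \in s -> eta (ordS x) -> eta x).
Proof.
elim: s eta => [|x s IH] eta //= /andP[xN sN].
have [h1 h2] := IH (exchange eta x) sN.
have we := weight_exchange eta xN.
split; first by lia.
move=> he; have [h3 h4] := h2 ltac:(lia).
have e0 : ~~ eta x && eta (ordS x) = false by case: (_ && _) we => //= ; lia.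
have ex : exchange eta x = eta.
  apply/ffunP => z; rewrite exchangeE; move: e0.
  case: eqP => [->|_]; first by case: (eta x) (eta _) => -[].
  by case: eqP => [->|//]; case: (eta x) (eta _) => -[].
rewrite h3 ex in h4 *; split => // z; rewrite inE => /orP[/eqP ->|].
  by case: (eta x) e0 => //= ->.
exact: h4.
Qed.

Definition sorting_word : seq 'I_N := flatten (nseq (N * N).+1 bonds).

(** Each pass over the bonds that do not cross the origin lowers the centre of
    mass of the particles until they are packed to the left. *)
Lemma sorting_wordP eta x :
  foldl (@exchange N) eta sorting_word x = (x < particles eta)%N.
Proof.
have bondsN : all (fun x : 'I_N => (x.+1 < N)%N) bonds by exact: filter_all.
have parts s eta' : particles (foldl (@exchange N) eta' s) = particles eta'.
  by elim: s eta' => [//|y s IH] eta' /=; rewrite IH particles_exchange.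
have wN eta' : (weight eta' <= N * N)%N.
  apply: (@leq_trans (\sum_(z < N) N)); last by rewrite sum_nat_const card_ord.
  by apply: leq_sum => z _; case: (eta' z); rewrite ?muln0 ?muln1 // ltnW.
suff h n eta' : (weight eta' < n)%N ->
    sorted_line (foldl (@exchange N) eta' (flatten (nseq n bonds))).
  by rewrite (sorted_lineP (h _ eta _)) ?parts// ltnS.
elim: n eta' => [//|n IH] eta' wn /=; rewrite foldl_cat.
have [h1 h2] := bubble_weight eta' bondsN.
move: h1; rewrite leq_eqVlt => /orP[/eqP/h2[h3 h4]|h1]; last first.
  by apply: IH; apply: leq_trans h1 _; rewrite -ltnS.
rewrite h3; have srt : sorted_line eta'.
  by move=> z zN; apply: h4; rewrite mem_filter zN mem_enum.
rewrite (_ : foldl _ _ _ = eta')//.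
elim: n {IH wn} => [//|n IHn]; by rewrite /= foldl_cat h3.
Qed.

End bubble_sort.

Section invariant_law_unique.
Variables (R : realType) (N k : nat) (m : 'I_k -> R).

Lemma invariant_law_uniq (P Q : config N k -> R) :
  invariant_law m P -> invariant_law m Q -> forall eta, P eta = Q eta.
Proof.
move=> [_ P1 Ps Pinv] [_ Q1 Qs Qinv].
pose g (x : 'I_N) (eta : config N k) : config N k := [ffun i => exchange (eta i) x].
pose c : config N k := [ffun i => [ffun x : 'I_N => (x < Num.truncn (N%:R * m i))%N]].
apply: (@invariant_uniq R _ N g P Q (sorting_word N) (state m) c) => //.
- move=> eta [_ hm]; apply/ffunP => i.
  have -> : run g (sorting_word N) eta i = foldl (@exchange N) (eta i) (sorting_word N).
    elim: (sorting_word N) eta {hm} => [//|x s IH] eta; rewrite /run/= -/(run g s _) IH.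
    by rewrite ffunE.
  by apply/ffunP => x; rewrite sorting_wordP !ffunE -hm.
- by rewrite P1 Q1.
Qed.

End invariant_law_unique.

(** * The queueing map and its intertwining property *)

Section queue_relation.
Variable N : nat.
Local Notation line := ({ffun 'I_N -> bool}).
Implicit Types (a b d : line) (x y z : 'I_N) (J : 'I_N -> nat).

(** [J] is the queue of a server on the ring with arrivals [a], services [b]
    and departures [d]; an arrival may be served at once. *)
Definition is_queue a b d J := forall x,
  J (ordS x) = (J x + a (ordS x) - b (ordS x))%N /\
  d (ordS x) = b (ordS x) && (0 < J x + a (ordS x))%N.

Lemma ordS_neq x y : x != y -> ordS x != x.
Proof.
move=> xy; apply/eqP => /(congr1 (@nat_of_ord N)) /= h.
have xN := ltn_ord x; have yN := ltn_ord y.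
have [e|ne] := eqVneq x.+1 N.
  by rewrite e modnn in h; move/eqP: xy; apply; apply: ord_inj; lia.
by rewrite modn_small in h; lia.
Qed.

(** On a ring with a single site a jump does nothing. *)
Lemma ord1_loop : (forall x, ordS x != x) \/ (forall x, ordS x = x).
Proof.
have [h|h] := pselect (exists x y : 'I_N, x != y).
  left => x; have [u [v uv]] := h; have [xu|] := eqVneq x u; last exact: ordS_neq.
  by apply: (@ordS_neq x v); rewrite xu.
right => x; apply/eqP; apply: contrapT => /negP xx; apply: h; by exists (ordS x), x.
Qed.

(** The site at which the bell rings on the line of the arrivals, after it has
    rung at [x] on the line of the services. *)
Definition bell b x := if b (ordS x) then x else ordS x.

(** The queueing map intertwines a jump of the departures with a jump of the
    services followed by a jump of the arrivals at the site given by [bell]. *)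
Lemma is_queue_exchange a b d J x : is_queue a b d J -> exists J',
  is_queue (exchange a (bell b x)) (exchange b x) (exchange d x) J'.
Proof.
move=> H; case: ord1_loop => [nl|lp]; last first.
  by exists J => z; rewrite !exchange_loop.
have inj := @ordS_inj N.
have nxt z y : ordS z != ordS y -> z != y by apply: contraNneq => ->.
rewrite /bell; case: ifPn => bx.
- (* the queue only changes between the two services *)
  pose p := ord_pred x; have px : ordS p = x by rewrite /p ord_predK.
  exists (fun z => if z == x then (J p + (a x || a (ordS x)) - 1)%N else J z) => z.
  have [zx|zx] := eqVneq (ordS z) x.
    have [hJ hd] := H p; have [hJ' hd'] := H x; rewrite px in hJ hd.
    have zp : z = p by apply: inj; rewrite zx px.
    rewrite zx !exchangeE eqxx.
    have -> : (z == x) = false by apply/negbTE; rewrite -zx eq_sym nl.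
    rewrite bx orbT hd hd' hJ bx zp; split => //.
    by case: (a x) (a _) (b x) => -[] [] /=; case: (J p) => [|j] //=; lia.
  have [zxx|zxx] := eqVneq z x.
    have [hJ hd] := H p; have [hJ' hd'] := H x; rewrite px in hJ hd.
    rewrite zxx !exchangeE (negbTE (nl x)) eqxx bx andbT hJ' hd hd' hJ bx.
    by case: (a x) (a _) (b x) => -[] [] /=; case: (J p) => [|j] //=; split; lia.
  have e : (ordS z == ordS x) = false by apply/negbTE; rewrite (inj_eq inj).
  by rewrite !exchangeE ?(negbTE zx) ?e ?(negbTE zxx); have [-> ->] := H z; split.
- set x' := ordS x; set x'' := ordS x'.
  have bE : exchange b x = b.
    apply/ffunP => z; rewrite exchangeE -/x' (negbTE bx) orbF andbF.
    by case: eqP => [->//|_]; case: eqP => [->|//]; exact/esym/negbTE.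
  have [hJ hd] := H x; have [hJ' hd'] := H x'; rewrite -/x' -/x'' in hJ hd hJ' hd'.
  have dx : d x' = false by rewrite hd (negbTE bx).
  have dE : exchange d x = d.
    apply/ffunP => z; rewrite exchangeE -/x' dx orbF andbF.
    by case: eqP => [->//|_]; case: eqP => [->|//].
  rewrite bE dE.
  exists (fun z => if z == x' then (J x + (a x' || a x''))%N else J z) => z.
  have [zx|zx] := eqVneq (ordS z) x'.
    have zx' : z = x by apply: inj.
    rewrite zx' -/x'; cbv beta; rewrite exchangeE !eqxx -/x'' (negbTE bx) dx subn0.
    by have -> : (x == x') = false by apply/negbTE; rewrite eq_sym nl.
  have [zxx|zxx] := eqVneq z x'.
    rewrite zxx -/x'' !exchangeE (negbTE (nl x')) eqxx hJ' hd' hJ (negbTE bx) subn0.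
    by case: (a x') (a x'') (b x'') => -[] [] /=; case: (J x) => [|j] //=; split; lia.
  have e : (ordS z == x'') = false by apply/negbTE; rewrite (inj_eq inj).
  by rewrite !exchangeE ?(negbTE zx) ?e ?(negbTE zxx); have [-> ->] := H z; split.
Qed.

Lemma is_queue_particles a b d J : is_queue a b d J -> particles d = particles a.
Proof.
move=> H; rewrite /particles (reindex_inj (@ordS_inj N))/= [RHS](reindex_inj (@ordS_inj N))/=.
have : (\sum_(x < N) d (ordS x) + \sum_(x < N) J (ordS x) =
        \sum_(x < N) a (ordS x) + \sum_(x < N) J x)%N.
  rewrite -!big_split; apply: eq_bigr => x _; have [-> ->] := H x.
  by case: (a _) (b _) => -[] /=; case: (J x) => [|j] /=; lia.
have -> : (\sum_(x < N) J (ordS x) = \sum_(x < N) J x)%N.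
  by rewrite [RHS](reindex_inj (@ordS_inj N)).
by move/addIn.
Qed.

Lemma ring_ind (p : 'I_N -> Prop) x : p x -> (forall z, p z -> p (ordS z)) -> forall y, p y.
Proof.
move=> px ps y.
have step (j : nat) (h : ((x + j) %% N < N)%N) : p (Ordinal h).
  elim: j h => [|j IH] h.
    by rewrite (_ : Ordinal h = x)//; apply: ord_inj; rewrite /= addn0 modn_small.
  have h' : ((x + j) %% N < N)%N by rewrite ltn_mod (leq_ltn_trans (leq0n x)).
  rewrite (_ : Ordinal h = ordS (Ordinal h')); first exact/ps/IH.
  by apply: ord_inj; rewrite /= -[in RHS]addn1 modnDml addn1 addnS.
have h : ((x + (N + y - x)) %% N < N)%N by rewrite ltn_mod (leq_ltn_trans (leq0n x)).
rewrite (_ : y = Ordinal h); first exact: step.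
apply: ord_inj; rewrite /= subnKC; last by rewrite (leq_trans (ltnW (ltn_ord x)))// leq_addr.
by rewrite modnDl modn_small.
Qed.

(** Of two stationary queues with the same input the one that is longer somewhere
    is longer everywhere, hence has more departures; but both let through the same
    number of particles. *)
Lemma is_queue_uniq a b d J d' J' : is_queue a b d J -> is_queue a b d' J' -> d = d'.
Proof.
wlog [x Jx] : d J d' J' / (exists x, (J x <= J' x)%N) => [W H H'|H H'].
  have [h|h] := pselect (exists x, (J x <= J' x)%N); first exact: W h H H'.
  apply/esym; have [h'|h'] := pselect (exists x, (J' x <= J x)%N).
    exact: W h' H' H.
  apply/ffunP => x; exfalso; apply: h; exists x; rewrite leqNgt; apply/negP => lt.
  by apply: h'; exists x; exact: ltnW.
have JJ' : forall z, (J z <= J' z)%N.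
  by apply: (ring_ind Jx) => z hz; have [-> _] := H z; have [-> _] := H' z; lia.
have dd' z : (d z <= d' z)%N.
  rewrite -(ord_predK z); have [_ ->] := H (ord_pred z); have [_ ->] := H' (ord_pred z).
  by have := JJ' (ord_pred z); case: (b _) => //=; case: (a _); rewrite ?addn0 ?addn1//; lia.
have : particles d = particles d' by rewrite (is_queue_particles H) (is_queue_particles H').
rewrite /particles => /eqP hs; apply/ffunP => z.
have := leqif_sum (fun i (_ : true) => leqif_eq (dd' i)).
move=> [_]; rewrite hs => /esym/forallP/(_ z) /= /eqP.
by case: (d z) (d' z) => -[].
Qed.

(** The jump at [x] can be undone from the next line: after the jump, the value at
    the site [bell a x] is the value of [a] at [ordS x], and tells where that site
    lies. *)
Lemma bell_exchange_inj a b x y :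
  bell a x = bell b y -> exchange a x = exchange b y -> x = y /\ a = b.
Proof.
move=> hb he; case: ord1_loop => [nl|lp]; last first.
  by move: hb he; rewrite /bell !lp !if_same !exchange_loop.
have inj := @ordS_inj N.
have val (c : line) z : exchange c z (bell c z) = c (ordS z).
  rewrite exchangeE /bell; case: (c (ordS z)); first by rewrite eqxx orbT.
  by rewrite (negbTE (nl z)) eqxx andbF.
have ab : a (ordS x) = b (ordS y) by rewrite -val -val hb he.
have xy : x = y.
  by move: hb; rewrite /bell -ab; case: ifP => // _ /inj.
rewrite -xy in he ab *; split => //; apply/ffunP => z.
have /ffunP/(_ z) := he; have /ffunP/(_ x) := he; have /ffunP/(_ (ordS x)) := he.
rewrite !exchangeE eqxx (negbTE (nl x)) eqxx -!ab.
case: eqP => [->|_]; last by case: eqP => [->|].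
by case: (a x) (b x) (a (ordS x)) => -[] [].
Qed.

End queue_relation.

(** * The stationary queue on a ring *)

Section stationary_queue.
Variable N : nat.
Hypothesis N_gt0 : (0 < N)%N.
Local Notation line := ({ffun 'I_N -> bool}).
Implicit Types (a b d : line) (x y : 'I_N) (s t u : nat).

(** The line read along the universal cover of the ring. *)
Definition at_time a t : bool := oapp a false (insub (t %% N)%N).

Lemma at_ord a x p : at_time a (x + p * N) = a x.
Proof. by rewrite /at_time addnC modnMDl modn_small// valK. Qed.

Lemma at_timeDN a t : at_time a (t + N) = at_time a t.
Proof. by rewrite /at_time modnDr. Qed.

(** The queue started empty at time 0; after one turn it is stationary. *)
Fixpoint qlen a b t : nat :=
  if t is s.+1 then (qlen a b s + at_time a s.+1 - at_time b s.+1)%N else 0%N.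

Definition departures a b : line :=
  [ffun x : 'I_N => b x && (0 < qlen a b (x + (2 * N).-1) + a x)%N].

Definition pcount a t : nat := (\sum_(1 <= s < t.+1) at_time a s)%N.

Lemma countS a t : pcount a t.+1 = (pcount a t + at_time a t.+1)%N.
Proof. by rewrite /pcount big_nat_recr. Qed.

Lemma count0 a : pcount a 0 = 0%N.
Proof. by rewrite /pcount big_geq. Qed.

Lemma sum_at_time a : (\sum_(0 <= s < N) at_time a s = particles a)%N.
Proof.
rewrite big_mkord; apply: eq_bigr => x _.
by rewrite -(at_ord a x 0) mul0n addn0.
Qed.

Lemma countN a : pcount a N = particles a.
Proof.
have h : (at_time a 0 + pcount a N = \sum_(0 <= s < N.+1) at_time a s)%N.
  by rewrite [RHS]big_ltn.
have a0N : at_time a N = at_time a 0 by rewrite -[N in LHS]add0n at_timeDN.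
apply/eqP; rewrite -(eqn_add2l (at_time a 0)) h big_nat_recr//= sum_at_time a0N.
by rewrite addnC.
Qed.

Lemma countDN a t : pcount a (t + N) = (pcount a t + particles a)%N.
Proof.
elim: t => [|t IH]; first by rewrite add0n count0 countN.
by rewrite addSn !countS IH -addSn at_timeDN addnAC.
Qed.

Lemma le_count a s t : (s <= t)%N -> (pcount a s <= pcount a t)%N.
Proof. by move/subnKC <-; elim: (t - s)%N => [|d IH]; rewrite ?addn0// addnS countS (leq_trans IH)// leq_addr. Qed.

Local Open Scope int_scope.

Let net a b t : int := (pcount a t)%:Z - (pcount b t)%:Z.

Let netS a b t : net a b t.+1 = net a b t + (at_time a t.+1)%:Z - (at_time b t.+1)%:Z.
Proof. by rewrite /net !countS; lia. Qed.

(** With the next lemma: the queue length is the largest excess of arrivals over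
    services on an interval that ends now. *)
Lemma qlen_ge a b s t : (s <= t)%N -> net a b t - net a b s <= (qlen a b t)%:Z - (qlen a b s)%:Z.
Proof.
move/subnKC <-; elim: (t - s)%N => [|p IH]; first by rewrite addn0; lia.
by rewrite addnS netS /=; move: IH; lia.
Qed.

Lemma qlen_attained a b t : exists2 u, (u <= t)%N & (qlen a b t)%:Z = net a b t - net a b u.
Proof.
elim: t => [|t [u ut hu]]; first by exists 0%N; rewrite //= subrr.
have [h|h] := leqP (at_time b t.+1) (qlen a b t + at_time a t.+1).
  by exists u; [exact: leqW|rewrite netS /=; lia].
by exists t.+1 => //; rewrite /=; lia.
Qed.


Section stationarity.
Variables a b : line.
Hypothesis ab : (particles a <= particles b)%N.

Let netDN t : net a b (t + N) <= net a b t.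
Proof. by rewrite /net !countDN; lia. Qed.

Let netDN' t u : net a b (t + N) - net a b (u + N) = net a b t - net a b u.
Proof. by rewrite /net !countDN; lia. Qed.

(** A turn around the ring brings no net arrivals, so that an excess over more than
    one turn is not larger than one over less than a turn. *)
Lemma qlen_periodic t : (N <= t)%N -> qlen a b (t + N) = qlen a b t.
Proof.
move=> Nt; apply/eqP; rewrite eqn_leq; apply/andP; split.
  have [u ut hu] := qlen_attained a b (t + N).
  have [Nu|uN] := leqP N u.
    have h := @qlen_ge a b (u - N) t; have h2 := netDN' t (u - N).
    by rewrite subnK// in h2; have := h ltac:(lia); lia.
  by have h := @qlen_ge a b u t ltac:(lia); have := netDN t; lia.
have [u ut hu] := qlen_attained a b t.
have := @qlen_ge a b (u + N) (t + N); rewrite leq_add2r => /(_ ut).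
by rewrite netDN'; lia.
Qed.

Lemma departuresE s : (2 * N < s)%N ->
  at_time (departures a b) s = at_time b s && (0 < qlen a b s.-1 + at_time a s)%N.
Proof.
have per p t : (N <= t)%N -> qlen a b (t + p * N) = qlen a b t.
  elim: p t => [|p IH] t Nt; first by rewrite addn0.
  by rewrite mulSn addnA IH ?qlen_periodic// (leq_trans Nt)// leq_addr.
move=> sN; pose x := Ordinal (ltn_pmod s N_gt0).
have sE : s = (x + (s %/ N)%N * N)%N by rewrite /= addnC -divn_eq.
have q2 : (2 <= (s %/ N)%N)%N by rewrite leq_divRL// ltnW.
rewrite [in LHS]sE at_ord ffunE [in at_time b _]sE [in at_time a _]sE !at_ord.
congr (_ && (0 < _ + _))%N.
have -> : s.-1 = (x + (2 * N).-1 + ((s %/ N)%N - 2) * N)%N.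
  rewrite [in LHS]sE; move: ((s %/ N)%N) q2 => q; case: q => [//|[//|q]] _.
  by rewrite subn2/= !mulSn; lia.
by rewrite per//; lia.
Qed.

Lemma departures_is_queue : is_queue a b (departures a b) (fun x => qlen a b (x + 2 * N)).
Proof.
move=> x; have nx : exists p, (x.+1 = ordS x + p * N)%N.
  by exists ((x.+1 %/ N)%N); rewrite /= addnC -divn_eq.
have [p hp] := nx.
have per q t : (N <= t)%N -> qlen a b (t + q * N) = qlen a b t.
  elim: q t => [|q IH] t Nt; first by rewrite addn0.
  by rewrite mulSn addnA IH ?qlen_periodic// (leq_trans Nt)// leq_addr.
have E : ((x + 2 * N).+1 = ordS x + (p + 2) * N)%N by rewrite -addSn hp mulnDl addnA.
have q1 : qlen a b (ordS x + 2 * N) = qlen a b (x + 2 * N).+1.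
  have h2 : (N <= ordS x + 2 * N)%N by rewrite mulSn mul1n addnCA leq_addr.
  by rewrite E [(p + 2)%N]addnC mulnDl addnA (per p _ h2).
split; first by rewrite q1 /= -/(qlen a b _) E !at_ord.
rewrite -(at_ord (departures a b) (ordS x) (p + 2)) -E departuresE//; last by lia.
by rewrite [in at_time b _]E [in at_time a _]E !at_ord.
Qed.

Lemma particles_departures : particles (departures a b) = particles a.
Proof. exact: is_queue_particles departures_is_queue. Qed.

Lemma count_departures t : (t <= N)%N ->
  (pcount (departures a b) t + qlen a b (2 * N + t) = pcount a t + qlen a b (2 * N))%N.
Proof.
elim: t => [|t IH] tN; first by rewrite !count0 addn0.
rewrite !countS addnS /=.
have e (c : line) : at_time c (2 * N + t).+1 = at_time c t.+1.
  by rewrite -addnS addnC mulSn mul1n addnA !at_timeDN.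
have := IH (ltnW tN); rewrite -[at_time (departures a b) t.+1]e departuresE; last by lia.
rewrite /= !e; case: (at_time a t.+1) (at_time b t.+1) => -[] /=;
  by case: (qlen a b (2 * N + t)) => [|q] /=; lia.
Qed.

End stationarity.

(** The intertwining of the queue with the dynamics, [is_queue_exchange], for the
    stationary departures, which are the only ones. *)
Lemma departures_exchange a b x : (particles a <= particles b)%N ->
  departures (exchange a (bell b x)) (exchange b x) = exchange (departures a b) x.
Proof.
move=> ab; have [J' hJ'] := is_queue_exchange x (departures_is_queue ab).
apply: is_queue_uniq _ hJ'; apply: departures_is_queue.
by rewrite !particles_exchange.
Qed.

Lemma departures_le_services a b x : departures a b x -> b x.
Proof. by rewrite ffunE => /andP[]. Qed.

Lemma departures_le a a' b : (forall x, a x -> a' x) ->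
  forall x, departures a b x -> departures a' b x.
Proof.
move=> aa' x.
have at_le t : (at_time a t <= at_time a' t)%N.
  by rewrite /at_time; case: insub => //= y; case: (a y) (aa' y) => // ->.
have qq t : (qlen a b t <= qlen a' b t)%N.
  by elim: t => //= t IH; have := at_le t.+1; lia.
rewrite !ffunE => /andP[-> /=]; have := qq (x + (2 * N).-1)%N.
by case: (a x) (aa' x) => [->//|_]; case: (a' x); lia.
Qed.

End stationary_queue.

(** * The multi-line process *)

Section multiline_process.
Variables (N k : nat).
Hypothesis N_gt0 : (0 < N)%N.
Local Notation line := ({ffun 'I_N -> bool}).
Local Notation config := (config N k).
Implicit Types (a b : line) (x y : 'I_N) (A B : seq line) (al be : config).

(** The bell rings at [x] on the last line and climbs through the lines. *)
Definition bell_seq A x := foldr (@bell N) x A.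

Fixpoint move_seq A x : seq line :=
  if A is a :: A' then exchange a (bell_seq A' x) :: move_seq A' x else [::].

Lemma bell_move_inj A B x y : size A = size B ->
  bell_seq A x = bell_seq B y -> move_seq A x = move_seq B y -> x = y /\ A = B.
Proof.
elim: A B => [|a A IH] [|b B]//= [sAB] hb [he hm].
have [hxy ->] := bell_exchange_inj hb he.
by have [-> ->] := IH _ sAB hxy hm.
Qed.

Definition through A a := foldl (@departures N) a A.

Lemma particles_through A a :
  path leq (particles a) (map (@particles N) A) -> particles (through A a) = particles a.
Proof.
elim: A a => [//|b A IH] a /= /andP[ab pA].
have e := particles_departures N_gt0 ab.
by rewrite /through/= -/(through A _) IH ?e//; apply: path_le pA => //; exact: leq_trans.
Qed.

Lemma through_exchange A a x : path leq (particles a) (map (@particles N) A) ->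
  through (move_seq A x) (exchange a (bell_seq A x)) = exchange (through A a) x.
Proof.
elim: A a => [//|b A IH] a /= /andP[ab pA].
rewrite /through/= -/(through _ _) -/(through A _) departures_exchange//.
rewrite IH// particles_departures//; apply: path_le pA => //; exact: leq_trans.
Qed.

Lemma through_le A a b : (forall x, a x -> b x) ->
  forall x, through A a x -> through A b x.
Proof.
elim: A a b => [//|c A IH] a b ab; apply: IH => x; exact: departures_le.
Qed.

Definition after (p : nat) : seq 'I_k := [seq j : 'I_k <- enum 'I_k | (p <= j)%N].

Lemma val_after p : map val (after p) = iota p (k - p).
Proof.
rewrite /after -(filter_map val (fun j => p <= j)%N) val_enum_ord.
have [pk|kp] := leqP p k; last first.
  rewrite (_ : k - p = 0)%N; last by apply/eqP; rewrite subn_eq0 ltnW.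
  rewrite (eq_in_filter (a2 := pred0)) ?filter_pred0// => j.
  by rewrite mem_iota add0n => jk; apply/negbTE; rewrite -ltnNge (leq_ltn_trans _ kp)// ltnW.
rewrite -{1}(subnKC pk) iotaD filter_cat add0n.
rewrite (eq_in_filter (a2 := pred0)); last first.
  by move=> j; rewrite mem_iota add0n => jp; apply/negbTE; rewrite -ltnNge.
rewrite filter_pred0 cat0s (eq_in_filter (a2 := predT)) ?filter_predT// => j.
by rewrite mem_iota => /andP[->].
Qed.

Lemma after_ord (j : 'I_k) : after j = j :: after j.+1.
Proof.
apply: (inj_map val_inj); rewrite /= !val_after.
by rewrite -(subnSK (ltn_ord j)).
Qed.

Lemma after_nil p : (k <= p)%N -> after p = [::].
Proof.
move=> kp; apply: (inj_map val_inj); rewrite val_after/=.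
by have -> : (k - p = 0)%N by apply/eqP; rewrite subn_eq0.
Qed.

(** The particles of line [i] go through the queues of the lines [i + 1], ..., [k];
    the departures are the particles of class at most [i]. *)
Definition multiline_map al : config :=
  [ffun i : 'I_k => through (map al (after i.+1)) (al i)].

Definition move al x : config :=
  [ffun j : 'I_k => exchange (al j) (bell_seq (map al (after j.+1)) x)].

Lemma move_seqE al x p : move_seq (map al (after p)) x = map (move al x) (after p).
Proof.
move: {2}(k - p)%N (erefl (k - p)%N) => d; elim: d p => [|d IH] p dE.
  by rewrite after_nil// -subn_eq0 dE.
have pk : (p < k)%N by rewrite -subn_gt0 dE.
rewrite (after_ord (Ordinal pk)) /= IH ?ffunE//; lia.
Qed.

Lemma move_inj al be x y :
  bell_seq (map al (after 0)) x = bell_seq (map be (after 0)) y ->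
  move al x = move be y -> x = y /\ al = be.
Proof.
move=> hb hm; have sz : size (map al (after 0)) = size (map be (after 0)) by rewrite !size_map.
have he : move_seq (map al (after 0)) x = move_seq (map be (after 0)) y by rewrite !move_seqE hm.
have [-> hAB] := bell_move_inj sz hb he; split => //.
apply/ffunP => j; have /eq_in_map := hAB; apply.
by rewrite mem_filter mem_enum.
Qed.

Variable M : 'I_k -> nat.
Hypothesis M_mono : forall i j : 'I_k, (i <= j)%N -> (M i <= M j)%N.

Definition multiline : {set config} := [set al : config | [forall i, particles (al i) == M i]].

Lemma multilineP al : reflect (forall i, particles (al i) = M i) (al \in multiline).
Proof. by rewrite inE; apply: (iffP forallP) => h i; apply/eqP/h. Qed.

Lemma move_multiline al x : (move al x \in multiline) = (al \in multiline).
Proof.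
by apply/multilineP/multilineP => h i; have := h i; rewrite ffunE particles_exchange.
Qed.

Lemma path_after al (i : 'I_k) : al \in multiline ->
  path leq (particles (al i)) (map (@particles N) (map al (after i.+1))).
Proof.
move=> /multilineP h; move: {2}(k - i.+1)%N (erefl (k - i.+1)%N) => d.
elim: d i => [|d IH] i dE; first by rewrite after_nil// -subn_eq0 dE.
have pk : (i.+1 < k)%N by rewrite -subn_gt0 dE.
rewrite (after_ord (Ordinal pk)) /= IH ?andbT; last by rewrite /=; lia.
by rewrite !h M_mono//=.
Qed.

(** The image of the multi-line process is the multi-class process. *)
Lemma multiline_map_move al x i : al \in multiline ->
  multiline_map (move al x) i = exchange (multiline_map al i) x.
Proof.
move=> hal; rewrite !ffunE -move_seqE; exact/through_exchange/path_after.
Qed.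

Lemma particles_multiline_map al i : al \in multiline ->
  particles (multiline_map al i) = M i.
Proof.
move=> hal; rewrite ffunE particles_through; last exact: path_after.
exact/multilineP.
Qed.

Lemma multiline_map_le al (i j : 'I_k) x : j = i.+1 :> nat ->
  multiline_map al i x -> multiline_map al j x.
Proof.
move=> ji; rewrite !ffunE -ji after_ord /=; apply: through_le => y.
exact: departures_le_services.
Qed.

(** The jumps permute the pairs of a multi-line configuration and a site, since the
    site reached by the bell allows one to undo them; so the uniform law is
    invariant. *)
Lemma sum_move (V : nmodType) (F : config -> V) :
  (\sum_(al in multiline) \sum_(x < N) F (move al x) =
   \sum_(al in multiline) \sum_(x < N) F al)%R.
Proof.
rewrite pair_big_dep/= [RHS]pair_big_dep/=.
pose tau (p : config * 'I_N) := (move p.1 p.2, bell_seq (map p.1 (after 0)) p.2).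
have tau_inj : injective tau.
  by move=> [al x] [be y] [hm hb]; have [-> ->] := move_inj hb hm.
by rewrite [RHS](reindex_inj tau_inj)/=; apply: eq_bigl => -[al x]; rewrite /= move_multiline.
Qed.

End multiline_process.

Section stationary_law.
Variables (R : realType) (N k : nat) (m : 'I_k -> R).
Hypothesis N_gt0 : (0 < N)%N.
Hypothesis m_gt0 : forall i, 0 < m i.
Hypothesis m_le1 : forall i, m i <= 1.
Hypothesis m_mono : forall i j : 'I_k, (i <= j)%N -> m i <= m j.

Definition nparticles (i : 'I_k) : nat := Num.truncn (N%:R * m i).
Local Notation lines := (@multiline N k nparticles).

Lemma nparticles_mono (i j : 'I_k) : (i <= j)%N -> (nparticles i <= nparticles j)%N.
Proof. by move=> ij; apply: le_truncn; rewrite ler_wpM2l ?m_mono. Qed.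

Lemma nparticles_itv i : (nparticles i)%:R <= N%:R * m i < (nparticles i).+1%:R.
Proof. by apply: truncn_itv; rewrite mulr_ge0// ltW. Qed.

Lemma nparticles_leN i : (nparticles i <= N)%N.
Proof.
have /andP[h _] := nparticles_itv i; rewrite -(ler_nat R) (le_trans h)//.
by rewrite ler_piMr.
Qed.

Definition stationary_law (eta : config N k) : R :=
  #|[set al in lines | multiline_map al == eta]|%:R / #|lines|%:R.

Lemma lines_gt0 : (0 < #|lines|)%N.
Proof.
apply/card_gt0P; exists [ffun i => [ffun x : 'I_N => (x < nparticles i)%N]].
apply/multilineP => i; rewrite /particles.
under eq_bigr do rewrite !ffunE.
rewrite -(big_mkord xpredT (fun x => nat_of_bool (x < nparticles i)%N)).
rewrite (big_cat_nat (leq0n _) (nparticles_leN i))/= [X in (_ + X)%N]big1_seq ?addn0.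
  rewrite big_nat (eq_bigr (fun=> 1%N)) -?big_nat ?sum_nat_const_nat ?muln1 ?subn0//.
  by move=> x /andP[_ ->].
by move=> x /andP[_]; rewrite mem_index_iota => /andP[h _]; rewrite ltnNge h.
Qed.

Lemma sum_stationary_law (f : config N k -> R) :
  \sum_eta stationary_law eta * f eta =
  (#|lines|%:R)^-1 * \sum_(al in lines) f (multiline_map al).
Proof.
rewrite mulr_sumr [RHS](partition_big (@multiline_map N k) xpredT)//=.
apply: eq_bigr => eta _; rewrite (eq_bigr (fun=> (#|lines|%:R)^-1 * f eta)); last first.
  by move=> al /andP[_ /eqP ->].
rewrite sumr_const -[RHS]mulr_natl /stationary_law mulrA; congr (_ * _ * _); congr (_%:R).
by apply: eq_card => al; rewrite !inE unfold_in /= inE.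
Qed.

(** The image of an invariant law under an intertwining map is invariant. *)
Lemma stationary_law_invariant : invariant_law m stationary_law.
Proof.
have mono := nparticles_mono.
have c0 : (#|lines|%:R : R) != 0 by rewrite pnatr_eq0 -lt0n lines_gt0.
split.
- by move=> eta; rewrite divr_ge0.
- have := sum_stationary_law (fun=> 1); under eq_bigr do rewrite mulr1.
  by move=> ->; rewrite sumr_const mulVf.
- move=> eta hs; rewrite /stationary_law.
  suff -> : #|[set al in lines | multiline_map al == eta]| = 0%N by rewrite mul0r.
  apply: eq_card0 => al; rewrite !inE; apply/negbTE/negP => /andP[hal /eqP he].
  have {}hal : al \in lines by rewrite inE.
  apply: hs; rewrite -he; split.
    move=> i j ji x; have := @multiline_map_le N k N_gt0 al i j x ji.
    by case: (multiline_map al i x) => // ->.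
  by move=> i; exact: (particles_multiline_map N_gt0 mono i hal).
- move=> f; rewrite sum_stationary_law; apply/eqP; rewrite mulf_eq0 invr_eq0 (negbTE c0)/=.
  pose F al := f (multiline_map al).
  rewrite (eq_bigr (fun al => \sum_(x < N) F (move al x) - \sum_(x < N) F al)); last first.
    move=> al hal; rewrite /generator sumrB; congr (_ - _).
    apply: eq_bigr => x _; congr f; apply/ffunP => i.
    by rewrite ffunE (multiline_map_move N_gt0 mono).
  by rewrite sumrB subr_eq0; apply/eqP; apply: sum_move.
Qed.

Lemma invariant_lawE (P : config N k -> R) : invariant_law m P ->
  forall A, law_empirical P A =
    #|[set al in lines | empirical_k R (multiline_map al) \in A]|%:R / #|lines|%:R.
Proof.
move=> hP A; rewrite /law_empirical.
rewrite (eq_bigr stationary_law); last first.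
  by move=> eta _; exact: invariant_law_uniq hP stationary_law_invariant eta.
transitivity (\sum_eta stationary_law eta * (empirical_k R eta \in A)%:R).
  rewrite big_mkcond/=; apply: eq_bigr => eta _; case: ifP => _; rewrite ?mulr1 ?mulr0//.
rewrite sum_stationary_law mulrC -natr_sum; congr (_%:R * _).
rewrite -[RHS]sum1_card big_mkcond/= [RHS]big_mkcond/=; apply: eq_bigr => al _.
by rewrite [in RHS]inE; case: (al \in _) => //=; case: (_ \in A).
Qed.

End stationary_law.

(** * Empirical distribution functions *)

Section discrete_profiles.
Variables (R : realType) (N : nat).
Hypothesis N_gt0 : (0 < N)%N.
Local Notation line := ({ffun 'I_N -> bool}).
Implicit Types (a b : line) (t u : R).

(** The site 0 counts at the end of the turn, as the arcs (0, t] do not contain 0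
    unless [t = 1]. *)
Definition fcount a t : R := N%:R^-1 * (pcount a (Num.truncn (t * N%:R)))%:R.

Let N0 : 0 < N%:R :> R. Proof. by rewrite ltr0n. Qed.

Lemma truncn_leN t : 0 <= t <= 1 -> (Num.truncn (t * N%:R) <= N)%N.
Proof.
move=> /andP[t0 t1]; have tN : 0 <= t * N%:R by rewrite mulr_ge0.
have /andP[h _] := truncn_itv tN; rewrite -(ler_nat R) (le_trans h)//.
by rewrite ler_piMl.
Qed.

Lemma truncn_natdiv (j : nat) : Num.truncn (j%:R / N%:R * N%:R : R) = j.
Proof. by rewrite divfK ?natrK// gt_eqF. Qed.

Lemma le_natdiv_truncn (j : nat) t : 0 <= t ->
  (j%:R / N%:R <= t) = (j <= Num.truncn (t * N%:R))%N.
Proof. by move=> t0; rewrite truncn_ge_nat ?mulr_ge0// ler_pdivrMr. Qed.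

Lemma bounded01_fcount a : bounded01 (fcount a).
Proof.
exists (N%:R^-1 * (particles a)%:R) => t /truncn_leN tN.
rewrite ger0_norm ?mulr_ge0 ?invr_ge0// ler_wpM2l ?invr_ge0// ler_nat.
by rewrite -countN le_count.
Qed.

Lemma dfun_empirical a t : 0 <= t <= 1 ->
  dfun (@empirical R N a : fin_measC R) t = fcount a t.
Proof.
move=> t01; have t0 : 0 <= t by case/andP : t01.
have xN := truncn_leN t01; set x := Num.truncn _ in xN.
pose c (s : nat) : bool := if s == 0%N then 1 <= t else s%:R / N%:R <= t.
have iE (s : 'I_N) : (\d_(toC (s%:R / N%:R : R)) (iarc t) = (c s)%:R%:E :> \bar R)%E.
  rewrite diracE; congr (_%:R%:E); congr nat_of_bool; rewrite /c.
  have E : (toC (s%:R / N%:R : R) \in iarc t) = (clift (toC (s%:R / N%:R : R)) <= t).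
    by apply/idP/idP => [/set_mem/iarcE|h]; last exact/mem_set/iarcE.
  rewrite E; case: eqVneq => [s0|sn0]; first by rewrite s0 mul0r lift0.
  suff hs : 0 < (s%:R / N%:R : R) <= 1 by rewrite liftK.
  apply/andP; split; first by rewrite divr_gt0// ltr0n lt0n.
  by rewrite ler_pdivrMr// mul1r ler_nat ltnW.
apply: EFin_inj; transitivity (@empirical R N a (iarc t)); first exact: dfunE.
rewrite /empirical.
rewrite (eq_bigr (fun s : 'I_N => ((a s * c s)%N%:R : R)%:E)); last first.
  by move=> s _; rewrite iE -EFinM -natrM.
rewrite sumEFin -EFinM; congr EFin; rewrite /fcount -natr_sum; congr (_ * _%:R).
rewrite (eq_bigr (fun s : 'I_N => at_time a s * c s)%N); last first.
  by move=> s _; rewrite -(at_ord a s 0) mul0n addn0.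
rewrite -(big_mkord xpredT (fun s => at_time a s * c s)%N).
have e1 : (\sum_(1 <= s < N.+1) at_time a s * (s <= x) = pcount a x)%N.
  rewrite (big_cat_nat (n := x.+1))//=.
  rewrite [X in (_ + X)%N]big1_seq ?addn0; last first.
    by move=> s; rewrite mem_index_iota => /andP[_ /andP[h _]]; rewrite leqNgt h muln0.
  rewrite /pcount big_nat [RHS]big_nat; apply: eq_bigr => s /andP[_ h].
  by rewrite -ltnS h muln1.
rewrite -e1; have NN : (N <= x)%N = (1 <= t).
  by rewrite -le_natdiv_truncn// divff ?gt_eqF.
have a0N : at_time a N = at_time a 0 by have := at_timeDN a 0; rewrite add0n.
rewrite big_ltn// [RHS]big_nat_recr//= NN a0N addnC; congr (_ + _)%N.
rewrite big_nat [RHS]big_nat; apply: eq_bigr => s /andP[s1 _]; congr (_ * _)%N.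
rewrite /c; case: eqP => [s0|_]; first by rewrite s0 in s1.
by rewrite le_natdiv_truncn.
Qed.

Section two_lines.
Variables a b : line.
Hypothesis ab : (particles a <= particles b)%N.

Let net (j : nat) : R := (pcount a j)%:R - (pcount b j)%:R.

Let W := fcount a \- fcount b.

Let WE t : W t = N%:R^-1 * net (Num.truncn (t * N%:R)).
Proof. by rewrite /W /fcount /= -mulrBr. Qed.

Let netDN (j : nat) : net (j + N)%N = net j + net N.
Proof. by rewrite /net !countDN// !countN// !natrD; ring. Qed.

Let netN : net N <= 0.
Proof. by rewrite /net !countN// subr_le0 ler_nat. Qed.

Let W1 : W 1 = N%:R^-1 * net N.
Proof. by rewrite WE mul1r natrK. Qed.

Let qlen_geR (i j : nat) : (i <= j)%N -> net j - net i <= (qlen a b j)%:R.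
Proof.
move=> ij; have := qlen_ge N_gt0 a b ij; rewrite /= => h.
have {}h : ((pcount a j)%:Z - (pcount b j)%:Z) - ((pcount a i)%:Z - (pcount b i)%:Z)
   <= (qlen a b j)%:Z by lia.
by move: h; rewrite -(ler_int R) !intrB.
Qed.

Let qlen_attainedR (j : nat) : exists2 i, (i <= j)%N & (qlen a b j)%:R = net j - net i.
Proof.
have [i ij /= h] := qlen_attained N_gt0 a b j; exists i => //.
have {}h : (qlen a b j)%:Z =
   ((pcount a j)%:Z - (pcount b j)%:Z) - ((pcount a i)%:Z - (pcount b i)%:Z) by lia.
by rewrite -[LHS]/((qlen a b j)%:Z%:~R) h !intrB.
Qed.

(** The continuous formula for the queue length is exact on step functions. *)
Lemma fqueue_fcount t : 0 <= t <= 1 ->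
  fqueue W t = N%:R^-1 * (qlen a b (2 * N + Num.truncn (t * N%:R)))%:R.
Proof.
move=> t01; have t0 : 0 <= t by case/andP : t01.
have bW : bounded01 W by apply: bounded01B; exact: bounded01_fcount.
have Ni : 0 <= N%:R^-1 :> R by rewrite invr_ge0 ltW.
have xN := truncn_leN t01; set x := Num.truncn _ in xN *.
have -> : qlen a b (2 * N + x) = qlen a b (x + N).
  by rewrite -(qlen_periodic N_gt0 ab (t := x + N)) ?leq_addl//; congr qlen; lia.
apply/le_anti/andP; split.
  apply: fqueue_le => u u01; have yN := truncn_leN u01.
  have u0 : 0 <= u by case/andP : u01.
  rewrite /arc_inc W1 !WE -/x; set y := Num.truncn _ in yN *.
  case: (leP u t) => ut.
    have yx : (y <= x)%N by apply: le_truncn; rewrite ler_wpM2r// ltW.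
    rewrite addr0 -mulrBr ler_wpM2l//.
    by have := @qlen_geR (y + N) (x + N) ltac:(lia); rewrite !netDN; lra.
  rewrite -mulrBr -mulrDr ler_wpM2l//.
  by have := @qlen_geR y (x + N) ltac:(lia); rewrite netDN; lra.
have [i ix ->] := qlen_attainedR (x + N)%N.
have incE (j : nat) : arc_inc W (j%:R / N%:R) t =
    N%:R^-1 * (net x - net j + (if (j <= x)%N then 0 else net N)).
  rewrite /arc_inc W1 !WE -/x truncn_natdiv le_natdiv_truncn// -/x.
  by case: ifP => _; ring.
have [Ni'|iN] := leqP N i.
  apply: le_trans (arc_inc_le_fqueue bW t01 (@grid_itv R N (i - N) N_gt0 _)); last by lia.
  rewrite incE ler_wpM2l// (_ : (i - N <= x)%N = true); last by lia.
  by rewrite -{1}(subnK Ni') !netDN; lra.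
apply: le_trans (arc_inc_le_fqueue bW t01 (@grid_itv R N i N_gt0 (ltnW iN))).
rewrite incE ler_wpM2l// netDN; case: ifP => _; last by lra.
by move: netN; lra.
Qed.

Lemma fcount_departures t : 0 <= t <= 1 ->
  fcount (departures a b) t = fcollapse (fcount a) (fcount b) t.
Proof.
move=> t01; rewrite /fcollapse -/W !fqueue_fcount ?lexx ?ler01//.
have tN := truncn_leN t01; rewrite mul0r truncn0 addn0 /fcount.
have := count_departures N_gt0 ab tN => /(congr1 (fun j => j%:R : R)).
rewrite !natrD => h; rewrite -mulrDr -mulrBr; congr (_ * _); move: h; lra.
Qed.

End two_lines.

Lemma fcount_through (A : seq line) a G :
  path leq (particles a) (map (@particles N) A) -> near01 0 (fcount a) G -> bounded01 G ->
  near01 0 (fcount (through A a)) (foldl (fun G b => fcollapse G (fcount b)) G A).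
Proof.
elim: A a G => [//|b A IH] a G /= /andP[ab pA] aG bG.
apply: IH.
- by rewrite particles_departures//; apply: path_le pA => //; exact: leq_trans.
- have bb := bounded01_fcount b; have ba := bounded01_fcount a.
  have h2 : near01 0 (fcount b) (fcount b) by exact/near01_0.
  have := fcollapse_near ba bb bG bb aG h2; rewrite mulr0 => /near01_0 h.
  by apply/near01_0 => t t01; rewrite fcount_departures// h.
- by apply: bounded01_fcollapse => //; exact: bounded01_fcount.
Qed.

Variables (k : nat) (M : 'I_k -> nat).
Hypothesis M_mono : forall i j : 'I_k, (i <= j)%N -> (M i <= M j)%N.

(** The empirical measures of the multi-class process are exactly the collapsed
    empirical measures of the independent lines. *)
Lemma dfun_empirical_multiline (al : config N k) i t : al \in multiline N M ->
  0 <= t <= 1 ->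
  dfun (empirical_k R (multiline_map al) i : fin_measC R) t =
  fcollapse_k (fun j => fcount (al j)) i t.
Proof.
move=> hal t01; rewrite dfun_empirical// ffunE /fcollapse_k.
have := fcount_through (path_after N_gt0 M_mono i hal) (G := fcount (al i)).
move=> h; have /near01_0 : near01 0 (fcount (al i)) (fcount (al i)) by exact/near01_0.
have e s G : foldl (fun G b => fcollapse G (fcount b)) G (map al s) =
    foldl (fun G j => fcollapse G (fcount (al j))) G s.
  by elim: s G => //= j s IH G; rewrite IH.
by move=> /near01_0/h/(_ (bounded01_fcount _))/near01_0 -> //; rewrite e.
Qed.

End discrete_profiles.

(** * Counting configurations *)

Section binomial_bounds.
Variable R : realType.
Implicit Types (N M c L : nat).

(** Up to the factor [N ^ N], the weights of the binomial law. *)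
Let term N M c : nat := ('C(N, c) * (M ^ c * (N - M) ^ (N - c)))%N.

Let term_step N M c : (c < N)%N ->
  (term N M c.+1 * (c.+1 * (N - M)) = term N M c * ((N - c) * M))%N.
Proof.
move=> cN; rewrite /term expnS -(subnSK cN) expnS.
have h := mul_bin_left N c; rewrite -(subnSK cN) in h.
move: (M ^ c)%N ((N - M) ^ _)%N => p r; move: h; set d := (N - c.+1)%N.
by move=> h; transitivity ((c.+1 * 'C(N, c.+1)) * (M * p * r * (N - M)))%N; [|rewrite h]; ring.
Qed.

(** The binomial law of parameters [N] and [M / N] has its mode at [M]. *)
Let term_mode N M c : (M <= N)%N -> (c <= N)%N -> (term N M c <= term N M M)%N.
Proof.
move=> MN cN; have [MeN|MltN] := eqVneq M N.
  have [->|cM] := eqVneq c M; first by [].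
  rewrite /term MeN subnn [(0 ^ (N - c))%N]exp0n ?muln0//.
  by rewrite subn_gt0 ltn_neqAle cN andbT -MeN.
have K0 : (0 < N - M)%N by rewrite subn_gt0 ltn_neqAle MltN.
have [cM|Mc] := leqP c M.
  move: (subnKC cM); move: (M - c)%N => d; elim: d c cM cN => [|d IH] c cM cN dE.
    by rewrite -dE addn0.
  have cM' : (c < M)%N by lia.
  apply: leq_trans (IH c.+1 cM' (leq_trans cM' MN) ltac:(lia)).
  have := term_step M (leq_trans cM' MN) => h.
  have h2 : (c.+1 * (N - M) <= (N - c) * M)%N by nia.
  have h3 : (0 < c.+1 * (N - M))%N by rewrite muln_gt0.
  by rewrite -(leq_pmul2r h3) h leq_mul2l h2 orbT.
move: (subnKC (ltnW Mc)); move: (c - M)%N => d; elim: d c {Mc} cN => [|d IH] c cN dE.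
  by rewrite -dE addn0.
case: c dE cN => [|c] dE cN; first by lia.
apply: leq_trans (IH c (ltnW cN) ltac:(lia)).
have h := term_step M cN.
have h2 : ((N - c) * M <= c.+1 * (N - M))%N by nia.
have h3 : (0 < c.+1 * (N - M))%N by rewrite muln_gt0.
by rewrite -(leq_pmul2r h3) h leq_mul2l h2 orbT.
Qed.

Let term_sum N M : (M <= N)%N -> (\sum_(c < N.+1) term N M c = N ^ N)%N.
Proof.
move=> MN; transitivity ((N - M + M) ^ N)%N; last by rewrite subnK.
by rewrite expnDn; apply: eq_bigr => c _; rewrite /term; congr (_ * _)%N; exact: mulnC.
Qed.

Let term_le N M : (M <= N)%N -> (term N M M <= N ^ N)%N.
Proof.
move=> MN; rewrite -(term_sum MN) (bigD1 (Ordinal (MN : (M < N.+1)%N)))//=.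
exact: leq_addr.
Qed.

Let term_ge N M : (M <= N)%N -> (N ^ N <= N.+1 * term N M M)%N.
Proof.
move=> MN; rewrite -(term_sum MN) -[X in (_ <= X * _)%N]card_ord -sum_nat_const.
by apply: leq_sum => c _; apply: term_mode => //; rewrite -ltnS.
Qed.

Lemma expR_xlnx c L : (0 < L)%N ->
  expR (- (c%:R * ln (c%:R / L%:R))) * (c ^ c)%:R = (L ^ c)%:R :> R.
Proof.
move=> L0; have [->|c0] := eqVneq c 0%N.
  by rewrite mul0r oppr0 expR0 mul1r !expn0.
have c0' : 0 < c%:R :> R by rewrite ltr0n lt0n.
have L0' : 0 < L%:R :> R by rewrite ltr0n.
rewrite expRN expRM_natl lnK ?posrE ?divr_gt0// !natrX.
by rewrite -exprVn invf_div -exprMn divfK// gt_eqF.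
Qed.

Lemma expR_binent c L : (c <= L)%N ->
  expR (L%:R * binent (c%:R / L%:R)) * (c ^ c * (L - c) ^ (L - c))%:R = (L ^ L)%:R :> R.
Proof.
move=> cL; have [L0|L0] := posnP L.
  by move: cL; rewrite L0 leqn0 => /eqP ->; rewrite mul0r expR0 mul1r.
have L0' : L%:R != 0 :> R by rewrite pnatr_eq0 -lt0n.
have -> : L%:R * binent (c%:R / L%:R : R) = - (c%:R * ln (c%:R / L%:R)) -
    ((L - c)%N%:R * ln ((L - c)%N%:R / L%:R)).
  rewrite /binent (_ : 1 - c%:R / L%:R = (L - c)%N%:R / L%:R); last first.
    by rewrite natrB//; field.
  by rewrite natrB// ; field.
rewrite expRD natrM mulrACA !expR_xlnx//.
by rewrite -natrM -expnD subnKC.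
Qed.

(** The weight of the mode is at most 1. *)
Lemma binomial_le c L : (c <= L)%N ->
  'C(L, c)%:R <= expR (L%:R * binent (c%:R / L%:R)) :> R.
Proof.
move=> cL; have h := term_le cL; rewrite /term in h.
have p0 : 0 < (c ^ c * (L - c) ^ (L - c))%:R :> R.
  by rewrite ltr0n muln_gt0 !expn_gt0; case: (c) => [|c']; case: (L - _)%N.
by rewrite -(ler_pM2r p0) expR_binent// -natrM ler_nat.
Qed.

(** The weight of the mode is at least the average [1 / (L + 1)]. *)
Lemma binomial_ge c L : (c <= L)%N ->
  expR (L%:R * binent (c%:R / L%:R)) <= L.+1%:R * 'C(L, c)%:R :> R.
Proof.
move=> cL; have h := term_ge cL; rewrite /term in h.
have p0 : 0 < (c ^ c * (L - c) ^ (L - c))%:R :> R.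
  by rewrite ltr0n muln_gt0 !expn_gt0; case: (c) => [|c']; case: (L - _)%N.
by rewrite -(ler_pM2r p0) expR_binent// -!natrM ler_nat -mulnA.
Qed.

End binomial_bounds.

Section counting_lines.
Variables (N k : nat).
Local Notation line := ({ffun 'I_N -> bool}).
Local Notation config := (config N k).

Lemma card_ffun_prod (I T : finType) (B : I -> {set T}) :
  (#|[set g : {ffun I -> T} | [forall i, g i \in B i]]%SET| = \prod_i #|B i|)%N.
Proof.
transitivity (\prod_i \sum_(a : T) (a \in B i))%N; last first.
  apply: eq_bigr => i _; rewrite -[RHS]sum1_card [RHS]big_mkcond/=.
  by apply: eq_bigr => a _; case: (_ \in _).
rewrite bigA_distr_bigA/= -[LHS]sum1_card [LHS]big_mkcond/=; apply: eq_bigr => g _.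
rewrite inE; case: ifPn => [/forallP h|/forallPn[i hi]].
  by rewrite big1// => i _; rewrite h.
by rewrite (bigD1 i)//= (negbTE hi).
Qed.

Lemma card_line_sets (A : {set {set 'I_N}}) :
  (#|[set a : line | [set x | a x]%SET \in A]%SET| = #|A|)%N.
Proof.
pose f (S : {set 'I_N}) : line := [ffun x => x \in S].
have fK S : [set x | f S x]%SET = S by apply/finset.setP => x; rewrite inE ffunE.
have f_inj : injective f by move=> S S' h; rewrite -(fK S) h fK.
rewrite -(card_imset _ f_inj); apply: eq_card => a; rewrite inE.
apply/idP/imsetP => [h|[S SA ->]]; last by rewrite fK.
by exists [set x | a x]%SET => //; apply/ffunP => x; rewrite ffunE inE.
Qed.

Lemma particles_card (a : line) : particles a = #|[set x | a x]%SET|.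
Proof.
rewrite -[RHS]sum1_card [RHS]big_mkcond/=; apply: eq_bigr => x _; rewrite inE.
by case: (a x).
Qed.

Lemma card_particles M : (#|[set a : line | particles a == M]%SET| = 'C(N, M))%N.
Proof.
rewrite -[N in RHS]card_ord -(card_draws _ M) -card_line_sets.
by apply: eq_card => a; rewrite !inE particles_card.
Qed.

Lemma card_multiline (M : 'I_k -> nat) :
  (#|multiline N M| = \prod_(i < k) 'C(N, M i))%N.
Proof.
rewrite -(eq_bigr _ (fun i _ => card_particles (M i))) -card_ffun_prod.
by apply: eq_card => al; rewrite !inE; apply: eq_forallb => i; rewrite inE.
Qed.

Variables (n : nat) (b : 'I_N -> 'I_n).

Definition block_count (a : line) (j : 'I_n) : nat := #|[set x | a x && (b x == j)]%SET|.

Definition block_size (j : 'I_n) : nat := #|[set x | b x == j]%SET|.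

Lemma block_count_le a j : (block_count a j <= block_size j)%N.
Proof. by apply/subset_leq_card/fintype.subsetP => x; rewrite !inE => /andP[]. Qed.

Lemma block_size_le j : (block_size j <= N)%N.
Proof. by rewrite -[N in X in (_ <= X)%N]card_ord max_card. Qed.

Lemma particles_blocks a : particles a = (\sum_(j < n) block_count a j)%N.
Proof.
rewrite particles_card -sum1_card (partition_big b xpredT)//=; apply: eq_bigr => j _.
by rewrite /block_count -[RHS]sum1_card; apply: eq_bigl => x; rewrite !inE.
Qed.

(** The particles can be placed independently in each of the blocks. *)
Lemma card_blocks_ge (a0 : line) :
  (\prod_(j < n) 'C(block_size j, block_count a0 j) <=
   #|[set a : line | [forall j, block_count a j == block_count a0 j]]%SET|)%N.
Proof.
pose F (j : 'I_n) : {set {set 'I_N}} :=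
  [set S : {set 'I_N} | (S \subset [set x | b x == j]%SET) & #|S| == block_count a0 j]%SET.
have cF j : #|F j| = 'C(block_size j, block_count a0 j) by rewrite cards_draws.
rewrite -(eq_bigr _ (fun j _ => cF j)).
rewrite -card_ffun_prod.
pose join (g : {ffun 'I_n -> {set 'I_N}}) : line := [ffun x => x \in g (b x)].
have joinK (g : {ffun 'I_n -> {set 'I_N}}) : [forall j, g j \in F j] -> forall j, [set x | join g x && (b x == j)]%SET = g j.
  move=> /forallP hg j; apply/finset.setP => x; rewrite inE ffunE.
  have := hg j; rewrite inE => /andP[/fintype.subsetP hs _].
  apply/andP/idP => [[h /eqP <-]//|h].
  by have := hs _ h; rewrite inE => /eqP e; rewrite e.
rewrite -(card_in_imset (f := join)); last first.
  move=> g g'; rewrite !inE => hg hg' e; apply/ffunP => j.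
  by rewrite -(joinK _ hg) -(joinK _ hg') e.
apply/subset_leq_card/fintype.subsetP => _ /imsetP[g hg ->]; rewrite inE in hg.
rewrite inE; apply/forallP => j; rewrite /block_count joinK//.
by move/forallP : hg => /(_ j); rewrite inE => /andP[].
Qed.

Variable R : realType.

(** Chernoff's bound: the configurations are weighted by a product law whose
    parameters are constant on the blocks. *)
Lemma card_le_weight (q : 'I_k -> 'I_n -> R) (K : R) (U : {set config}) :
  (forall i j, 0 < q i j < 1) ->
  (forall al, al \in U -> - K <= \sum_(i < k) \sum_(j < n)
     ((block_count (al i) j)%:R * ln (q i j) +
      (block_size j - block_count (al i) j)%N%:R * ln (1 - q i j))) ->
  #|U|%:R <= expR K.
Proof.
move=> q01 hU.
pose g i x (c : bool) : R := if c then q i (b x) else 1 - q i (b x).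
have g0 i x c : 0 < g i x c by rewrite /g; have := q01 i (b x); case: c; lra.
have total : \sum_(al : config) \prod_(i < k) \prod_(x < N) g i x (al i x) = 1.
  rewrite -(bigA_distr_bigA (fun i (a : line) => \prod_(x < N) g i x (a x))) big1// => i _.
  rewrite -(bigA_distr_bigA (fun x c => g i x c)) big1// => x _.
  by rewrite big_bool /g/= addrC subrK.
have wE (al : config) : \prod_(i < k) \prod_(x < N) g i x (al i x) =
    expR (\sum_(i < k) \sum_(j < n)
     ((block_count (al i) j)%:R * ln (q i j) +
      (block_size j - block_count (al i) j)%N%:R * ln (1 - q i j))).
  rewrite expR_sum; apply: eq_bigr => i _.
  rewrite (eq_bigr (fun x => expR (ln (g i x (al i x))))); last first.
    by move=> x _; rewrite lnK// posrE.
  rewrite -expR_sum; congr expR; rewrite (partition_big b xpredT)//=.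
  apply: eq_bigr => j _; rewrite (bigID (fun x => al i x))/=; congr (_ + _).
    rewrite (eq_bigr (fun=> ln (q i j))) => [|x /andP[/eqP bx ax]]; last by rewrite /g ax bx.
    rewrite sumr_const mulr_natl; congr (_ *+ _).
    by apply: eq_card => x; rewrite !inE unfold_in/= andbC.
  rewrite (eq_bigr (fun=> ln (1 - q i j))) => [|x /andP[/eqP bx ax]]; last first.
    by rewrite /g (negbTE ax) bx.
  rewrite sumr_const mulr_natl; congr (_ *+ _).
  have -> : block_size j = (block_count (al i) j + #|[set x | ~~ al i x && (b x == j)]%SET|)%N.
    rewrite /block_size -(cardsID [set x | al i x]%SET); congr (_ + _)%N.
      by apply: eq_card => x; rewrite !inE andbC.
    by apply: eq_card => x; rewrite !inE.
  by rewrite addKn; apply: eq_card => x; rewrite !inE unfold_in/= andbC.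
have : expR (- K) * #|U|%:R <= 1.
  rewrite -[leRHS]total mulr_natr -sumr_const big_mkcond/=; apply: ler_sum => al _.
  case: ifPn => [/hU h|_]; first by rewrite wE ler_expR.
  by apply: prodr_ge0 => i _; apply: prodr_ge0 => x _; exact: ltW.
by rewrite expRN mulrC ler_pdivrMr ?expR_gt0// mul1r.
Qed.

End counting_lines.

(** * Blocks of sites, and closeness on a grid *)

Section sites_and_cells.
Variables (R : realType) (N n : nat).
Hypothesis N_gt0 : (0 < N)%N.
Hypothesis n_gt0 : (0 < n)%N.
Local Notation line := ({ffun 'I_N -> bool}).

Lemma site_block : exists b : 'I_N -> 'I_n,
  forall x j, (b x == j) = `[< cell n j (toC (x%:R / N%:R : R)) >].
Proof.
have H (x : 'I_N) : exists j : 'I_n, cell n j (toC (x%:R / N%:R : R)).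
  have [j jn jx] := cell_cover (toC (x%:R / N%:R : R)) n_gt0.
  by exists (Ordinal jn).
have [b hb] := choice H.
exists b => x j; apply/eqP/asboolP => [<- //|h].
exact/ord_inj/(cell_uniq n_gt0 (hb x) h).
Qed.

Variable b : 'I_N -> 'I_n.
Hypothesis bE : forall x j, (b x == j) = `[< cell n j (toC (x%:R / N%:R : R)) >].

Lemma block_count_dincr (a : line) (j : 'I_n) :
  (block_count b a j)%:R = N%:R * dincr (@fcount R N a) n j.
Proof.
have N0 : N%:R != 0 :> R by rewrite pnatr_eq0 -lt0n.
have : (@empirical R N a : fin_measC R) (cell n j) = (dincr (@fcount R N a) n j)%:E.
  by rewrite measure_cell /dincr !dfun_empirical// grid_itv// ltnW.
rewrite -[LHS]/(@empirical R N a (cell n j)) /empirical.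
rewrite (eq_bigr (fun x : 'I_N => ((a x && (b x == j))%:R : R)%:E)); last first.
  move=> x _; rewrite diracE bE -EFinM -natrM; congr (_%:R%:E).
  have -> : (toC (x%:R / N%:R : R) \in cell n j) = `[< cell n j (toC (x%:R / N%:R : R)) >] by [].
  by case: (a x); case: asbool.
rewrite sumEFin -EFinM => -[<-]; rewrite mulrA divff// mul1r -natr_sum; congr (_%:R).
rewrite /block_count -sum1_card big_mkcond/=; apply: eq_bigr => x _; rewrite inE.
by case: (_ && _).
Qed.

Let full : line := [ffun=> true].

Lemma block_size_dincr (j : 'I_n) :
  (block_size b j)%:R = N%:R * dincr (@fcount R N full) n j.
Proof.
rewrite -block_count_dincr; congr (_%:R); rewrite /block_size /block_count.
by apply: eq_card => x; rewrite !inE ffunE.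
Qed.

Lemma pcount_full p : pcount full p = p.
Proof.
elim: p => [|p IH]; first by rewrite count0.
rewrite countS IH /at_time; case: insubP => [x _ _|]; first by rewrite /= ffunE addn1.
by rewrite ltn_mod N_gt0.
Qed.

Lemma block_size_near (j : 'I_n) :
  `|(block_size b j)%:R - N%:R / n%:R| <= 1 :> R.
Proof.
have N0 : 0 < N%:R :> R by rewrite ltr0n.
have n0 : 0 < n%:R :> R by rewrite ltr0n.
have h (t : R) : 0 <= t -> t * N%:R - 1 <= N%:R * fcount full t <= t * N%:R.
  move=> t0; rewrite /fcount pcount_full mulrA divff ?gt_eqF// mul1r.
  have tN : 0 <= t * N%:R by rewrite mulr_ge0// ltW.
  have /andP[h1 h2] := truncn_itv tN; rewrite h1 andbT -natr1 in h2 *; lra.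
rewrite block_size_dincr /dincr mulrBr.
have h1 := h (j.+1%:R / n%:R) (divr_ge0 _ _).
have h2 := h (j%:R / n%:R) (divr_ge0 _ _).
have e : j.+1%:R / n%:R * N%:R = j%:R / n%:R * N%:R + N%:R / n%:R :> R.
  by rewrite -natr1; field; rewrite gt_eqF.
rewrite ler_norml; move: (h1 (ler0n _ _) (ler0n _ _)) (h2 (ler0n _ _) (ler0n _ _)).
by rewrite e; lra.
Qed.

End sites_and_cells.

Section near_profiles.
Variables (R : realType) (N : nat).
Hypothesis N_gt0 : (0 < N)%N.
Local Notation line := ({ffun 'I_N -> bool}).

Lemma fcount_incr (a : line) (s t : R) : 0 <= s -> s <= t ->
  0 <= fcount a t - fcount a s <= t - s + N%:R^-1.
Proof.
move=> s0 st; have N0 : 0 < N%:R :> R by rewrite ltr0n.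
have t0 := le_trans s0 st.
have xy : (Num.truncn (s * N%:R) <= Num.truncn (t * N%:R))%N.
  by apply: le_truncn; rewrite ler_wpM2r// ltW.
have sN : 0 <= s * N%:R by rewrite mulr_ge0// ltW.
have tN : 0 <= t * N%:R by rewrite mulr_ge0// ltW.
have := truncn_itv sN; have := truncn_itv tN; move: xy.
rewrite /fcount -mulrBr; set x := Num.truncn _; set y := Num.truncn _ => xy hy hx.
have h1 := le_count a xy.
have h2 : (pcount a y <= pcount a x + (y - x))%N.
  rewrite -{1}(subnKC xy); elim: (y - x)%N => [|p IH]; first by rewrite !addn0.
  by rewrite addnS countS; case: (at_time _ _); lia.
rewrite -natrB// mulr_ge0 ?invr_ge0 ?(ltW N0)//= mulrC ler_pdivrMr// mulrDl mulrBl mulVf ?gt_eqF//.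
have h3 : (pcount a y - pcount a x)%N%:R <= (y - x)%N%:R :> R by rewrite ler_nat; lia.
by apply: le_trans h3 _; rewrite natrB//; move: hx hy; rewrite -[y.+1%:R]natr1 -[x.+1%:R]natr1; lra.
Qed.

(** Closeness on a grid extends to the whole interval, by monotonicity. *)
Lemma near_grid (m d : R) (F G : R -> R) n : (0 < n)%N -> profile m F ->
  nondecr01 G ->
  (forall j, (j <= n)%N -> `|G (j%:R / n%:R) - F (j%:R / n%:R)| <= d) ->
  near01 (d + n%:R^-1) G F.
Proof.
move=> n0 [F0 F1 hF] hG hd t /andP[t0 t1].
have n0' : 0 < n%:R :> R by rewrite ltr0n.
have tn : 0 <= t * n%:R by rewrite mulr_ge0// ltW.
have itv (j : nat) : (j <= n)%N -> j%:R / n%:R <= 1 :> R.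
  by move=> jn; rewrite ler_pdivrMr// mul1r ler_nat.
have [j [jn hj]] : exists j : nat, (j < n)%N /\ j%:R / n%:R <= t <= j.+1%:R / n%:R.
  have /andP[h1 h2] := truncn_itv tn.
  have [h|h] := ltnP (Num.truncn (t * n%:R)) n.
    by exists (Num.truncn (t * n%:R)); rewrite h ler_pdivrMr// ler_pdivlMr// h1 ltW.
  have t1' : t = 1.
    apply/le_anti; rewrite t1/= -(ler_pM2r n0') mul1r (le_trans _ h1)//.
    by rewrite ler_nat.
  by exists n.-1; rewrite prednK// t1' divff ?gt_eqF// lexx andbT itv ?leq_pred// -ltnS prednK.
have /andP[h1 h2] := hj.
have := hF (j%:R / n%:R) (j.+1%:R / n%:R) (divr_ge0 (ler0n _ _) (ler0n _ _)) (le_trans h1 h2) (itv _ jn).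
rewrite -mulrBl -[j.+1%:R]natr1 [j%:R + 1 - _]addrAC subrr add0r mul1r.
have := hF _ _ (divr_ge0 (ler0n _ _) (ler0n _ _)) h1 t1.
have := hF _ _ t0 h2 (itv _ jn).
have := hG _ _ (divr_ge0 (ler0n _ _) (ler0n _ _)) h1 t1.
have := hG _ _ t0 h2 (itv _ jn).
have := hd _ (ltnW jn); have := hd _ jn.
rewrite -[j.+1%:R]natr1 !ler_norml; lra.
Qed.

End near_profiles.

Section integrals_near.
Variable R : realType.
Implicit Types (mu nu : fin_measC R).

Section one_function.
Variable f : circle R -> R.
Hypothesis f_cont : continuous f.

Let g : R -> R := f \o @toC R.

Let g_cont : continuous g.
Proof. by move=> x; apply: continuous_comp; [exact: toC_continuous|exact: f_cont]. Qed.

Let fE w : f w = g (clift w).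
Proof. by rewrite /g /= toC_lift. Qed.

Lemma continuous_circle_measurable : measurable_fun setT f.
Proof.
rewrite (_ : f = g \o @clift R); last by apply/funext => w; rewrite /= fE.
apply: measurableT_comp; last exact: measurable_lift.
exact: continuous_measurable_fun.
Qed.

Lemma continuous_circle_bounded : exists2 M, 0 <= M & forall w, `|f w| <= M.
Proof.
have : compact (g @` `[0, 1]%classic).
  apply: continuous_compact; last exact: segment_compact.
  exact: continuous_subspaceT.
move=> /compact_bounded[M [_ hM]]; exists (`|M| + 1); first by rewrite addr_ge0.
move=> w; apply: hM.
  by rewrite (le_lt_trans (ler_norm M))// ltrDl.
by exists (clift w); rewrite ?fE//= in_itv/=; have := lift_itv w; lra.
Qed.

(** A continuous function on the circle is uniformly continuous. *)
Lemma continuous_circle_step e : 0 < e -> exists2 n, (0 < n)%N &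
  forall w, `|f w - step n (fun j => g (j.+1%:R / n%:R)) w| <= e.
Proof.
move=> e0; pose P (i : R) (x : R) := forall y, `|x - y| < i -> `|g x - g y| <= e.
have /compact_near_coveringP/(_ R (at_right (0 : R)) P _) := @segment_compact R 0 1.
case.
  move=> x _; have e2 : 0 < e / 2 by rewrite divr_gt0.
  have /cvgrPdist_lt/(_ _ e2) := g_cont (x := x).
  move=> /nbhs_ballP[d /= d0 hd].
  have d2 : 0 < d / 2 by rewrite divr_gt0.
  exists (ball x (d / 2), [set i | i < d / 2]) => /=.
    by split; [exact: nbhsx_ballx|exact: nbhs_right_lt].
  move=> [x' i] /= [hx' hi] y hy.
  have h1 : `|g x - g x'| < e / 2.
    by apply: hd; apply: (le_ball _ hx'); lra.
  have h2 : `|g x - g y| < e / 2.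
    apply: hd; rewrite /ball/=; have -> : x - y = (x - x') + (x' - y) by ring.
    by rewrite (le_lt_trans (ler_normD _ _))//; move: hx'; rewrite /ball/=; lra.
  have -> : g x' - g y = (g x - g y) - (g x - g x') by ring.
  by rewrite (le_trans (ler_normB _ _))//; lra.
move=> d /= d0 hd.
pose n := (Num.truncn (2 / d)).+1.
have n0 : 0 < n%:R :> R by rewrite ltr0n.
have nd : n%:R^-1 <= d / 2.
  rewrite -[leRHS]invrK lef_pV2 ?posrE ?invr_gt0 ?divr_gt0// invf_div ltW//.
  exact: truncnS_gt.
exists n => // w; have [j jn jw] := cell_cover w (ltn0Sn _ : (0 < n)%N).
rewrite (step_cell _ jn jw) fE.
apply: (hd (d / 2)) => //.
- by rewrite /ball/= sub0r normrN gtr0_norm ?divr_gt0//; lra.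
- by rewrite divr_gt0.
- by rewrite /= in_itv/=; have := lift_itv w; lra.
- move/cellE : jw => /andP[h1 h2].
  apply: lt_le_trans nd; rewrite distrC ger0_norm ?subr_ge0// ltrBlDr -ltrBlDl.
  by rewrite (_ : _ - n%:R^-1 = j%:R / n%:R)// -natr1; field; rewrite gt_eqF.
Qed.

Lemma integrable_continuous_circle mu : mu.-integrable setT (EFin \o f).
Proof.
have [M _ hM] := continuous_circle_bounded.
by apply: (@bounded_integrable _ _ _ mu _ M) => //; exact: continuous_circle_measurable.
Qed.

Lemma integrable_step mu n c : mu.-integrable setT (EFin \o step n c).
Proof.
apply: (@bounded_integrable _ _ _ mu _ (\sum_(j < n) `|c j|)).
  exact: step_measurable.
move=> w; rewrite /step (le_trans (ler_norm_sum _ _ _))//; apply: ler_sum => j _.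
by rewrite normrM indicE ler_piMr//; case: (_ \in _); rewrite ?normr1 ?normr0.
Qed.

Lemma Rintegral_step_near mu e n : 0 <= e -> dfun mu 1 <= 1 ->
  (forall w, `|f w - step n (fun j => g (j.+1%:R / n%:R)) w| <= e) ->
  `|\int[mu]_w f w - \sum_(j < n) g (j.+1%:R / n%:R) * dincr (dfun mu) n j| <= e.
Proof.
move=> e0 mu1 h.
have -> : \sum_(j < n) g (j.+1%:R / n%:R) * dincr (dfun mu) n j =
    \int[mu]_w step n (fun j => g (j.+1%:R / n%:R)) w.
  by rewrite /Rintegral integral_step.
have i1 := integrable_continuous_circle mu.
have i2 := integrable_step mu n (fun j => g (j.+1%:R / n%:R)).
rewrite -RintegralB//.
apply: le_trans (le_normr_Rintegral _ _) _ => //; first exact: integrableB i1 i2.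
apply: (@le_trans _ _ (\int[mu]_w (cst e w))).
  apply: le_Rintegral => //.
  - exact: (integrable_abse (integrableB _ i1 i2)).
  - exact: finite_measure_integrable_cst.
rewrite Rintegral_cst//.
rewrite [X in e * X](_ : _ = dfun mu 1); first by rewrite ler_piMr.
by rewrite /dfun iarc1.
Qed.

(** Integrals of a fixed continuous function are uniformly continuous in the
    distribution function of the measure. *)
Lemma Rintegral_near e : 0 < e -> exists2 d, 0 < d &
  forall mu nu, dfun mu 1 <= 1 -> dfun nu 1 <= 1 -> near01 d (dfun mu) (dfun nu) ->
  `|\int[mu]_w f w - \int[nu]_w f w| < e.
Proof.
move=> e0; have e4 : 0 < e / 4 by rewrite divr_gt0.
have [n n0 hn] := continuous_circle_step e4.
have [M M0 hM] := continuous_circle_bounded.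
have nM0 : 0 <= n%:R * M by rewrite mulr_ge0.
have nM : 0 < (n%:R * M + 1) * 8 by rewrite mulr_gt0//; lra.
exists (e / ((n%:R * M + 1) * 8)); first by rewrite divr_gt0.
move=> mu nu mu1 nu1 hd; set d := e / _ in hd.
have h1 := Rintegral_step_near (ltW e4) mu1 hn.
have h2 := Rintegral_step_near (ltW e4) nu1 hn.
have n0' : 0 < n%:R :> R by rewrite ltr0n.
have d0 : 0 < d by rewrite divr_gt0.
have h3 : `|\sum_(j < n) g (j.+1%:R / n%:R) * dincr (dfun mu) n j -
            \sum_(j < n) g (j.+1%:R / n%:R) * dincr (dfun nu) n j| <= n%:R * (M * (2 * d)).
  rewrite -sumrB (le_trans (ler_norm_sum _ _ _))//.
  rewrite -[n in leRHS]card_ord mulr_natl -sumr_const; apply: ler_sum => j _.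
  rewrite -mulrBr normrM; apply: ler_pM => //; first exact: hM.
  have h4 := hd _ (grid_itv R n0 (ltnW (ltn_ord j))); have h5 := hd _ (grid_itv R n0 (ltn_ord j)).
  by rewrite /dincr; move: h4 h5; rewrite !ler_norml; lra.
have h6 : n%:R * (M * (2 * d)) <= e / 4.
  have -> : e / 4 = (n%:R * M + 1) * 2 * d by rewrite /d; field; rewrite gt_eqF//; lra.
  by move: nM0; nra.
move: h1 h2 h3; rewrite !ler_norml ltr_norml; lra.
Qed.

End one_function.
End integrals_near.

(** * The weak topology *)

Section weak_topology.
Variable R : realType.

Lemma cvg_initial (S : choiceType) (T : topologicalType) (h : S -> T)
    (F : set_system S) (s : S) : Filter F ->
  h @ F --> h s -> F --> (s : initial_topology h).
Proof.
move=> FF hF A; rewrite /= nbhsE => -[B [[C oC <-] hs] BA].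
apply: filterS BA _; apply: (hF C); exact: open_nbhs_nbhs.
Qed.

Lemma cvg_measCk k (F : set_system (measCk R k)) (rho : measCk R k) : Filter F ->
  (forall (i : 'I_k) (f : continuousType (circle R) R),
     (\int[(r i : fin_measC R)]_u f u) @[r --> F] --> \int[(rho i : fin_measC R)]_u f u) ->
  F --> rho.
Proof.
move=> FF h; apply/cvg_sup => i.
apply: (@cvg_initial _ _ (fun r : measCk R k => r i)).
apply: (@cvg_initial _ _ (@integrals R) ((fun r : measCk R k => r i) @ F) (rho i)).
apply/cvg_sup => f.
apply: (@cvg_initial _ _ (fun p => p f) (@integrals R @ ((fun r : measCk R k => r i) @ F))).
exact: h.
Qed.

Lemma continuous_integral k (i : 'I_k) (f : continuousType (circle R) R) :
  continuous (fun r : measCk R k => \int[(r i : fin_measC R)]_u f u).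
Proof.
move=> rho.
apply: (@continuous_comp _ _ _ (fun r : measCk R k => r i)
  (fun mu : measC R => \int[(mu : fin_measC R)]_u f u)).
  exact: (@proj_continuous _ (fun _ : 'I_k => measC R : topologicalType) i rho).
apply: (@continuous_comp _ _ _ (@integrals R : measC R -> _) (fun p => p f)).
  exact: initial_continuous.
exact: (@proj_continuous _ (fun _ : continuousType (circle R) R => R : topologicalType) f).
Qed.

(** A weak neighbourhood of [rho] contains all the measures whose distribution
    functions are uniformly close to those of [rho]. *)
Lemma open_near k (O : set (measCk R k)) (rho : measCk R k) : open O -> O rho ->
  (forall i, dfun (rho i : fin_measC R) 1 <= 1) ->
  exists2 d, 0 < d & forall r : measCk R k,
    (forall i, dfun (r i : fin_measC R) 1 <= 1) ->
    (forall i, near01 d (dfun (r i : fin_measC R)) (dfun (rho i : fin_measC R))) -> O r.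
Proof.
move=> oO Orho rho1.
pose B (d : R) : set (measCk R k) := [set r : measCk R k |
  (forall i, dfun (r i : fin_measC R) 1 <= 1) /\
  (forall i, near01 d (dfun (r i : fin_measC R)) (dfun (rho i : fin_measC R)))].
pose F := filter_from [set d | 0 < d] B.
have FF : Filter F.
  apply: filter_from_filter; first by exists 1 => /=; exact: ltr01.
  move=> d d' /= d0 d0'; exists (Num.min d d'); first by rewrite /= lt_min d0.
  move=> r [r1 hr]; split; split => // i t t01;
    by rewrite (le_trans (hr i t t01))// ge_min lexx ?orbT.
have : F --> rho.
  apply: cvg_measCk => i f; apply/cvgrPdist_lt => e e0.
  have [d d0 hd] := Rintegral_near (@cts_fun _ _ f) e0.
  exists d => // r [r1 hr] /=; rewrite distrC; apply: hd => //.
move=> /(_ O) []; first exact: open_nbhs_nbhs.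
by move=> d /= d0 hd; exists d => // r r1 hr; apply: hd.
Qed.

End weak_topology.

Section separation.
Variable R : realType.
Implicit Types (mu nu : fin_measC R) (t x : R).

Let bump t (n : nat) x : R :=
  Num.max 0 (Num.min 1 (1 + n%:R * (cos (2 * pi * (x - t / 2)) - cos (pi * t)))).

Let cos_int (x : R) (n : int) : cos (x + 2 * pi * n%:~R) = cos x.
Proof.
have P (y : R) (p : nat) : cos (y + 2 * pi * p%:R) = cos y.
  elim: p => [|p IH]; first by rewrite mulr0 addr0.
  have -> : y + 2 * pi * p.+1%:R = y + 2 * pi * p%:R + pi *+ 2.
    by rewrite -natr1 -[pi *+ 2]mulr_natl; ring.
  by rewrite cosD2pi IH.
case: n => p; first exact: P.
rewrite -[LHS](P _ p.+1); congr cos.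
by rewrite NegzE intrN -[(p.+1 : int)%:~R]/(p.+1%:R : R); ring.
Qed.

Let bump_periodic t n x (p : int) : bump t n (x + p%:~R) = bump t n x.
Proof.
rewrite /bump; congr (Num.max _ (Num.min _ (_ + _ * (_ - _)))).
by rewrite -(cos_int (2 * pi * (x - t / 2)) p); congr cos; ring.
Qed.

Let bump_cont t n : continuous (bump t n).
Proof.
move=> x; rewrite /bump.
apply: (@continuous_max _ _ (cst 0) (fun x => Num.min 1 _)); first exact: cvg_cst.
apply: (@continuous_min _ _ (cst 1)); first exact: cvg_cst.
apply: cvgD; first exact: cvg_cst.
apply: cvgM; first exact: cvg_cst.
apply: cvgB; last exact: cvg_cst.
apply: (@continuous_comp _ _ _ (fun x => 2 * pi * (x - t / 2)) cos); last exact: continuous_cos.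
apply: cvgM; first exact: cvg_cst.
by apply: cvgB; [exact: cvg_id|exact: cvg_cst].
Qed.

Let bumpC t n (w : circle R) : R := bump t n (repr w).

Let bumpC_cont t n : continuous (bumpC t n).
Proof.
apply: repr_comp_continuous; first exact: bump_cont.
move=> x y /eqP/toC_eq/intrP[p hp]; apply/eqP.
by rewrite -(bump_periodic t n y p) -hp addrC subrK.
Qed.

Let bumpCE t n w : bumpC t n w = bump t n (clift w).
Proof.
rewrite /bumpC; have /toC_eq/intrP[p hp] : toC (repr w) = toC (clift w).
  by rewrite toC_repr toC_lift.
by rewrite -(bump_periodic t n (clift w) p) -hp addrC subrK.
Qed.

(** On ]0, 1], the cosine singles out the closed arc from 0 to [t]. *)
Let cos_arc t x : 0 <= t < 1 -> 0 < x <= 1 ->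
  (cos (pi * t) <= cos (2 * pi * (x - t / 2))) = (x <= t) || (x == 1).
Proof.
move=> /andP[t0 t1] /andP[x0 x1]; have p0 := pi_gt0 R.
have pt : pi * t \in `[0, pi] by rewrite in_itv/=; apply/andP; split; nra.
have [->|xn1] := eqVneq x 1.
  rewrite orbT; have -> : 2 * pi * (1 - t / 2) = - (pi * t) + 2 * pi * (1 : int)%:~R :> R.
    by rewrite mulr1z; field.
  by rewrite cos_int cosN lexx.
have x1' : x < 1 by rewrite lt_neqAle xn1.
rewrite orbF; have [xt|tx] := leP x t.
  rewrite -[leRHS]cos_norm; set y := `|_|.
  have yt : y <= pi * t by rewrite /y ler_norml; nra.
  have y_itv : y \in `[0, pi] by rewrite in_itv/= normr_ge0/=; move: pt; rewrite in_itv/=; lra.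
  have [->|yn] := eqVneq y (pi * t); first
    by rewrite lexx.
  by apply: ltW; rewrite ltr_cos// lt_neqAle yn.
apply/negbTE; rewrite -ltNge.
have [th|th] := leP (2 * pi * (x - t / 2)) pi.
  rewrite ltr_cos//; first by nra.
  by rewrite in_itv/= th andbT; nra.
have -> : cos (2 * pi * (x - t / 2)) = cos (2 * pi - 2 * pi * (x - t / 2)).
  rewrite -cosN -(cos_int (- _) 1); congr cos; rewrite mulr1z; ring.
rewrite ltr_cos//; first by nra.
by rewrite in_itv/=; nra.
Qed.

Let bump_cvg t w : 0 <= t < 1 ->
  bumpC t n w @[n --> \oo] --> (\1_(iarc t `|` [set toC 0]) w : R).
Proof.
move=> t01; have hw := lift_itv w.
have -> : \1_(iarc t `|` [set toC 0]) w =
    (cos (pi * t) <= cos (2 * pi * (clift w - t / 2)))%R%:R :> R.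
  rewrite cos_arc// indicE; congr (_%:R); congr nat_of_bool.
  apply/idP/idP.
    by move=> /set_mem [/iarcE ->//|/= ->]; rewrite lift0 eqxx orbT.
  move=> h; apply/mem_set; case/orP: h => [h|/eqP h]; [left; exact/iarcE|right].
  by rewrite /= toC01 -h toC_lift.
apply: cvg_near_cst; set D := cos (2 * pi * (clift w - t / 2)) - cos (pi * t).
case: leP => hD.
  near=> n; rewrite bumpCE /bump -/D min_l ?max_r// lerDl mulr_ge0//.
  by rewrite subr_ge0.
have D0 : 0 < - D by rewrite oppr_gt0 subr_lt0.
near=> n; rewrite bumpCE /bump -/D.
have nD : 1 + n%:R * D <= 0.
  have : (- D)^-1 <= n%:R by near: n; exact: nbhs_infty_ger.
  by rewrite -div1r ler_pdivrMr// mulrN; lra.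
rewrite min_r; last by lra.
by rewrite max_l.
Unshelve. all: by end_near. Qed.

Let bump_itv t n w : 0 <= bumpC t n w <= 1.
Proof. by rewrite /bumpC /bump le_max lexx/= ge_max ler01 ge_min lexx. Qed.

Let closed_arc_measure mu t : 0 <= t < 1 ->
  (\int[mu]_w (bumpC t n w)%:E)%E @[n --> \oo] --> mu (iarc t `|` [set toC 0]).
Proof.
move=> t01.
have mA : measurable (iarc t `|` [set toC (0 : R)]).
  by apply: measurableU; [exact: measurable_iarc|exact: measurable_point].
have := @dominated_convergence _ _ _ mu setT measurableT
  (fun n w => (bumpC t n w)%:E) (EFin \o \1_(iarc t `|` [set toC 0])) (cst 1%E).
case.
- move=> n; apply/measurable_EFinP; apply: continuous_circle_measurable.
  exact: bumpC_cont.
- by apply/measurable_EFinP; exact: measurable_indic.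
- apply: aeW => w _; apply/fine_cvgP; split; first by near=> n.
  exact: bump_cvg.
- exact: (finite_measure_integrable_cst mu).
- apply: aeW => w n _; rewrite /= lee_fin.
  by have /andP[h0 h1] := bump_itv t n w; rewrite ger0_norm.
move=> _ _; rewrite [X in _ --> X -> _](_ : _ = mu (iarc t `|` [set toC 0]))//.
by rewrite /= integral_indic// setIT.
Unshelve. all: by end_near. Qed.

Let eq_integral_bump mu nu (f : circle R -> R) :
  (forall f : continuousType (circle R) R, \int[mu]_u f u = \int[nu]_u f u) ->
  continuous f -> (\int[mu]_u (f u)%:E = \int[nu]_u (f u)%:E)%E.
Proof.
move=> h cf; have := h (mkcts cf); rewrite /Rintegral/=.
have fin (m : fin_measC R) : (\int[m]_u (f u)%:E)%E \is a fin_num.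
  by apply: integrable_fin_num => //; exact: integrable_continuous_circle.
by move=> e; rewrite -(fineK (fin mu)) -(fineK (fin nu)) e.
Qed.

(** Continuous functions separate the finite measures. *)
Lemma eq_integrals_measure_eq mu nu :
  (forall f : continuousType (circle R) R, \int[mu]_u f u = \int[nu]_u f u) ->
  mu ≡μ nu.
Proof.
move=> h; apply: dfun_measure_eq => t /andP[t0]; rewrite le_eqVlt => /orP[/eqP ->|t1].
  have := h (mkcts (@cst_continuous (circle R) R 1)).
  by rewrite /= !Rintegral_cst// !mul1r /dfun iarc1.
have E s : 0 <= s < 1 -> mu (iarc s `|` [set toC 0]) = nu (iarc s `|` [set toC 0]).
  move=> s01; have hm := @closed_arc_measure mu _ s01.
  have hn := @closed_arc_measure nu _ s01.
  have e : (fun n => \int[mu]_w (bumpC s n w)%:E)%E = (fun n => \int[nu]_w (bumpC s n w)%:E)%E.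
    by apply/funext => n; apply: eq_integral_bump => //; exact: bumpC_cont.
  rewrite e in hm; exact: (cvg_unique (@ereal_hausdorff R) hm hn).
have U (m : fin_measC R) : m (iarc t `|` [set toC 0]) = (m (iarc t) + m [set toC 0])%E.
  rewrite measureU//; [exact: measurable_iarc|exact: measurable_point|].
  apply/seteqP; split => w //= [/iarcE wt w0].
  by move: wt; rewrite w0 lift0; lra.
have E0 : mu [set toC 0] = nu [set toC 0].
  by have := E 0; rewrite iarc0// set0U; apply; rewrite lexx ltr01.
have := E t; rewrite t0 t1 => /(_ isT); rewrite !U E0 /dfun.
have fp : nu [set toC 0] \is a fin_num by apply: fin_measC_fin; exact: measurable_point.
by move=> /(congr1 (fun z : \bar R => z - nu [set toC 0])%E); rewrite !addeK// => ->.
Unshelve. all: by end_near. Qed.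

End separation.

(** * The compact space of profiles *)

Section grid_limit.
Variable R : realType.

Lemma cvg_sum (T : Type) (I : Type) (r : seq I) (F : set_system T) (f : I -> T -> R) (l : I -> R) :
  Filter F -> (forall i, f i x @[x --> F] --> l i) ->
  \sum_(i <- r) f i x @[x --> F] --> \sum_(i <- r) l i.
Proof.
move=> FF h; apply: (cvg_big _ FF) => //; exact: add_continuous.
Qed.

Lemma ent_grid_cvg m F : profile m F -> ent_grid n.+1 F @[n --> \oo] --> (ent F : R).
Proof.
move=> pF; have [psi hpsi] := profile_measure pF.
have ppsi : profile m (dfun psi).
  by apply: (profile_eq _ pF) => t /hpsi.
have := grid_cvg_integral (profile_M0b ppsi); rewrite (ent_integral (profile_M0b ppsi)).
rewrite (eq_ent hpsi) => /fine_cvgP[_ /= hc].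
apply: cvg_trans hc; apply: near_eq_cvg; near=> n.
exact: eq_ent_grid.
Unshelve. all: by end_near. Qed.

End grid_limit.

Section profile_space.
Variables (R : realType) (k : nat) (m : 'I_k -> R).
Hypothesis m_le1 : forall i, m i <= 1.

(** A tuple of functions is a point of a power of the line, so that pointwise
    convergence of tuples of profiles is the product topology. *)
Definition profiles := prod_topology (fun _ : 'I_k * R => R : topologicalType).

Definition line_of (G : profiles) : 'I_k -> R -> R := fun i t => G (i, t).

(** The values outside [0, 1] carry no information. *)
Definition cut (F : 'I_k -> R -> R) : profiles :=
  fun p => if 0 <= p.2 <= 1 then F p.1 p.2 else 0.

Definition unit_cube : set profiles := [set G | forall p, `[0, 1]%classic (G p)].

Lemma unit_cube_compact : compact unit_cube.
Proof.
apply: (@tychonoff _ (fun _ => R : topologicalType) (fun _ => `[0, 1]%classic)) => p.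
exact: segment_compact.
Qed.

Lemma cutE F i t : 0 <= t <= 1 -> line_of (cut F) i t = F i t.
Proof. by move=> t01; rewrite /line_of /cut /= t01. Qed.

Lemma cut_cube F : (forall i t, 0 <= t <= 1 -> 0 <= F i t <= 1) -> unit_cube (cut F).
Proof.
move=> h [i t]; rewrite /cut /= in_itv /=; case: ifP => [t01|_]; first exact: h.
by rewrite lexx ler01.
Qed.

Lemma profile_itv i F t : profile (m i) F -> 0 <= t <= 1 -> 0 <= F t <= 1.
Proof.
move=> [F0 F1 hF] /andP[t0 t1].
have := hF 0 t (lexx _) t0 t1; have := hF t 1 t0 t1 (lexx _).
by rewrite F0 F1; have := m_le1 i; lra.
Qed.

Lemma value_continuous p : continuous (fun G : profiles => G p).
Proof. exact: (@proj_continuous _ (fun _ : 'I_k * R => R : topologicalType) p). Qed.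

Lemma value_near (G : profiles) i t (e : R) : 0 < e ->
  \forall H \near G, `|line_of H i t - line_of G i t| <= e.
Proof.
move=> e0; have /cvgrPdist_le/(_ e e0) := @value_continuous (i, t) G.
by apply: filterS => H; rewrite distrC.
Qed.

(** The empirical distribution functions on [N] sites satisfy the constraints on a
    profile up to an error [1 / N], and only profiles are limits of such
    functions. *)
Definition near_profile (e m : R) (F : R -> R) :=
  [/\ `|F 0| <= e, `|F 1 - m| <= e &
      forall s t, 0 <= s -> s <= t -> t <= 1 -> - e <= F t - F s <= t - s + e].

Lemma near_profile_limit G :
  (forall e, 0 < e -> forall V, nbhs G V -> exists H, V H /\
     forall i, near_profile e (m i) (line_of H i)) -> profile_k m (line_of G).
Proof.
move=> h i.
have two s t e : 0 < e -> exists H : R -> R, [/\ near_profile e (m i) H,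
    `|H s - line_of G i s| <= e & `|H t - line_of G i t| <= e].
  move=> e0; have [H [[Hs Ht] hH]] := h e e0 _ (filterI (value_near G i s e0) (value_near G i t e0)).
  by exists (line_of H i); split => //; exact: hH.
have zero (x c : R) : (forall e, 0 < e -> `|x| <= c * e) -> 0 < c -> x = 0.
  move=> hx c0; apply/eqP; rewrite -normr_le0; apply/ler_addgt0Pr => e e0.
  by rewrite add0r (le_trans (hx (e / c) _))// ?divr_gt0// mulrC divfK// gt_eqF.
split.
- apply: (zero _ 2) => // e e0; have [H [[h0 _ _] hs _]] := two 0 0 e e0.
  by move: h0 hs; rewrite !ler_norml; lra.
- apply/eqP; rewrite -subr_eq0; apply/eqP; apply: (zero _ 2) => // e e0.
  have [H [[_ h1 _] hs _]] := two 1 1 e e0.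
  by move: h1 hs; rewrite !ler_norml; lra.
- move=> s t s0 st t1; apply/andP; split; apply/ler_addgt0Pr => e e0.
    have [H [[_ _ hH] hs ht]] := two s t (e / 3) (divr_gt0 e0 (ltr0n _ 3)).
    by move: hs ht (hH s t s0 st t1); rewrite !ler_norml; lra.
  have [H [[_ _ hH] hs ht]] := two s t (e / 3) (divr_gt0 e0 (ltr0n _ 3)).
  by move: hs ht (hH s t s0 st t1); rewrite !ler_norml; lra.
Qed.

Lemma profile_near_profile e m' F : 0 <= e -> profile m' F -> near_profile e m' F.
Proof.
move=> e0 [F0 F1 hF]; split; first by rewrite F0 normr0.
  by rewrite F1 subrr normr0.
by move=> s t s0 st t1; have := hF s t s0 st t1; lra.
Qed.

Lemma continuous_ent_grid i n : continuous (fun G : profiles => ent_grid n (line_of G i)).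
Proof.
have h j : continuous (fun G : profiles => n%:R * (G (i, j.+1%:R / n%:R) - G (i, j%:R / n%:R))).
  move=> G.
  have hB : (fun G : profiles => G (i, j.+1%:R / n%:R) - G (i, j%:R / n%:R)) H @[H --> G] -->
      G (i, j.+1%:R / n%:R) - G (i, j%:R / n%:R).
    exact: (cvgB (@value_continuous (i, j.+1%:R / n%:R) G) (@value_continuous (i, j%:R / n%:R) G)).
  exact: (@cvgM _ _ (nbhs G) _ (cst n%:R) _ _ _ (cvg_cst _) hB).
have hb j : continuous (fun G : profiles => binent (n%:R * (G (i, j.+1%:R / n%:R) - G (i, j%:R / n%:R)))).
  move=> G; exact: (cvg_comp _ _ (h j G) (@continuous_binent R _)).
pose f (j : 'I_n) (G : profiles) := binent (n%:R * (G (i, j.+1%:R / n%:R) - G (i, j%:R / n%:R))).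
have hs : continuous (fun G : profiles => \sum_(j < n) f j G).
  move=> G; exact: (@cvg_sum _ _ _ _ (nbhs G) f (fun j => f j G) _ (fun j => hb j G)).
move=> G; exact: (@cvgM _ _ (nbhs G) _ (cst n%:R^-1) _ _ _ (cvg_cst _) (hs G)).
Qed.

Definition grid_rate n (F : 'I_k -> R -> R) : R :=
  \sum_(i < k) (binent (m i) - ent_grid n (F i)).

Lemma continuous_grid_rate n : continuous (fun G : profiles => grid_rate n (line_of G)).
Proof.
pose f i (G : profiles) := binent (m i) - ent_grid n (line_of G i).
have hf G i : f i x @[x --> G] --> f i G.
  exact: (cvgB (cvg_cst _) (@continuous_ent_grid i n G)).
move=> G; exact: (@cvg_sum _ _ _ _ (nbhs G) f (fun j => f j G) _ (hf G)).
Qed.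

Lemma grid_rate_le n F : profile_k m F -> (0 < n)%N -> grid_rate n F <= frate m F.
Proof.
by move=> pF n0; apply: ler_sum => i _; rewrite lerD2l lerN2; exact: ent_le_grid (pF i) n0.
Qed.

(** The entropy on the grid of step [1 / n] converges to [ent]. *)
Lemma grid_rate_gt a F : profile_k m F -> a < frate m F ->
  exists2 n, (0 < n)%N & a < grid_rate n F.
Proof.
move=> pF aF; have hc : grid_rate n.+1 F @[n --> \oo] --> frate m F.
  apply: (@cvg_sum _ _ _ (index_enum _) \oo (fun i l => binent (m i) - ent_grid l.+1 (F i)) (fun i => binent (m i) - ent (F i)) _) => i.
  exact: (cvgB (cvg_cst _) (ent_grid_cvg (pF i))).
have : \forall n \near \oo, a < grid_rate n.+1 F by exact: cvgr_gt hc _ aF.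
by move=> [n _ /(_ n (leqnn n))] h; exists n.+1.
Qed.

Definition rate_level (a : R) : set profiles :=
  [set G | [/\ unit_cube G, profile_k m (line_of G) & frate m (line_of G) <= a]].

(** The level set is closed because the rate is a supremum of continuous functions,
    the rates on the grids. *)
Lemma rate_level_compact a : compact (rate_level a).
Proof.
apply: (subclosed_compact _ unit_cube_compact); last by move=> G [].
move=> G hG.
have near_level V : nbhs G V -> exists H, V H /\ rate_level a H.
  by move=> /hG [H [? ?]]; exists H.
have pG : profile_k m (line_of G).
  apply: near_profile_limit => e e0 V /near_level [H [VH [_ pH _]]].
  by exists H; split => // i; apply: profile_near_profile (ltW e0) (pH i).
split => //.
- move=> p; rewrite /= in_itv/=; apply/andP; split; apply/ler_addgt0Pr => e e0;
    have [H [hH [cH _ _]]] := near_level _ (value_near G p.1 p.2 e0);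
    by move: (cH p) hH; rewrite /= in_itv /line_of/= -surjective_pairing ler_norml; lra.
- rewrite leNgt; apply/negP => /(grid_rate_gt pG)[n n0 hn].
  have : \forall H \near G, a < grid_rate n (line_of H).
    exact: (@cvgr_gt _ _ _ _ _ _ (@continuous_grid_rate n G)).
  move=> /near_level [H [hH [_ pH]]]; apply/negP; rewrite -ltNge.
  exact: lt_le_trans hH (grid_rate_le pH n0).
Qed.

Lemma nondecr01_bounded (F : R -> R) : nondecr01 F -> bounded01 F.
Proof.
move=> hF; exists (`|F 0| + `|F 1|) => t /andP[t0 t1].
have h0 := hF 0 t (lexx _) t0 t1; have h1 := hF t 1 t0 t1 (lexx _).
have := ler_norm (F 1); have := lerNnormlW (lexx `|F 0|) => a b.
by rewrite ler_norml; have := normr_ge0 (F 0); have := normr_ge0 (F 1); lra.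
Qed.

(** For monotone functions, closeness on a fine grid to a Lipschitz function is
    uniform closeness; the collapsing operators respect the latter. *)
Lemma collapse_grid_near F d : profile_k m F -> 0 < d ->
  exists n e, [/\ (0 < n)%N, 0 < e & forall G, (forall i, nondecr01 (G i)) ->
    (forall i j, (j <= n)%N -> `|G i (j%:R / n%:R) - F i (j%:R / n%:R)| <= e) ->
    forall i, near01 d (fcollapse_k G i) (fcollapse_k F i)].
Proof.
move=> pF d0; pose e := d / 13 ^+ k.
have c0 : 0 < 13 ^+ k :> R by rewrite exprn_gt0.
have e0 : 0 < e by rewrite divr_gt0.
have e20 : 0 < e / 2 by rewrite divr_gt0.
pose n := (Num.truncn (e / 2)^-1).+1.
have n0 : 0 < n%:R :> R by rewrite ltr0n.
have ne : n%:R^-1 <= e / 2.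
  by rewrite -[leRHS]invrK lef_pV2 ?posrE ?invr_gt0// ltW// truncnS_gt.
exists n, (e / 2); split => // G mG GF.
rewrite (_ : d = 13 ^+ k * e); last by rewrite /e mulrC divfK// gt_eqF.
apply: fcollapse_k_near; first exact: ltW.
- by move=> i; exact: nondecr01_bounded.
- by move=> i; exact: profile_bounded (pF i).
move=> i t t01.
apply: le_trans (near_grid (n := n) (ltn0Sn _) (pF i) (mG i) (GF i) t01) _.
by rewrite -/n; lra.
Qed.

Lemma grid_near (G : profiles) n (e : R) : 0 < e ->
  \forall H \near G, forall i j, (j <= n)%N ->
    `|line_of H i (j%:R / n%:R) - line_of G i (j%:R / n%:R)| <= e.
Proof.
move=> e0.
have : \forall H \near G, forall (i : 'I_k) (j : 'I_n.+1),
    `|line_of H i (j%:R / n%:R) - line_of G i (j%:R / n%:R)| <= e.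
  apply: (@filter_forall _ _ (fun i H => forall j : 'I_n.+1,
    `|line_of H i (j%:R / n%:R) - line_of G i (j%:R / n%:R)| <= e) (nbhs G) _) => i.
  apply: (@filter_forall _ _ (fun (j : 'I_n.+1) H =>
    `|line_of H i (j%:R / n%:R) - line_of G i (j%:R / n%:R)| <= e) (nbhs G) _) => j.
  exact: (@value_near G i (j%:R / n%:R) e e0).
apply: filterS => H hH i j jn; exact: (hH i (Ordinal (jn : (j < n.+1)%N))).
Qed.

End profile_space.

(** * Goodness and lower semicontinuity of the rate function *)

Section rate_function.
Variables (R : realType) (k : nat) (m : 'I_k -> R).
Hypothesis m_gt0 : forall i, 0 < m i.
Hypothesis m_le1 : forall i, m i <= 1.
Hypothesis m_mono : forall i j : 'I_k, (i <= j)%N -> m i <= m j.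

Lemma profile_nondecr01 m' (F : R -> R) : profile m' F -> nondecr01 F.
Proof. by move=> [_ _ hF] s t s0 st t1; have := hF s t s0 st t1; lra. Qed.

Lemma represented_profile F rho : profile_k m F -> represents F rho ->
  forall i, profile (m i) (dfun (rho i : fin_measC R)).
Proof.
by move=> pF rF i; apply: (profile_eq _ (profile_fcollapse_k m_mono pF i)) => t /rF.
Qed.

Lemma represented_le1 F rho : profile_k m F -> represents F rho ->
  forall i, dfun (rho i : fin_measC R) 1 <= 1.
Proof.
by move=> pF rF i; have [_ -> _] := represented_profile pF rF i.
Qed.

Lemma exists_represented F : profile_k m F -> exists rho : measCk R k, represents F rho.
Proof.
move=> pF; have [rho hrho] := choice (fun i => profile_measure (profile_fcollapse_k m_mono pF i)).
by exists rho.
Qed.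

Lemma eq_fcollapse_k (F G : 'I_k -> R -> R) :
  (forall i, bounded01 (F i)) -> (forall i, bounded01 (G i)) ->
  (forall i t, 0 <= t <= 1 -> F i t = G i t) ->
  forall i t, 0 <= t <= 1 -> fcollapse_k F i t = fcollapse_k G i t.
Proof.
move=> bF bG FG i; apply/near01_0; rewrite -(mulr0 (13 ^+ k)).
by apply: fcollapse_k_near => // j; apply/near01_0; exact: FG.
Qed.

Lemma cut_rate_level F a : profile_k m F -> frate m F <= a -> rate_level m a (cut F).
Proof.
move=> pF Fa; split.
- by apply: cut_cube => i t; exact: profile_itv (pF i).
- by move=> i; apply: (profile_eq _ (pF i)) => t t01; rewrite cutE.
- rewrite (_ : frate m _ = frate m F)//; apply: eq_bigr => i _; congr (_ - _).
  by apply: eq_ent => t t01; rewrite cutE.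
Qed.

Lemma cut_represents F rho : profile_k m F -> represents F rho -> represents (line_of (cut F)) rho.
Proof.
move=> pF rF i t t01; rewrite rF//; apply: eq_fcollapse_k => // j.
- exact: profile_bounded (pF j).
- have pj : profile (m j) (line_of (cut F) j).
    by apply: (profile_eq _ (pF j)) => s s01; rewrite cutE.
  exact: profile_bounded pj.
- by move=> s s01; rewrite cutE.
Qed.

(** By compactness, the infimum that defines the rate function is attained. *)
Lemma rate_attained a rho : (S_k m rho <= a%:E)%E ->
  exists G, rate_level m a G /\ represents (line_of G) rho.
Proof.
move=> Sa.
pose B e : set (profiles R k) := [set G | rate_level m (a + e) G /\ represents (line_of G) rho].
pose FF := filter_from [set e | 0 < e] B.
have Bne e : 0 < e -> B e !=set0.
  move=> e0; have [|F [pF rF Fa]] := S_k_lt_frate m_gt0 m_le1 m_mono (rho := rho) (x := a + e).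
    by apply: le_lt_trans Sa _; rewrite lte_fin ltrDl.
  by exists (cut F); split; [apply: cut_rate_level => //; exact: ltW|exact: cut_represents].
have Ble e e' : e <= e' -> B e `<=` B e'.
  by move=> ee' G [[? ? h] ?]; split => //; split => //; rewrite (le_trans h)// lerD2l.
have FFp : ProperFilter FF.
  apply: filter_from_proper => //; apply: filter_from_filter; first by exists 1 => /=; exact: ltr01.
  move=> e e' /= e0 e0'; exists (Num.min e e'); first by rewrite /= lt_min e0.
  by move=> G hG; split; apply: Ble hG; rewrite ge_min lexx ?orbT.
have FB e : 0 < e -> FF (B e) by exists e.
have [|G [[cG pG _] clG]] := @rate_level_compact _ _ m (a + 1) FF FFp.
  by apply: filterS (FB 1 ltr01) => G [].
exists G; split.
  split => //; apply/ler_addgt0Pr => e e0.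
  have : closed (rate_level m (a + e)).
    apply: compact_closed; last exact: rate_level_compact.
    exact: (@hausdorff_product _ (fun _ : 'I_k * R => R : topologicalType)).
  move=> /(_ G); case=> //.
  move=> V hV; have := clG _ _ (FB e e0) hV => -[H [[? ?] ?]]; by exists H.
move=> i t t01; apply/eqP; rewrite -subr_eq0 -normr_le0; apply/ler_addgt0Pr => d d0.
rewrite add0r; have [n [e [n0 e0 hn]]] := collapse_grid_near pG d0.
have [H [[[_ pH _] rH] near_H]] := clG _ _ (FB 1 ltr01) (grid_near G n e0).
by rewrite rH//; apply: hn => // j; exact: profile_nondecr01 (pH j).
Qed.

Lemma rate_level_S_k a G rho : rate_level m a G -> represents (line_of G) rho ->
  (S_k m rho <= a%:E)%E.
Proof.
move=> [_ pG Ga] rG; apply: le_trans (S_k_le_frate m_gt0 m_le1 m_mono pG rG) _.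
by rewrite lee_fin.
Qed.

(** A neighbourhood of the measures represented by [F] contains those that are
    represented by monotone functions close to [F] on a suitable grid. *)
Lemma open_grid (O : set (measCk R k)) rho F : open O -> O rho ->
  profile_k m F -> represents F rho ->
  exists n e, [/\ (0 < n)%N, 0 < e & forall G r, (forall i, nondecr01 (G i)) ->
    (forall i j, (j <= n)%N -> `|G i (j%:R / n%:R) - F i (j%:R / n%:R)| <= e) ->
    (forall i, dfun (r i : fin_measC R) 1 <= 1) -> represents G r -> O r].
Proof.
move=> oO Orho pF rF.
have [d d0 hd] := open_near oO Orho (represented_le1 pF rF).
have [n [e [n0 e0 hn]]] := collapse_grid_near pF d0.
exists n, e; split => // G r mG GF r1 rG.
apply: hd => // i t t01; rewrite rG// rF//; exact: (hn G mG GF i t t01).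
Qed.

(** A filter of measures in a level set lifts to a filter of profiles of bounded
    rate; a cluster point of the latter represents a cluster point of the former. *)
Lemma S_k_good : good_rate (S_k m).
Proof.
move=> a Fil PFil hFil.
pose L := [set rho : measCk R k | (S_k m rho <= a%:E)%E].
have attained rho : exists G : profiles R k,
    L rho -> rate_level m a G /\ represents (line_of G) rho.
  have [h|h] := pselect (L rho); last by exists (cut (fun _ _ => 0)).
  by have [G hG] := rate_attained h; exists G.
have [g hg] := choice attained.
have [|G [hG clG]] := @rate_level_compact _ _ m a (g @ Fil) (fmap_proper_filter g PFil).
  change (Fil (g @^-1` rate_level m a)).
  by apply: filterS hFil => rho Lr; exact: (proj1 (hg rho Lr)).
have pG : profile_k m (line_of G) by case: hG.
have [rho rG] := exists_represented pG.
exists rho; split; first exact: rate_level_S_k rG.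
move=> A V FA; rewrite nbhsE => -[ O [oO Orho] OV].
have [n [e [n0 e0 hn]]] := open_grid oO Orho pG rG.
have : (g @ Fil) (g @` (A `&` L)).
  change (Fil (g @^-1` (g @` (A `&` L)))).
  by apply: filterS (filterI FA hFil) => r hr; exists r.
move=> /clG/(_ (grid_near G n e0)) [_ [[r [Ar Lr] <-] hr]]; exists r; split => //; apply: OV.
have [[_ pr _] rr] := hg _ Lr.
apply: (hn (line_of (g r)) r) => //; last exact: represented_le1 pr rr.
by move=> i; exact: profile_nondecr01 (pr i).
Qed.

(** If [rho] is a limit of measures of rate at most [a], these cluster at some [r]
    of rate at most [a], by compactness. Continuous functions have the same
    integrals for [r] and [rho], which are then represented by the same
    profiles. *)
Lemma S_k_lsc : lower_semicontinuous (S_k m).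
Proof.
move=> rho a aS; apply: contrapT => noV.
pose L := [set r : measCk R k | (S_k m r <= a%:E)%E].
have PF : ProperFilter (within L (nbhs rho)).
  apply: within_nbhs_proper => V hV; apply: contrapT => h.
  apply: noV; exists V => // r Vr; rewrite ltNge; apply/negP => Lr.
  by apply: h; exists r.
have [|r [Lr clr]] := @S_k_good a _ PF; first exact: withinT.
have [G [hG rG]] := rate_attained Lr.
have : (S_k m rho <= a%:E)%E.
  apply: (rate_level_S_k hG) => i t t01; rewrite -rG//.
  have e : (rho i : fin_measC R) ≡μ (r i : fin_measC R).
    apply: eq_integrals_measure_eq => f.
    apply: (@Rhausdorff R (\int[(rho i : fin_measC R)]_u f u) (\int[(r i : fin_measC R)]_u f u)) => A B hA hB.
    pose I (s : measCk R k) := \int[(s i : fin_measC R)]_u f u.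
    have hA' : nbhs rho (I @^-1` A) by exact: (@continuous_integral _ _ i f rho _ hA).
    have hB' : nbhs r (I @^-1` B) by exact: (@continuous_integral _ _ i f r _ hB).
    have wA : within L (nbhs rho) (I @^-1` A).
      by rewrite /within /=; apply: (filterS _ hA') => x hx _.
    by have [s [sA sB]] := clr _ _ wA hB'; exists (I s).
  by rewrite /dfun e//; exact: measurable_iarc.
by rewrite leNgt aS.
Qed.

End rate_function.

(** * Asymptotics of the multi-line ensemble *)

Section multiline_counts.
Variables (R : realType) (k : nat) (m : 'I_k -> R).
Hypothesis m_gt0 : forall i, 0 < m i.
Hypothesis m_le1 : forall i, m i <= 1.
Hypothesis m_mono : forall i j : 'I_k, (i <= j)%N -> m i <= m j.
Local Notation lines N := (multiline N (nparticles N m)).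

Definition counts N (al : config N k) : profiles R k := cut (fun i => fcount (al i)).

Lemma fcount0 N (a : {ffun 'I_N -> bool}) : fcount a 0 = 0 :> R.
Proof. by rewrite /fcount mul0r truncn0 count0 mulr0. Qed.

Lemma fcount1 N (a : {ffun 'I_N -> bool}) : fcount a 1 = N%:R^-1 * (particles a)%:R :> R.
Proof. by rewrite /fcount mul1r natrK countN. Qed.

Lemma nondecr01_fcount N (a : {ffun 'I_N -> bool}) : (0 < N)%N -> nondecr01 (@fcount R N a).
Proof. by move=> N0 s t s0 st t1; have := fcount_incr N0 a s0 st; lra. Qed.

Lemma nparticles_near N i : (0 < N)%N -> `|N%:R^-1 * (nparticles N m i)%:R - m i| <= N%:R^-1.
Proof.
move=> N0; have n0 : 0 < N%:R :> R by rewrite ltr0n.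
have /andP[h1 h2] := nparticles_itv N m_gt0 i.
rewrite -(ler_pM2l n0) -[X in X * `|_|]gtr0_norm// -normrM mulrBr mulrA divff ?gt_eqF//.
by rewrite mul1r; move: h2; rewrite -natr1 ler_norml; lra.
Qed.

Lemma near_profile_counts N (al : config N k) i : (0 < N)%N -> al \in lines N ->
  near_profile N%:R^-1 (m i) (line_of (counts al) i).
Proof.
move=> N0 hal; have n0 : 0 <= N%:R^-1 :> R by rewrite invr_ge0.
split.
- by rewrite cutE ?lexx ?ler01// fcount0 normr0.
- rewrite cutE ?lexx ?ler01// fcount1; move/multilineP : hal => ->; exact: nparticles_near.
- move=> s t s0 st t1; rewrite !cutE ?s0 ?(le_trans s0 st) ?t1 ?(le_trans st t1)//.
  by have := fcount_incr N0 (al i) s0 st; lra.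
Qed.

Lemma empirical_le1 N (al : config N k) i : (0 < N)%N ->
  dfun (empirical_k R al i : fin_measC R) 1 <= 1.
Proof.
move=> N0; rewrite dfun_empirical ?lexx ?ler01//.
rewrite fcount1.
rewrite mulrC ler_pdivrMr ?ltr0n// mul1r ler_nat.
by rewrite /particles (leq_trans (leq_sum _ (fun x _ => leq_b1 _)))// sum1_card card_ord.
Qed.

Lemma empirical_represents N (al : config N k) : (0 < N)%N -> al \in lines N ->
  represents (fun i => fcount (al i)) (empirical_k R (multiline_map al)).
Proof.
move=> N0 hal i t t01.
by rewrite (dfun_empirical_multiline N0 (nparticles_mono N m_mono) i hal t01).
Qed.

Lemma counts_cube N (al : config N k) : (0 < N)%N -> unit_cube (counts al).
Proof.
move=> N0; apply: cut_cube => i t /andP[t0 t1].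
have h0 := nondecr01_fcount (al i) N0 (lexx 0) t0 t1.
have h1 := nondecr01_fcount (al i) N0 t0 t1 (lexx 1).
have := empirical_le1 al i N0; rewrite dfun_empirical ?lexx ?ler01//.
by move: h0; rewrite fcount0; lra.
Qed.

Lemma ltr_invn_near (e : R) : 0 < e -> \forall N \near \oo, (0 < N)%N /\ N%:R^-1 <= e.
Proof.
move=> e0; near=> N.
have N0 : (0 < N)%N by near: N; exact: nbhs_infty_gt.
split=> //; have : e^-1 <= N%:R by near: N; exact: nbhs_infty_ger.
by move=> h; rewrite -[leRHS]invrK lef_pV2// posrE ?invr_gt0// ltr0n.
Unshelve. all: by end_near. Qed.

Lemma nparticles_cvg i : N%:R^-1 * (nparticles N m i)%:R @[N --> \oo] --> m i.
Proof.
apply/cvgrPdist_le => e e0; apply: filterS (ltr_invn_near e0) => N [N0 Ne].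
by rewrite distrC (le_trans (nparticles_near i N0)).
Qed.

Lemma binent_nparticles_near (e : R) : 0 < e -> \forall N \near \oo, forall i,
  `|binent (m i) - binent ((nparticles N m i)%:R / N%:R)| <= e.
Proof.
move=> e0; apply: (@filter_forall _ _ (fun i N =>
  `|binent (m i) - binent ((nparticles N m i)%:R / N%:R)| <= e) \oo _) => i.
have hc : binent (N%:R^-1 * (nparticles N m i)%:R) @[N --> \oo] --> binent (m i).
  exact: (cvg_comp _ _ (@nparticles_cvg i) (@continuous_binent R _)).
have /cvgrPdist_le/(_ e e0) := hc.
by apply: filterS => N; rewrite mulrC.
Qed.

(** [N + 1] is at most [(1 + 1 / c) exp (c N)], for every positive [c]. *)
Lemma expR_absorb p (B e : R) : 0 < e ->
  \forall N \near \oo, expR B * N.+1%:R ^+ p <= expR (N%:R * e).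
Proof.
move=> e0; pose c := e / (2 * p.+1%:R); pose D := ln (1 + c^-1).
have p0 : 0 < p.+1%:R :> R by rewrite ltr0n.
have c0 : 0 < c by rewrite divr_gt0// mulr_gt0.
have pc : p%:R * c <= e / 2.
  have -> : p%:R * c = e / 2 * (p%:R / p.+1%:R) by rewrite /c; field; rewrite gt_eqF.
  by rewrite ler_piMr ?divr_ge0 ?(ltW e0)// ler_pdivrMr// mul1r ler_nat.
near=> N.
have hN : (B + p%:R * D) / (e / 2) <= N%:R by near: N; exact: nbhs_infty_ger.
have N0 : 0 <= N%:R :> R by [].
have h1 : N.+1%:R <= expR (D + c * N%:R).
  rewrite expRD lnK ?posrE; last by rewrite addr_gt0 ?invr_gt0.
  have h : 1 + c * N%:R <= expR (c * N%:R) by exact: expR_ge1Dx.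
  have D0 : 0 <= 1 + c^-1 by rewrite addr_ge0// invr_ge0 ltW.
  apply: le_trans (ler_wpM2l D0 h); rewrite -natr1.
  have -> : (1 + c^-1) * (1 + c * N%:R) = 1 + c^-1 + c * N%:R + N%:R by field; rewrite gt_eqF.
  have cN0 : 0 <= c * N%:R by rewrite mulr_ge0// ltW.
  have cV0 : 0 <= c^-1 by rewrite invr_ge0 ltW.
  by lra.
apply: (@le_trans _ _ (expR B * expR (D + c * N%:R) ^+ p)).
  by rewrite ler_pM2l ?expR_gt0// lerXn2r ?nnegrE// ltW// expR_gt0.
rewrite -expRM_natl -expRD ler_expR mulrDr mulrA.
have : (p%:R * c) * N%:R <= e / 2 * N%:R by rewrite ler_wpM2r.
by move: hN; rewrite ler_pdivrMr ?divr_gt0//; lra.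
Unshelve. all: by end_near. Qed.

(** The polynomial factor comes from [binomial_ge] on each of the lines. *)
Lemma card_lines_ge N : expR (N%:R * \sum_(i < k) binent ((nparticles N m i)%:R / N%:R)) <=
  N.+1%:R ^+ k * #|lines N|%:R :> R.
Proof.
rewrite card_multiline natr_prod mulr_sumr expR_sum.
rewrite -[X in _ ^+ X]card_ord -prodr_const -big_split/=; apply: ler_prod => i _.
rewrite expR_ge0/=; apply: binomial_ge; exact: nparticles_leN.
Qed.

Lemma card_lines_le N : #|lines N|%:R <=
  expR (N%:R * \sum_(i < k) binent ((nparticles N m i)%:R / N%:R)) :> R.
Proof.
rewrite card_multiline natr_prod mulr_sumr expR_sum; apply: ler_prod => i _.
by rewrite ler0n/=; apply: binomial_le; exact: nparticles_leN.
Qed.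

(** The empirical profiles of the lines accumulate only at profiles. *)
Lemma counts_avoid G : ~ profile_k m (line_of G) ->
  exists V, nbhs G V /\ \forall N \near \oo, forall al : config N k, al \in lines N -> ~ V (counts al).
Proof.
move=> nG; apply: contrapT => noV; apply: nG; apply: near_profile_limit => e e0 V GV.
apply: contrapT => noH; apply: noV; exists V; split => //.
apply: filterS (ltr_invn_near e0) => N [N0 Ne] al hal Val; apply: noH.
exists (counts al); split => // i.
have [h0 h1 h] := near_profile_counts i N0 hal; split; try exact: le_trans Ne.
by move=> s t s0 st t1; have := h s t s0 st t1; lra.
Qed.

End multiline_counts.

(** * The upper bound *)

Section upper_bound.
Variables (R : realType) (k : nat) (m : 'I_k -> R).
Hypothesis m_gt0 : forall i, 0 < m i.
Hypothesis m_le1 : forall i, m i <= 1.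
Hypothesis m_mono : forall i j : 'I_k, (i <= j)%N -> m i <= m j.
Local Notation lines N := (multiline N (nparticles N m)).

(** With [q i j] close to the densities of a profile, this is close to its grid
    entropy; it is used because it is linear. *)
Definition grid_xent n (q : 'I_k -> 'I_n -> R) (G : profiles R k) : R :=
  \sum_(i < k) \sum_(j < n) n%:R^-1 * xent (q i j) (n%:R * dincr (line_of G i) n j).

Lemma continuous_grid_xent n (q : 'I_k -> 'I_n -> R) : continuous (grid_xent q).
Proof.
pose x (i : 'I_k) (j : 'I_n) (G : profiles R k) := n%:R * (G (i, j.+1%:R / n%:R) - G (i, j%:R / n%:R)).
have cx i j : continuous (x i j).
  move=> G; apply: (@cvgM _ _ (nbhs G) _ (cst n%:R) _ _ _ (cvg_cst _)).
  exact: (cvgB (@value_continuous _ _ (i, j.+1%:R / n%:R) G) (@value_continuous _ _ (i, j%:R / n%:R) G)).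
have cxent (p : R) : continuous (xent p).
  move=> y; apply: cvgB; first by apply: cvgN; apply: cvgM; [exact: cvg_id|exact: cvg_cst].
  by apply: cvgM; [apply: cvgB; [exact: cvg_cst|exact: cvg_id]|exact: cvg_cst].
pose f i j (G : profiles R k) := n%:R^-1 * xent (q i j) (x i j G).
have cf i j : continuous (f i j).
  move=> G; apply: (@cvgM _ _ (nbhs G) _ (cst n%:R^-1) _ _ _ (cvg_cst _)).
  exact: (cvg_comp _ _ (cx i j G) (@cxent (q i j) _)).
pose g i (G : profiles R k) := \sum_(j < n) f i j G.
have cg i : continuous (g i).
  by move=> G; exact: (@cvg_sum _ _ _ _ (nbhs G) (f i) (fun j => f i j G) _ (fun j => cf i j G)).
by move=> G; exact: (@cvg_sum _ _ _ _ (nbhs G) g (fun i => g i G) _ (fun i => cg i G)).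
Qed.

(** The weight [prod q ^ count * (1 - q) ^ (size - count)] of a configuration
    is governed by the cross entropy of [q] and its densities on the blocks. *)
Lemma card_grid_xent N n (q : 'I_k -> 'I_n -> R) (K : R) (U : {set config N k}) :
  (0 < N)%N -> (0 < n)%N -> (forall i j, 0 < q i j < 1) ->
  (forall al, al \in U -> grid_xent q (counts al) <= K) ->
  #|U|%:R <= expR (N%:R * K + \sum_(i < k) \sum_(j < n) - ln (1 - q i j)).
Proof.
move=> N0 n0 hq hU; have [b hb] := @site_block R N n n0.
have NN0 : 0 < N%:R :> R by rewrite ltr0n.
apply: (card_le_weight (b := b) hq) => al /hU hal.
rewrite lerNl; apply: le_trans (lerD (ler_wpM2l (ltW NN0) hal) (lexx _)).
rewrite /grid_xent mulr_sumr -big_split/= -sumrN; apply: ler_sum => i _.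
rewrite mulr_sumr -big_split/= -sumrN; apply: ler_sum => j _.
have -> : dincr (line_of (counts al) i) n j = dincr (fcount (al i)) n j :> R.
  by rewrite /dincr !cutE// grid_itv// ltnW.
rewrite natrB; last exact: block_count_le.
rewrite (block_count_dincr N0 n0 hb); set r := dincr _ _ _.
have /ler_normlP[_ hL] := block_size_near N0 n0 hb j.
set L := (block_size b j)%:R in hL *; have /andP[q0 q1] := hq i j.
have l0 : ln (1 - q i j) <= 0 by apply: ln_le0; lra.
have -> : N%:R * (n%:R^-1 * xent (q i j) (n%:R * r)) =
    - (N%:R * r * ln (q i j)) - (N%:R / n%:R - N%:R * r) * ln (1 - q i j).
  by rewrite /xent; field; rewrite pnatr_eq0 -lt0n.
have : 0 <= (1 - (L - N%:R / n%:R)) * - ln (1 - q i j).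
  by rewrite mulr_ge0 ?oppr_ge0// subr_ge0.
by lra.
Qed.

(** Chernoff's bound with [q] adapted to the densities of [G] on a fine grid: the
    lines near [G] have an entropy close to that of [G]. *)
Lemma count_rate G a : profile_k m (line_of G) -> a < frate m (line_of G) ->
  exists V, nbhs G V /\ \forall N \near \oo, forall U : {set config N k},
    (forall al, al \in U -> V (counts al)) ->
    #|U|%:R <= expR (- (N%:R * a)) * #|lines N|%:R.
Proof.
move=> pG /(grid_rate_gt pG)[n n0 hn].
(* The margin is shared between the [k] choices of [q], the size of the neighbourhood, the polynomial factor and the [k] limits of the numbers of particles. *)
pose e := (grid_rate m n (line_of G) - a) / (2 * k%:R + 2).
have k2 : 0 < 2 * k%:R + 2 :> R by rewrite ltr_wpDl// mulr_ge0.
have e0 : 0 < e by rewrite divr_gt0// subr_gt0.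
have ek : grid_rate m n (line_of G) - a = (2 * k%:R + 2) * e.
  by rewrite /e mulrC divfK// gt_eqF.
have hq (ij : 'I_k * 'I_n) : exists q, 0 < q < 1 /\
    xent q (n%:R * dincr (line_of G ij.1) n ij.2) <= binent (n%:R * dincr (line_of G ij.1) n ij.2) + e.
  by apply: xent_near_binent => //; exact: profile_dincr (pG _) (ltn_ord _).
have {hq}[q0 hq] := choice hq; pose q i j := q0 (i, j).
have q01 i j : 0 < q i j < 1 by have [] := hq (i, j).
pose S := \sum_(i < k) ent_grid n (line_of G i).
have hS : grid_xent q G <= S + k%:R * e.
  rewrite mulr_natl -[X in _ *+ X]card_ord -sumr_const -big_split/=; apply: ler_sum => i _.
  rewrite /ent_grid -mulr_sumr.
  have -> : e = n%:R^-1 * (\sum_(j < n) e).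
    by rewrite sumr_const card_ord -[e *+ n]mulr_natl mulKf// pnatr_eq0 -lt0n.
  rewrite -mulrDr ler_wpM2l ?invr_ge0// -big_split/=; apply: ler_sum => j _.
  by have [_] := hq (i, j).
pose B := \sum_(i < k) \sum_(j < n) - ln (1 - q i j).
exists [set H | grid_xent q H <= S + k%:R * e + e]; split.
  have : \forall H \near G, grid_xent q H < S + k%:R * e + e.
    by apply: (@cvgr_lt _ _ _ _ _ _ (@continuous_grid_xent n q G)); lra.
  by apply: filterS => H /ltW.
near=> N; move=> U hU.
have [N0 _] : (0 < N)%N /\ N%:R^-1 <= 1 :> R by near: N; exact: ltr_invn_near.
have h1 := card_grid_xent N0 n0 q01 hU; rewrite -/B in h1.
have h2 := card_lines_ge m_gt0 m_le1 N; set T := \sum_(i < k) binent _ in h2.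
have hT : \sum_(i < k) binent (m i) <= T + k%:R * e.
  rewrite mulr_natl -[X in _ *+ X]card_ord -sumr_const -big_split/=; apply: ler_sum => i _.
  have : forall i, `|binent (m i) - binent ((nparticles N m i)%:R / N%:R)| <= e.
    by near: N; exact: binent_nparticles_near.
  by move=> /(_ i)/ler_normlP[_]; lra.
have h3 : expR B * N.+1%:R ^+ k <= expR (N%:R * e) by near: N; exact: expR_absorb.
have gS : grid_rate m n (line_of G) = \sum_(i < k) binent (m i) - S.
  by rewrite /grid_rate /S sumrB.
have NN : 0 <= N%:R :> R by [].
have P0 : 0 < N.+1%:R ^+ k :> R by rewrite exprn_gt0.
rewrite -(ler_pM2l P0); apply: (@le_trans _ _ (expR (- (N%:R * a)) * expR (N%:R * T))); last first.
  by rewrite mulrCA ler_pM2l ?expR_gt0.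
apply: le_trans (ler_wpM2l (ltW P0) h1) _.
rewrite expRD mulrCA mulrC [X in X * _]mulrC.
apply: le_trans (ler_wpM2r (expR_ge0 _) h3) _.
rewrite -!expRD ler_expR -mulrN -!mulrDr ler_wpM2l//.
by move: ek; rewrite gS; lra.
Unshelve. all: by end_near. Qed.

(** For each limit profile [G], the lines near [G] whose empirical measure lies
    in [C] are few: there are none unless [G] is a profile of large rate. *)
Lemma local_upper_bound (C : set (measCk R k)) a (G : profiles R k) : closed C ->
  (forall rho, C rho -> (a%:E < S_k m rho)%E) ->
  exists V, nbhs G V /\ \forall N \near \oo, forall U : {set config N k},
    (forall al, al \in U -> [/\ al \in lines N, V (counts al : profiles R k) & C (empirical_k R (multiline_map al))]) ->
    #|U|%:R <= expR (- (N%:R * a)) * #|lines N|%:R.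
Proof.
move=> cC aC.
have void N (U : {set config N k}) : (forall al, al \in U -> False) ->
    #|U|%:R <= expR (- (N%:R * a)) * #|lines N|%:R.
  move=> hU; have -> : U = finset.set0.
    by apply/finset.setP => al; rewrite finset.inE; apply/negP => /hU.
  by rewrite cards0 mulr_ge0// expR_ge0.
have [pG|nG] := pselect (profile_k m (line_of G)); last first.
  have [V [GV hV]] := counts_avoid m_gt0 nG; exists V; split => //.
  apply: filterS hV => N hV U hU; apply: void => al /hU[hal Val _]; exact: hV hal Val.
have [Ga|aG] := leP (frate m (line_of G)) a; last first.
  have [V [GV hV]] := count_rate pG aG; exists V; split => //.
  by apply: filterS hV => N hV U hU; apply: hV => al /hU[].
have [rho rG] := exists_represented m_mono pG.
have Srho : (S_k m rho <= a%:E)%E.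
  by apply: le_trans (S_k_le_frate m_gt0 m_le1 m_mono pG rG) _; rewrite lee_fin.
have nC : (~` C) rho by move=> /aC; rewrite ltNge Srho.
have [n [e [n0 e0 hn]]] := open_grid m_le1 m_mono (closed_openC cC) nC pG rG.
exists [set H | forall i j, (j <= n)%N ->
    `|line_of H i (j%:R / n%:R) - line_of G i (j%:R / n%:R)| <= e].
split; first exact: (grid_near G n e0).
apply: filterS (@ltr_invn_near R 1 ltr01) => N [N0 _] U hU.
apply: void => al /hU[hal Val]; apply: (hn (fun i => fcount (al i))).
- by move=> i; exact: nondecr01_fcount.
- by move=> i j jn; have := Val i j jn; rewrite cutE// grid_itv.
- by move=> i; exact: empirical_le1.
- exact: (empirical_represents m_mono N0 hal).
Qed.

(** By compactness finitely many of the neighbourhoods given by [local_upper_bound]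
    suffice. *)
Lemma upper_bound_near (C : set (measCk R k)) a e : closed C -> 0 < e ->
  (forall rho, C rho -> (a%:E < S_k m rho)%E) ->
  \forall N \near \oo,
    #|[set al in lines N | empirical_k R (multiline_map al) \in C]|%:R / #|lines N|%:R
      <= expR (- (N%:R * (a - e))).
Proof.
move=> cC e0 aC.
have [V hV] := choice (fun G => local_upper_bound G cC aC).
(* [compact_cover] asks for a base point. *)
pose T : ptopologicalType := HB.pack
  (prod_topology (fun _ : 'I_k * R => R : topologicalType)) (isPointed.Build (profiles R k) (cut (fun _ _ => 0))).
have : @cover_compact T (@unit_cube R k) by rewrite -compact_cover; exact: unit_cube_compact.
move=> /(_ _ setT (fun G => interior (V G))) [].
- by move=> G _; exact: open_interior.
- by move=> G _; exists G => //; exact: (proj1 (hV G)).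
move=> D _ Dcover.
pose few G N := forall U : {set config N k},
    (forall al, al \in U -> [/\ al \in lines N, V G (counts al) & C (empirical_k R (multiline_map al))]) ->
    #|U|%:R <= expR (- (N%:R * a)) * #|lines N|%:R.
have hD : \forall N \near \oo, forall G, G \in D -> few G N.
  have hb : \forall N \near \oo, (\bigcap_(G in [set` D]) few G) N := filter_bigI _ (fun G _ => proj2 (hV G)).
  by case: hb => l _ hl; exists l => // N /hl h G GD; exact: h.
near=> N.
have [N0 _] : (0 < N)%N /\ N%:R^-1 <= 1 :> R by near: N; exact: ltr_invn_near.
have hDN : forall G, G \in D -> few G N by near: N.
have h0 : expR (ln (size (enum_fset D)).+1%:R) * N.+1%:R ^+ 0 <= expR (N%:R * e).
  by near: N; exact: expR_absorb.
rewrite expr0 mulr1 lnK ?posrE// in h0.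
have l0 : 0 < #|lines N|%:R :> R by rewrite ltr0n; exact: lines_gt0.
rewrite ler_pdivrMr//.
pose U G := [set al in lines N | (counts al \in V G) && (empirical_k R (multiline_map al) \in C)]%SET.
have hU : (#|[set al in lines N | empirical_k R (multiline_map al) \in C]| <=
    \sum_(G <- D) #|U G|)%N.
  apply: (@leq_trans #|\bigcup_(G <- D) U G|%SET); last first.
    elim/big_rec2 : _ => [|G B s _ hs]; first by rewrite cards0.
    by rewrite (leq_trans (leq_card_setU _ _))// leq_add2l.
  apply/subset_leq_card/fintype.subsetP => al; rewrite finset.in_set => /andP[hal alC].
  have [G GD VG] := Dcover _ (counts_cube al N0).
  rewrite (big_rem G)//= finset.in_setU; apply/orP; left.
  rewrite finset.in_set hal alC andbT; apply/mem_set; exact: interior_subset VG.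
apply: (@le_trans _ _ (\sum_(G <- D) #|U G|)%:R); first by rewrite ler_nat.
rewrite natr_sum; apply: (@le_trans _ _ (\sum_(G <- D) expR (- (N%:R * a)) * #|lines N|%:R)).
  rewrite big_seq [leRHS]big_seq; apply: ler_sum => G GD; apply: hDN GD _ _ => al.
  by rewrite finset.in_set => /and3P[hal /set_mem ? /set_mem ?].
rewrite big_const_seq count_predT iter_addr_0 -[leLHS]mulr_natr mulrAC ler_wpM2r//.
rewrite mulrBr opprB addrC expRD ler_wpM2l ?expR_ge0//.
by apply: le_trans h0; rewrite ler_nat.
Unshelve. all: by end_near. Qed.

End upper_bound.

(** * The lower bound *)

Section lower_bound.
Variables (R : realType) (k : nat) (m : 'I_k -> R).
Hypothesis m_gt0 : forall i, 0 < m i.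
Hypothesis m_le1 : forall i, m i <= 1.
Hypothesis m_mono : forall i j : 'I_k, (i <= j)%N -> m i <= m j.
Local Notation lines N := (multiline N (nparticles N m)).

Lemma truncn_step (x y : R) : 0 <= x -> x <= y -> y <= x + 1 ->
  (Num.truncn y = Num.truncn x + (Num.truncn x < Num.truncn y))%N.
Proof.
move=> x0 xy yx; have y0 : 0 <= y by lra.
have h1 : (Num.truncn x <= Num.truncn y)%N by exact: le_truncn.
have h2 : (Num.truncn y <= (Num.truncn x).+1)%N.
  rewrite -ltnS -(ltr_nat R).
  apply: (le_lt_trans (y := y)); first by have /andP[] := truncn_itv y0.
  have /andP[_ hx] := truncn_itv x0; rewrite -[X in _ < X]natr1; move: hx; lra.
by case: ltnP => h; lia.
Qed.

(** Rounding down the distribution function of a profile at the sites gives a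
    line with the prescribed number of particles. *)
Lemma round_profile N m' F : (0 < N)%N -> profile m' F ->
  exists a : {ffun 'I_N -> bool}, forall p, (p <= N)%N ->
    pcount a p = Num.truncn (N%:R * F (p%:R / N%:R) : R).
Proof.
move=> N0 [F0 F1 hF]; have NN0 : 0 < N%:R :> R by rewrite ltr0n.
pose T p := Num.truncn (N%:R * F (p%:R / N%:R)).
pose site (x : nat) := if x == 0%N then N else x.
exists [ffun x : 'I_N => (T (site x).-1 < T (site x))%N]; elim => [|p IH] pN.
  by rewrite count0 mul0r F0 mulr0 truncn0.
rewrite countS IH ?(ltnW pN)//.
have -> : at_time [ffun x : 'I_N => (T (site x).-1 < T (site x))%N] p.+1 = (T p < T p.+1)%N.
  have hp : (p.+1 %% N < N)%N by rewrite ltn_mod.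
  rewrite /at_time insubT/= ffunE /= /site.
  have [e|pN'] := eqVneq p.+1 N; first by rewrite e modnn eqxx -e.
  have lt : (p.+1 < N)%N by rewrite ltn_neqAle pN'.
  by rewrite modn_small.
have st : (p%:R / N%:R : R) <= p.+1%:R / N%:R by rewrite ler_pM2r ?invr_gt0// ler_nat.
have := hF _ _ (proj1 (andP (@grid_itv R N p N0 (ltnW pN)))) st (proj2 (andP (@grid_itv R N p.+1 N0 pN))).
have F0p := hF 0 (p%:R / N%:R) (lexx _) (proj1 (andP (@grid_itv R N p N0 (ltnW pN)))) (proj2 (andP (@grid_itv R N p N0 (ltnW pN)))).
rewrite -mulrBl -natrB// subSnn => /andP[h1 h2].
symmetry; apply: truncn_step.
- by rewrite mulr_ge0 ?(ltW NN0)//; move: F0p; rewrite F0; lra.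
- by rewrite ler_pM2l//; lra.
- have : N%:R * (F (p.+1%:R / N%:R) - F (p%:R / N%:R)) <= N%:R * (1 / N%:R) by rewrite ler_pM2l.
  by rewrite mul1r divff ?gt_eqF//; lra.
Qed.

Lemma round_near N m' F (a : {ffun 'I_N -> bool}) : (0 < N)%N -> profile m' F ->
  (forall p, (p <= N)%N -> pcount a p = Num.truncn (N%:R * F (p%:R / N%:R) : R)) ->
  near01 (2 * N%:R^-1) (fcount a) F.
Proof.
move=> N0 [F0 F1 hF] ha t /andP[t0 t1]; have NN0 : 0 < N%:R :> R by rewrite ltr0n.
rewrite /fcount; set p := Num.truncn (t * N%:R).
have /andP[p1 p2] : p%:R <= t * N%:R < p.+1%:R by apply: truncn_itv; rewrite mulr_ge0.
have pN : (p <= N)%N.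
  by rewrite -(ler_nat R); apply: le_trans p1 _; rewrite ler_piMl// ltW.
have /andP[s0 s1] := @grid_itv R N p N0 pN.
rewrite ha//; set s := p%:R / N%:R.
have st : s <= t by rewrite /s ler_pdivrMr.
have ts : t <= s + N%:R^-1.
  by rewrite /s -[X in _ + X]mul1r -mulrDl ler_pdivlMr// natr1 ltW.
have /andP[h1 h2] := hF s t s0 st t1.
have /andP[h3 _] := hF 0 s (lexx _) s0 s1.
have Fs0 : 0 <= N%:R * F s by rewrite mulr_ge0 ?(ltW NN0)//; move: h3; rewrite F0; lra.
have /andP[h4 h5] := truncn_itv Fs0; rewrite -natr1 in h5.
have e : N%:R^-1 * (N%:R * F s) = F s by rewrite mulKf// gt_eqF.
have i0 : 0 < N%:R^-1 :> R by rewrite invr_gt0.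
have h6 : N%:R^-1 * (Num.truncn (N%:R * F s))%:R <= F s by rewrite -[leRHS]e ler_pM2l.
have h7 : F s <= N%:R^-1 * (Num.truncn (N%:R * F s))%:R + N%:R^-1.
  by rewrite -{1}e -[X in _ + X]mulr1 -mulrDr ler_pM2l// ltW.
by rewrite ler_norml; lra.
Qed.

Lemma sum_const n (y : R) : \sum_(i < n) y = n%:R * y.
Proof. by rewrite sumr_const card_ord mulr_natl. Qed.

(** All the lines with the same block counts as the rounded profile are close to it
    on the grid; [card_blocks_ge] and [binomial_ge] count them. *)
Lemma lines_lower F n e : profile_k m F -> (0 < n)%N -> 0 < e ->
  \forall N \near \oo, exists U : {set config N k},
    (forall al, al \in U -> al \in lines N /\ forall i j, (j <= n)%N ->
       `|fcount (al i) (j%:R / n%:R) - F i (j%:R / n%:R)| <= 2 * N%:R^-1) /\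
    expR (- (N%:R * (grid_rate m n F + e))) * #|lines N|%:R <= #|U|%:R.
Proof.
move=> pF n0 e0; have nn0 : 0 < n%:R :> R by rewrite ltr0n.
pose h := e / (4 * k.+1%:R).
have h0 : 0 < h by rewrite divr_gt0// mulr_gt0.
have kh : k%:R * h <= e / 4.
  have -> : k%:R * h = e / 4 * (k%:R / k.+1%:R) by rewrite /h; field; rewrite gt_eqF.
  by rewrite ler_piMr ?divr_ge0 ?(ltW e0)// ler_pdivrMr// mul1r ler_nat.
pose x i j := n%:R * dincr (F i) n j.
have x01 i (j : 'I_n) : 0 <= x i j <= 1 by exact: profile_dincr (pF i) (ltn_ord j).
(* How close a density has to be to [x i j] for its entropy to be close. *)
have hd (ij : 'I_k * 'I_n) : exists d, 0 < d /\ forall y, `|y - x ij.1 ij.2| <= d ->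
    binent (x ij.1 ij.2) - h <= binent y.
  have /cvgrPdist_le/(_ h h0) := @continuous_binent R (x ij.1 ij.2).
  move=> /nbhs_closedballP [d hd]; exists d%:num; split => // y hy.
  have : `|binent (x ij.1 ij.2) - binent y| <= h.
    by apply: hd; rewrite closed_ballE//= /closed_ball_ /= distrC.
  by move=> /ler_normlP[_]; lra.
have {hd}[d hd] := choice hd.
pose B := k%:R * (n%:R * (1 + h)).
near=> N.
have [N0 _] : (0 < N)%N /\ N%:R^-1 <= 1 :> R by near: N; exact: ltr_invn_near.
have NN0 : 0 < N%:R :> R by rewrite ltr0n.
have hN : forall ij, n%:R * (1 + 5 / d ij) <= N%:R.
  near: N; apply: (@filter_forall _ _ (fun ij N => n%:R * (1 + 5 / d ij) <= N%:R) \oo _) => ij.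
  exact: nbhs_infty_ger.
have hB : expR B * N.+1%:R ^+ (k * n) <= expR (N%:R * (e / 2)) by near: N; apply: expR_absorb; rewrite divr_gt0.
have hM : forall i, `|binent (m i) - binent ((nparticles N m i)%:R / N%:R)| <= h.
  by near: N; exact: binent_nparticles_near.
have [a0 ha0] := choice (fun i => round_profile N0 (pF i)).
have near0 i := round_near N0 (pF i) (ha0 i).
have [b hb] := @site_block R N n n0.
pose U := [set al : config N k | [forall i, al i \in
  [set a | [forall j, block_count b a j == block_count b (a0 i) j]]%SET]]%SET.
exists U; split.
  move=> al; rewrite finset.in_set => /forallP hal.
  have eqb i j : block_count b (al i) j = block_count b (a0 i) j.
    by have := hal i; rewrite finset.in_set => /forallP/(_ j)/eqP.
  split.
    apply/multilineP => i; rewrite (particles_blocks b) (eq_bigr _ (fun j _ => eqb i j)).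
    rewrite -particles_blocks -countN ha0// divff ?gt_eqF//.
    by have [_ -> _] := pF i.
  move=> i j jn; have -> : fcount (al i) (j%:R / n%:R) = fcount (a0 i) (j%:R / n%:R) :> R.
    elim: j jn => [|j IH] jn; first by rewrite mul0r !fcount0.
    have := congr1 (fun c : nat => c%:R : R) (eqb i (Ordinal jn)).
    rewrite !(block_count_dincr N0 n0 hb) /dincr/= (IH (ltnW jn)).
    by move/(mulfI (lt0r_neq0 NN0))/(addIr _).
  by apply: near0; exact: grid_itv.
pose c i j := block_count b (a0 i) j; pose L j := block_size b j.
have cU : \prod_(i < k) \prod_(j < n) 'C(L j, c i j)%:R <= #|U|%:R :> R.
  rewrite card_ffun_prod natr_prod; apply: ler_prod => i _.
  rewrite prodr_ge0//= -natr_prod ler_nat; exact: card_blocks_ge.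
have cE : expR (\sum_(i < k) \sum_(j < n) (L j)%:R * binent ((c i j)%:R / (L j)%:R)) <=
    N.+1%:R ^+ (k * n) * #|U|%:R :> R.
  apply: le_trans (ler_wpM2l _ cU); last by rewrite exprn_ge0.
  rewrite expR_sum mulnC exprM -[X in _ ^+ X]card_ord -prodr_const -big_split/=.
  apply: ler_prod => i _; rewrite expR_ge0/= expR_sum.
  rewrite -[X in _ ^+ X]card_ord -prodr_const -big_split/=.
  apply: ler_prod => j _; rewrite expR_ge0/=.
  apply: le_trans (binomial_ge _ (block_count_le _ _ _)) _.
  by rewrite ler_wpM2r// ler_nat ltnS; exact: block_size_le.
have term i (j : 'I_n) : N%:R / n%:R * binent (x i j) - 1 - (N%:R / n%:R + 1) * h <=
    (L j)%:R * binent ((c i j)%:R / (L j)%:R).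
  have /ler_normlP[L1 L2] := block_size_near N0 n0 hb j; rewrite -/(L j) in L1 L2.
  have [d0 hy] := hd (i, j); have := hN (i, j).
  rewrite mulrC -ler_pdivlMr// => hL.
  have L0 : 5 / d (i, j) <= (L j)%:R by lra.
  have Lp : 0 < (L j)%:R :> R by apply: lt_le_trans L0; rewrite divr_gt0.
  have cx : `|(c i j)%:R - N%:R / n%:R * x i j| <= 4.
    rewrite /c (block_count_dincr N0 n0 hb) /x.
    have -> : N%:R / n%:R * (n%:R * dincr (F i) n j) = N%:R * dincr (F i) n j.
      by rewrite mulrA divfK// gt_eqF.
    rewrite -mulrBr normrM gtr0_norm// mulrC -ler_pdivlMr// /dincr.
    have g1 := near0 i _ (@grid_itv R n j n0 (ltnW (ltn_ord j))).
    have g2 := near0 i _ (@grid_itv R n j.+1 n0 (ltn_ord j)).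
    by move: g1 g2; rewrite !ler_norml; lra.
  have /andP[x0 x1] := x01 i j.
  have close : `|(c i j)%:R / (L j)%:R - x i j| <= d (i, j).
    have -> : (c i j)%:R / (L j)%:R - x i j = ((c i j)%:R - x i j * (L j)%:R) / (L j)%:R.
      by rewrite mulrBl mulfK// gt_eqF.
    rewrite normrM [X in _ * X]gtr0_norm ?invr_gt0// ler_pdivrMr//.
    apply: (@le_trans _ _ 5); last by rewrite mulrC -ler_pdivrMr.
    have hL2 : `|x i j * ((L j)%:R - N%:R / n%:R)| <= 1.
      rewrite normrM ger0_norm//; apply: mulr_ile1 => //.
      by rewrite ler_norml; lra.
    by move: cx hL2; rewrite !ler_norml; lra.
  have hbin := hy _ close; have /andP[b0 b1] := binent_itv (x01 i j).
  apply: le_trans (ler_wpM2l (ltW Lp) hbin).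
  have q1 : 0 <= ((L j)%:R - N%:R / n%:R + 1) * binent (x i j) by rewrite mulr_ge0//; lra.
  have q2 : 0 <= (N%:R / n%:R + 1 - (L j)%:R) * h by rewrite mulr_ge0 ?(ltW h0)//; lra.
  by move: (binent (x i j)) b1 q1 q2 => /= bx b1 q1 q2; lra.
pose S := \sum_(i < k) ent_grid n (F i).
have sumE : N%:R * S - B - N%:R * (k%:R * h) <=
    \sum_(i < k) \sum_(j < n) (L j)%:R * binent ((c i j)%:R / (L j)%:R).
  apply: le_trans (ler_sum _ (fun i _ => ler_sum _ (fun j _ => term i j))).
  apply: (@le_trans _ _ (\sum_(i < k) (N%:R * ent_grid n (F i) - n%:R * (1 + h) - N%:R * h))).
    by rewrite !sumrB -mulr_sumr !sum_const -/S /B; lra.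
  apply: ler_sum => i _; rewrite !sumrB -mulr_sumr !sum_const mulr1 /ent_grid.
  have -> : n%:R * ((N%:R / n%:R + 1) * h) = N%:R * h + n%:R * h by field; rewrite gt_eqF.
  by lra.
have cl := card_lines_le m_gt0 m_le1 N; set T := \sum_(i < k) binent _ in cl.
have hT : T <= \sum_(i < k) binent (m i) + k%:R * h.
  rewrite mulr_natl -[X in _ *+ X]card_ord -sumr_const -big_split/=; apply: ler_sum => i _.
  by have /ler_normlP[h1 h2] := hM i; lra.
have gS : grid_rate m n F = \sum_(i < k) binent (m i) - S by rewrite /grid_rate /S sumrB.
have P0 : 0 < N.+1%:R ^+ (k * n) :> R by rewrite exprn_gt0.
rewrite -(ler_pM2l P0); apply: le_trans cE.
apply: (@le_trans _ _ (expR (N%:R * S - B - N%:R * (k%:R * h)))); last by rewrite ler_expR.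
rewrite -(ler_pM2l (expR_gt0 B)) mulrA.
apply: (@le_trans _ _ (expR (N%:R * (e / 2)) * (expR (- (N%:R * (grid_rate m n F + e))) * expR (N%:R * T)))).
  by rewrite ler_pM// ?mulr_ge0 ?expR_ge0// ler_wpM2l ?expR_ge0.
rewrite -!expRD ler_expR.
have : N%:R * (e / 2 - (grid_rate m n F + e) + T) <= N%:R * (S - k%:R * h).
  by rewrite ler_pM2l// gS; lra.
by lra.
Unshelve. all: by end_near. Qed.

Lemma lower_bound_near (O : set (measCk R k)) rho y : open O -> O rho ->
  (S_k m rho < y%:E)%E ->
  \forall N \near \oo, expR (- (N%:R * y)) <=
    #|[set al in lines N | empirical_k R (multiline_map al) \in O]|%:R / #|lines N|%:R.
Proof.
move=> oO Orho Sy; have [F [pF rF Fy]] := S_k_lt_frate m_gt0 m_le1 m_mono Sy.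
have [n [e [n0 e0 hn]]] := open_grid m_le1 m_mono oO Orho pF rF.
have gy : 0 < y - grid_rate m n F by have := grid_rate_le pF n0; lra.
near=> N.
have [N0 Ne] : (0 < N)%N /\ N%:R^-1 <= e / 2.
  by near: N; apply: ltr_invn_near; rewrite divr_gt0.
have [U [hU cU]] : exists U : {set config N k},
    (forall al, al \in U -> al \in lines N /\ forall i j, (j <= n)%N ->
       `|fcount (al i) (j%:R / n%:R) - F i (j%:R / n%:R)| <= 2 * N%:R^-1) /\
    expR (- (N%:R * (grid_rate m n F + (y - grid_rate m n F)))) * #|lines N|%:R <= #|U|%:R.
  by near: N; exact: lines_lower.
have l0 : 0 < #|lines N|%:R :> R by rewrite ltr0n; exact: lines_gt0.
rewrite ler_pdivlMr//; move: cU; rewrite addrC subrK => /le_trans; apply.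
rewrite ler_nat; apply/subset_leq_card/fintype.subsetP => al /hU[hal near_F].
rewrite finset.in_set hal/=; apply/mem_set; apply: (hn (fun i => fcount (al i))).
- by move=> i; exact: nondecr01_fcount.
- by move=> i j jn; apply: le_trans (near_F i j jn) _; lra.
- by move=> i; exact: empirical_le1.
- exact: (empirical_represents m_mono N0 hal).
Unshelve. all: by end_near. Qed.

End lower_bound.

(** * The large deviation principle *)

Section limits.
Variable R : realType.
Local Open Scope ereal_scope.

(** Reduces inequalities between extended reals to finite thresholds. *)
Lemma exists_real_between (a b : \bar R) : a < b -> exists y : R, a < y%:E < b.
Proof.
case: a b => [a||] [b||]//=.
- rewrite lte_fin => ab; exists ((a + b) / 2)%R; rewrite !lte_fin; apply/andP; split; lra.
- by move=> _; exists (a + 1)%R; rewrite lte_fin ltrDl ltr01 ltry.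
- by move=> _; exists (b - 1)%R; rewrite ltNyr lte_fin ltrBlDr ltrDl ltr01.
- by move=> _; exists 0%R; rewrite ltNyr ltry.
Qed.

Lemma limn_esup_le_near (u : nat -> \bar R) (x : \bar R) :
  (\forall N \near \oo, u N <= x) -> limn_esup u <= x.
Proof.
move=> h; apply: (@le_trans _ _ (ereal_sup (u @` [set N | u N <= x]))).
  by apply: ereal_inf_lbound; exists [set N | u N <= x].
by apply: ge_ereal_sup => _ [N hN <-].
Qed.

Lemma log_rate_le (T : topologicalType) (mu : nat -> set T -> R) A N (y : R) : (0 < N)%N ->
  (0 <= mu N A)%R -> (mu N A <= expR (- (N%:R * y)))%R -> log_rate mu A N <= (- y)%:E.
Proof.
move=> N0; rewrite /log_rate le_eqVlt => /orP[/eqP <- _|A0 hA]; have NN0 : (0 < N%:R :> R)%R by rewrite ltr0n.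
  by rewrite le0_lneNy// gt0_muleNy ?lte_fin ?invr_gt0// leNye.
rewrite lne_EFin// -EFinM lee_fin mulrC ler_pdivrMr//.
by rewrite -[leRHS]expRK ler_ln ?posrE ?expR_gt0// mulNr mulrC.
Qed.

Lemma log_rate_ge (T : topologicalType) (mu : nat -> set T -> R) A N (y : R) : (0 < N)%N ->
  (expR (- (N%:R * y)) <= mu N A)%R -> (- y)%:E <= log_rate mu A N.
Proof.
move=> N0 hA; have NN0 : (0 < N%:R :> R)%R by rewrite ltr0n.
have A0 : (0 < mu N A)%R by apply: lt_le_trans hA; exact: expR_gt0.
rewrite /log_rate lne_EFin// -EFinM lee_fin mulrC ler_pdivlMr//.
by rewrite -[leLHS]expRK ler_ln ?posrE ?expR_gt0// mulNr mulrC.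
Qed.

End limits.

Theorem theorem9p1 (R : realType) (k : nat) (m : 'I_k -> R)
    (k_gt0 : (0 < k)%N)
    (m_gt0 : forall i, 0 < m i)
    (m_mono : forall i j : 'I_k, (i <= j)%N -> m i <= m j)
    (m_le1 : forall i, m i <= 1)
    (P : forall N : nat, config N k -> R)
    (P_inv : forall N : nat, (0 < N)%N -> invariant_law m (P N)) :
  LDP (fun N => law_empirical (P N)) (S_k m) /\ good_rate (S_k m).
Proof.
split; last exact: S_k_good.
split.
- exact: S_k_ge0.
- exact: S_k_lsc.
- move=> C cC; rewrite leNgt; apply/negP => hlt.
  have [y /andP[hy1 hy2]] : exists y : R,
      (- ereal_inf (S_k m @` C) < y%:E < limn_esup (log_rate (fun N => law_empirical (P N)) C))%E.
    exact: exists_real_between.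
  have [z /andP[hz1 hz2]] : exists z : R, (- ereal_inf (S_k m @` C) < z%:E < y%:E)%E.
    exact: exists_real_between.
  move: hy2; rewrite ltNge => /negP; apply.
  apply: limn_esup_le_near; rewrite lte_fin in hz2.
  have zC rho : C rho -> ((- z)%:E < S_k m rho)%E.
    move=> Crho; rewrite EFinN lteNl; apply: le_lt_trans hz1.
    by rewrite leeN2; apply: ereal_inf_lbound; exists rho.
  have e0 : 0 < y - z by rewrite subr_gt0.
  have := upper_bound_near m_gt0 m_le1 m_mono cC e0 zC.
  rewrite (_ : - z - (y - z) = - y); last by ring.
  apply: filter_app; near=> N => hN.
  have N0 : (0 < N)%N by near: N; exact: nbhs_infty_gt.
  rewrite -[y]opprK; apply: log_rate_le => //.
    by rewrite (invariant_lawE N0 m_gt0 m_le1 m_mono (P_inv N N0)) divr_ge0.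
  by rewrite (invariant_lawE N0 m_gt0 m_le1 m_mono (P_inv N N0)).
- move=> O oO; rewrite /limn_einf leeN2 leNgt; apply/negP => hlt.
  have [y /andP[hy1 hy2]] : exists y : R, (ereal_inf (S_k m @` O) < y%:E <
      limn_esup (\- log_rate (fun N => law_empirical (P N)) O))%E.
    exact: exists_real_between.
  move: hy2; rewrite ltNge => /negP; apply.
  have [_ [rho Orho <-] Sy] := ereal_inf_lt hy1.
  apply: limn_esup_le_near.
  have := lower_bound_near m_gt0 m_le1 m_mono oO Orho Sy.
  apply: filter_app; near=> N => hN.
  have N0 : (0 < N)%N by near: N; exact: nbhs_infty_gt.
  rewrite leeNl -EFinN; apply: log_rate_ge => //.
  by rewrite (invariant_lawE N0 m_gt0 m_le1 m_mono (P_inv N N0)).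
Unshelve. all: by end_near. Qed.
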